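(* Let $P>0$, $Q>0$ and $\Delta\in[0,\pi/2]$, and let $C$ be the capacity of the dirty paper channel with phase fading with input power constraint $P$, interference power $Q$, and circular binomial phase fading $\Pr[\theta=+\Delta]=\Pr[\theta=-\Delta]=\tfrac12$. For $\alpha,\beta\in[0,1]$, $\bar\alpha=1-\alpha$, $\bar\beta=1-\beta$, let $$ \begin{aligned} R^{\rm IN\text{-}B}(\alpha,\beta)=\ &\tfrac12\log\!\big(1+\bar\beta P\big)+\tfrac12\log\!\left(1+\frac{\alpha\beta P}{1+\bar\alpha\beta P+\sin^2(\Delta)Q}\right)+\tfrac14\log\!\big(1+\bar\alpha\beta P\big)\\ &+\tfrac14\log\!\left(\max\left\{1,\ \frac{(\bar\alpha\beta P+1)(\bar\alpha\beta P+\sin^2(\Delta)Q+1)}{\bar\alpha\beta P+2\sin^2(\Delta)Q\,\bar\alpha\beta P+\sin^2(\Delta)Q+1}\right\}\right). \end{aligned} $$ Then $$C\ \ge\ \max_{\alpha,\beta\in[0,1]}R^{\rm IN\text{-}B}(\alpha,\beta)\ \ge\ R^{\rm IN\text{-}APP\text{-}B},$$ where $$ R^{\rm IN\text{-}APP\text{-}B}=\begin{cases} \tfrac12\log\!\big(1+\tfrac P2\big)+\tfrac12\log\!\left(1+\dfrac{P}{2+2\sin^2(\Delta)Q}\right) & \text{if }\sin^2(\Delta)Q<1,\\[6pt] \tfrac34\log\!\big(1+\tfrac P2\big)-1 & \text{if }\sin^2(\Delta)Q\ge P+1,\\[6pt] \tfrac12\log\!\big(1+\tfrac P2\big)+\tfrac12\log\!\left(\tfrac12+\dfrac{P+2}{2\sin^2(\Delta)Q}\right)+\tfrac14\log\!\big(\sin^2(\Delta)Q\big)-\tfrac54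 & \text{if }1<\sin^2(\Delta)Q<P+1. \end{cases} $$
   Context: Dirty paper channel with phase fading (DPC-PF): for channel uses $j=1,\dots,N$ the (complex) output is $Y_j=X_j+e^{i\theta_j}S_{Rj}+Z_j$, $i=\sqrt{-1}$. The complex input $X_j$ satisfies $\mathbb{E}[|X_j|^2]\le P$; the interference $S_{R1},\dots,S_{RN}$ is iid real Gaussian $\mathcal N(0,Q)$; the noise $Z_1,\dots,Z_N$ is iid circularly symmetric complex Gaussian $\mathcal{CN}(0,1)$ (zero mean, unit variance); the phases $\theta_1,\dots,\theta_N$ are iid with the given distribution; interference, noise, phases and message are mutually independent. The transmitter knows the whole sequence $S_R^N$ non-causally (before transmission) but not $\theta^N$; the receiver knows $\theta^N$ but not $S_R^N$. An encoder maps (message $W$ uniform on $\{1,\dots,2^{NR}\}$, $S_R^N$) to $X^N$, and a decoder maps $(Y^N,\theta^N)$ to an estimate of $W$. A rate $R$ is achievable if there are codes of rate $R$ with error probability tending to $0$ as $N\to\infty$; the capacity $C$ is the supremum of achievable rates. All logarithms are base 2. *)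

(* Defs.v *)
From HB Require Import structures.
From mathcomp Require Import all_boot all_order all_algebra.
From mathcomp Require Import all_classical all_reals all_analysis.
From mathcomp Require Import complex.
Set Implicit Arguments.
Unset Strict Implicit.
Unset Printing Implicit Defensive.
Import Order.TTheory GRing.Theory Num.Theory.
Local Open Scope classical_set_scope.
Local Open Scope ring_scope.

(* [R[i]] carries the sigma-algebra generated by the real and imaginary parts,
   i.e. the Borel one under the identification with R^2. *)

HB.instance Definition _ (R : realType) := isPointed.Build R[i] 0.

Definition complex_display : measure_display. Proof. exact. Qed.

Section complex_measurable.
Variable R : realType.

Let mcomplex : set (set R[i]) := g_sigma_preimageU (@complex.Re R) (@complex.Im R).

Let mcomplex0 : mcomplex set0. Proof. exact: sigma_algebra0. Qed.

Let mcomplexC A : mcomplex A -> mcomplex (~` A).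
Proof. exact: sigma_algebraC. Qed.

Let mcomplex_bigcup (F : (set R[i])^nat) :
  (forall i, mcomplex (F i)) -> mcomplex (\bigcup_i (F i)).
Proof. exact: sigma_algebra_bigcup. Qed.

HB.instance Definition _ := @isMeasurable.Build complex_display R[i]
  mcomplex mcomplex0 mcomplexC mcomplex_bigcup.

Lemma measurable_Re : measurable_fun [set: R[i]] (@complex.Re R).
Proof.
move=> _ Y mY; rewrite setTI; apply: sub_sigma_algebra; left.
by exists Y => //; rewrite setTI.
Qed.

Lemma measurable_Im : measurable_fun [set: R[i]] (@complex.Im R).
Proof.
move=> _ Y mY; rewrite setTI; apply: sub_sigma_algebra; right.
by exists Y => //; rewrite setTI.
Qed.

Definition mk_complex (x : measurableTypeR R * measurableTypeR R) : R[i] :=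
  Complex x.1 x.2.

Lemma measurable_mk_complex : measurable_fun setT mk_complex.
Proof.
apply: (@measurability _ _ _ _ _ _
  (preimage_set_system setT (@complex.Re R) measurable `|`
   preimage_set_system setT (@complex.Im R) measurable)) => //.
move=> _ [_ [[B mB <-]|[B mB <-]] <-]; rewrite !setTI.
- by have := @measurable_fst _ _ (measurableTypeR R) (measurableTypeR R) measurableT B mB; rewrite setTI.
- by have := @measurable_snd _ _ (measurableTypeR R) (measurableTypeR R) measurableT B mB; rewrite setTI.
Qed.

HB.instance Definition _ :=
  isMeasurableFun.Build _ _ _ _ mk_complex measurable_mk_complex.

End complex_measurable.

Section iid.
Context d (T : measurableType d) (R : realType) (P : probability T R).

Definition tuple_cons n (x : T * n.-tuple T) : n.+1.-tuple T :=
  [tuple of x.1 :: x.2].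

Lemma measurable_tuple_cons n : measurable_fun setT (@tuple_cons n).
Proof. exact: measurable_cons. Qed.

HB.instance Definition _ n :=
  isMeasurableFun.Build _ _ _ _ (@tuple_cons n) (@measurable_tuple_cons n).

(* Product law P x ... x P on n-tuples; [iid_rect] is its characterization on
   measurable rectangles. *)
Fixpoint iid n : probability (n.-tuple T) R :=
  match n with
  | 0 => dirac [tuple]
  | n.+1 => distribution (P \x iid n)%E (@tuple_cons n)
  end.

Lemma iid_rect n (A : 'I_n -> set T) : (forall i, measurable (A i)) ->
  iid n [set t | forall i, A i (tnth t i)] = (\prod_(i < n) P (A i))%E.
Proof.
elim: n A => [|n IH] A mA /=.
  by rewrite big_ord0 diracE mem_set// => -[].
rewrite big_ord_recl -IH; last by move=> i; exact: mA.
pose B := [set t : n.-tuple T | forall i, A (lift ord0 i) (tnth t i)].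
have mB : measurable B.
  rewrite [B](_ : _ = \bigcap_(i in [set: 'I_n])
     ((@tnth n T ^~ i) @^-1` A (lift ord0 i))); last first.
    by apply/seteqP; split=> t /= Bt i; [move=> _|]; exact: Bt.
  apply: fin_bigcap_measurable => // i _.
  by rewrite -[X in measurable X]setTI; exact: measurable_tnth.
rewrite -(product_measure1E P (iid n) (mA ord0) mB) /distribution /pushforward.
congr (product_measure1 _ _ _); apply/seteqP; split=> -[x t] /=.
  move=> At; split=> [|i /=]; first exact: (At ord0).
  by have := At (lift ord0 i); rewrite tnthS.
move=> [Ax Bt] i; case: (unliftP ord0 i) => [j ->|-> //].
by rewrite tnthS; exact: Bt.
Qed.

End iid.

Section laws.
Variable R : realType.

(* [normal_prob] takes the standard deviation, not the variance. *)
Definition gaussian (v : R) : probability (measurableTypeR R) R :=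
  normal_prob 0 (Num.sqrt v).

(* Unit variance means E|Z|^2 = 1, i.e. variance 1/2 per real component. *)
Definition circular_gaussian : probability R[i] R :=
  distribution (gaussian 2^-1 \x gaussian 2^-1)%E (@mk_complex R).

Definition sign_phase (Delta : R) (b : bool) : measurableTypeR R :=
  if b then Delta else - Delta.

Lemma measurable_sign_phase Delta : measurable_fun setT (sign_phase Delta).
Proof. by []. Qed.

HB.instance Definition _ Delta :=
  isMeasurableFun.Build _ _ _ _ (sign_phase Delta) (measurable_sign_phase Delta).

Definition circular_binomial (Delta : R) : probability (measurableTypeR R) R :=
  distribution (bernoulli_prob 2^-1) (sign_phase Delta).

End laws.

Section channel.
Variables (R : realType) (P Q : R).
Variable phase : probability (measurableTypeR R) R.
Local Notation reals N := (N.-tuple (measurableTypeR R)).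
Local Notation complexes N := (N.-tuple R[i]).

(* The encoder sees only the message and the interference, the decoder only
   the output and the phases; messages are numbered from 0. *)
Record code (M N : nat) := Code {
  enc : 'I_M -> {mfun reals N >-> complexes N} ;
  dec : (complexes N * reals N)%type -> 'I_M ;
  measurable_dec : forall w, measurable (dec @^-1` [set w]) }.

(* E|X_j|^2, the message being uniform and independent of the interference. *)
Definition input_power M N (c : code M N) (j : 'I_N) : \bar R :=
  ((M%:R^-1)%:E * \sum_(w < M)
     \int[iid (gaussian Q) N]_s
       (ComplexField.Normc.normc (tnth (enc c w s) j) ^+ 2)%:E)%E.

(* e^{it} *)
Definition cis (t : R) : R[i] := Complex (cos t) (sin t).

Definition output N (x : complexes N) (s th : reals N) (z : complexes N)
    : complexes N :=
  [tuple (tnth x j + cis (tnth th j) * ((tnth s j : R)%:C)%C + tnth z j) | j < N].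

(* Joint law of (interference, phases, noise), mutually independent. *)
Definition channel_law N
    : probability (reals N * reals N * complexes N)%type R :=
  (iid (gaussian Q) N \x iid phase N \x iid (circular_gaussian R) N)%E.

Definition error_event M N (c : code M N) (w : 'I_M)
    : set (reals N * reals N * complexes N)%type :=
  [set o | let: (s, th, z) := o in
           dec c (output (enc c w s) s th z, th) <> w].

Definition error_prob M N (c : code M N) : \bar R :=
  ((M%:R^-1)%:E * \sum_(w < M) channel_law N (error_event c w))%E.

Definition nb_messages (rate : R) (N : nat) : nat :=
  `|Num.ceil (2 `^ (N%:R * rate))|%N.

Definition achievable (rate : R) : Prop :=
  0 <= rate /\
  exists c : forall N, code (nb_messages rate N) N,
    (forall N j, (input_power (c N) j <= P%:E)%E) /\
    error_prob (c N) @[N --> \oo] --> 0%E.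

Definition capacity : \bar R :=
  ereal_sup [set rate%:E | rate in achievable].

End channel.

Section rates.
Variable R : realType.

Definition log2 (x : R) : R := ln x / ln 2.

Definition rate_IN_B (P Q Delta alpha beta : R) : R :=
  let sQ := sin Delta ^+ 2 * Q in
  let alpha' := 1 - alpha in
  let beta' := 1 - beta in
  2^-1 * log2 (1 + beta' * P)
  + 2^-1 * log2 (1 + alpha * beta * P / (1 + alpha' * beta * P + sQ))
  + 4^-1 * log2 (1 + alpha' * beta * P)
  + 4^-1 * log2 (Num.max 1
      ((alpha' * beta * P + 1) * (alpha' * beta * P + sQ + 1)
       / (alpha' * beta * P + 2 * sQ * (alpha' * beta * P) + sQ + 1))).

(* The closed form is given by cases that leave out sin(Delta)^2 Q = 1;
   [None] there records that it has no value. *)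
Definition rate_IN_APP_B (P Q Delta : R) : option R :=
  let sQ := sin Delta ^+ 2 * Q in
  if sQ < 1 then
    Some (2^-1 * log2 (1 + P / 2) + 2^-1 * log2 (1 + P / (2 + 2 * sQ)))
  else if P + 1 <= sQ then
    Some (3 / 4 * log2 (1 + P / 2) - 1)
  else if 1 < sQ < P + 1 then
    Some (2^-1 * log2 (1 + P / 2) + 2^-1 * log2 (2^-1 + (P + 2) / (2 * sQ))
          + 4^-1 * log2 sQ - 5 / 4)
  else None.

End rates.

(* Main.v *)
Require Import Defs.
From HB Require Import structures.
From mathcomp Require Import all_boot all_order all_algebra all_fingroup.
From mathcomp Require Import all_classical all_reals all_analysis.
From mathcomp Require Import measurable_realfun.
From mathcomp Require Import complex.
From mathcomp Require Import ring lra.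
Set Implicit Arguments.
Unset Strict Implicit.
Unset Printing Implicit Defensive.
Import Order.TTheory GRing.Theory Num.Theory.
Import numFieldNormedType.Exports.
Local Open Scope classical_set_scope.
Local Open Scope ring_scope.

(* The capacity bound is a Gelfand-Pinsker coding theorem: a random Gaussian
   codebook with [L] codewords per message is binned against the interference,
   and the decoder thresholds a sum of single-letter scores [l']. The codewords
   are [X1 + mu1 S] for the real part and [X2 + mu2 S] for the imaginary part,
   with independent [X1 ~ N(0, p1)], [X2 ~ N(0, p2)]; the receiver, knowing the
   phase, scores against the linear estimate of the codeword from its output.
   This achieves (in nats)
     1/2 ln (1 + 2 p1) + 1/4 ln (p2^2 / (v+ v-)),
   where [v+], [v-] are the imaginary estimation error variances for the phases
   [Delta], [- Delta]: the real part sees the same interference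
   [cos Delta * S] for both phases, which Costa's [mu1] removes.

   The noise has variance 1/2 per real dimension, so the in-phase term is
   1/2 ln (1 + 2 p1), not 1/2 ln (1 + p1) as in [rate_IN_B]. This slack pays for
   a simple scheme: all the power in phase when [(1 - beta) P] or [beta P] is at
   most 1, and otherwise the split [p1 = (1 - beta) P], [p2 = beta P] with
   [mu2 = 0] or the [mu2] that minimizes [v+ v-]. *)

(** * Integrals over tuples of independent letters *)

(** The alphabets are continuous, so typical sequences cannot be counted. Both halves of binning are
    likelihood-ratio bounds instead: a bin contains a typical codeword because, on typical pairs,
    the conditional law of the codeword has density at most [expR (N * a)] with respect to the
    codebook law; a wrong codeword is rejected by a Chernoff bound. The sample means behind
    typicality and acceptance concentrate by Chebyshev, so finite second moments suffice and the
    error terms decay like 1/N. The power constraint binds every single letter of one deterministic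
    codebook, whereas typicality controls the total power of a block. Permutation symmetry of the
    positions and averaging over exponentially many messages close this gap. In the comparison of
    rates, the slack of the in-phase term is used as (1 + 2x) / (1 + x) >= 3/2 for x >= 1. Squared,
    it lets the quadrature gain fall short by the factor 4/9, which is the origin of the 4 and 9 in
    those lemmas. *)

Section full_integrals.
Context d (T : measurableType d) (R : realType) (mu : {measure set T -> \bar R}).
Local Open Scope ereal_scope.
Implicit Types f g : T -> \bar R.

Lemma ge0_integralTZl f (k : R) : measurable_fun setT f -> (forall x, 0 <= f x) ->
  (0 <= k)%R -> \int[mu]_x (k%:E * f x) = k%:E * \int[mu]_x f x.
Proof. by move=> mf f0 k0; exact: (ge0_integralZl_EFin _ _ (fun x _ => f0 x)). Qed.

Lemma ge0_integralTD f g : measurable_fun setT f -> (forall x, 0 <= f x) ->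
  measurable_fun setT g -> (forall x, 0 <= g x) ->
  \int[mu]_x (f x + g x) = \int[mu]_x f x + \int[mu]_x g x.
Proof.
move=> mf f0 mg g0.
exact: (ge0_integralD _ _ (fun x _ => f0 x) mf (fun x _ => g0 x) mg).
Qed.

Lemma ge0_le_integralT f g : measurable_fun setT f -> (forall x, 0 <= f x) ->
  measurable_fun setT g -> (forall x, f x <= g x) ->
  \int[mu]_x f x <= \int[mu]_x g x.
Proof.
move=> mf f0 mg fg.
exact: (ge0_le_integral _ _ (fun x _ => f0 x) mf mg (fun x _ => fg x)).
Qed.

Lemma ge0_integralT_sum (I : Type) (s : seq I) (f : I -> T -> \bar R) :
  (forall i, measurable_fun setT (f i)) -> (forall i x, 0 <= f i x) ->
  \int[mu]_x (\sum_(i <- s) f i x) = \sum_(i <- s) \int[mu]_x f i x.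
Proof.
by move=> mf f0; exact: (ge0_integral_sum _ _ mf (fun i x _ => f0 i x)).
Qed.

End full_integrals.

Section tuple_integrals.
Context d (T : measurableType d) (R : realType) (P : probability T R).
Local Open Scope ereal_scope.

Lemma measurable_tuple_consf d' (T' : measurableType d') n
    (f : T' -> T) (g : T' -> n.-tuple T) :
  measurable_fun setT f -> measurable_fun setT g ->
  measurable_fun setT (fun x => tuple_cons (f x, g x)).
Proof. by move=> mf mg; exact: measurable_cons. Qed.

Lemma measurable_tuple_cons2 n x :
  measurable_fun setT (fun t : n.-tuple T => tuple_cons (x, t)).
Proof. by apply: measurable_tuple_consf. Qed.

Lemma ge0_integral_iid0 (f : 0.-tuple T -> \bar R) :
  measurable_fun setT f -> (forall t, 0 <= f t) ->
  \int[iid P 0]_t f t = f [tuple].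
Proof. by move=> mf f0; rewrite /= integral_dirac// diracT mul1e. Qed.

Lemma ge0_integral_iidS n (f : n.+1.-tuple T -> \bar R) :
  measurable_fun setT f -> (forall t, 0 <= f t) ->
  \int[iid P n.+1]_t f t =
  \int[P]_x \int[iid P n]_t f (tuple_cons (x, t)).
Proof.
move=> mf f0 /=.
have mfc := measurableT_comp mf (@measurable_tuple_cons _ T n).
rewrite (ge0_integral_distribution _ mf f0).
by rewrite (fubini_tonelli1 _ mfc (fun x => f0 _)).
Qed.

Lemma measurable_integral_snd d1 d2 (T1 : measurableType d1)
    (T2 : measurableType d2) (Q : probability T2 R) (f : T1 * T2 -> \bar R) :
  measurable_fun setT f -> (forall x, 0 <= f x) ->
  measurable_fun setT (fun x => \int[Q]_y f (x, y)).
Proof. by move=> mf f0; exact: (measurable_fun_fubini_tonelli_F _ mf f0). Qed.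

Definition tuple_upd n (t : n.-tuple T) (k : 'I_n) (a : T) : n.-tuple T :=
  [tuple if j == k then a else tnth t j | j < n].

Lemma tnth_tuple_upd n (t : n.-tuple T) k a j :
  tnth (tuple_upd t k a) j = if j == k then a else tnth t j.
Proof. by rewrite tnth_mktuple. Qed.

Lemma measurable_tuple_upd d' (T' : measurableType d') n (k : 'I_n)
    (f : T' -> n.-tuple T) (g : T' -> T) :
  measurable_fun setT f -> measurable_fun setT g ->
  measurable_fun setT (fun x => tuple_upd (f x) k (g x)).
Proof.
move=> mf mg; apply/measurable_fun_tnthP => i.
rewrite (_ : _ \o _ = if i == k then g else (tnth (T:=T) ^~ i) \o f).
  by case: ifP => // _; exact: (measurableT_comp (measurable_tnth i) mf).
by apply/funext => x /=; rewrite tnth_mktuple; case: ifP.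
Qed.

(** Resampling one letter preserves the product law. This isolates a letter while the others stay
    frozen: it yields the marginals, exchangeability, and the independence of two bins of a
    codebook. *)
Lemma ge0_integral_iid_upd n (k : 'I_n) (f : n.-tuple T -> \bar R) :
  measurable_fun setT f -> (forall t, 0 <= f t) ->
  \int[iid P n]_t f t = \int[iid P n]_t \int[P]_a f (tuple_upd t k a).
Proof.
elim: n k f => [[]//|n IH k f mf f0].
have mfu : measurable_fun setT (fun ta : n.+1.-tuple T * T =>
    f (tuple_upd ta.1 k ta.2)).
  apply: (measurableT_comp mf).
  exact: (measurable_tuple_upd k measurable_fst measurable_snd).
have mfc := measurableT_comp mf (@measurable_tuple_cons _ T n).
rewrite (ge0_integral_iidS mf f0) ge0_integral_iidS; last 2 first.
- exact: (measurable_integral_snd _ mfu (fun x => f0 _)).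
- by move=> t; apply: integral_ge0 => a _; exact: f0.
case: (unliftP ord0 k) => [j ->|->]; last first.
  have E x t a : tuple_upd (tuple_cons (x, t)) ord0 a = tuple_cons (a, t).
    apply: eq_from_tnth => i; rewrite tnth_tuple_upd.
    by case: (unliftP ord0 i) => [j ->|->] //=; rewrite !tnthS.
  under [RHS]eq_integral => x _ do under eq_integral => t _ do
    under eq_integral => a _ do rewrite E.
  rewrite integral_cst//= probability_setT mule1.
  exact: (fubini_tonelli _ mfc (fun x => f0 _)).
apply: eq_integral => x _.
have mfx := measurableT_comp mf (@measurable_tuple_cons2 n x).
rewrite (IH j _ mfx (fun x => f0 _)).
apply: eq_integral => t _; apply: eq_integral => a _ /=; congr f.
apply: eq_from_tnth => i; rewrite tnth_tuple_upd.
case: (unliftP ord0 i) => [i' ->|->] //=; rewrite !tnthS tnth_tuple_upd.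
by rewrite (inj_eq lift_inj).
Qed.

Lemma ge0_integral_iid_tnth n (k : 'I_n) (f : T -> \bar R) :
  measurable_fun setT f -> (forall x, 0 <= f x) ->
  \int[iid P n]_t f (tnth t k) = \int[P]_a f a.
Proof.
move=> mf f0.
have mfk := measurableT_comp mf (measurable_tnth (T := T) k).
rewrite (ge0_integral_iid_upd k mfk (fun x => f0 _)).
under eq_integral => t _ do under eq_integral => a _ do
  rewrite /= tnth_tuple_upd eqxx.
by rewrite integral_cst//= probability_setT mule1.
Qed.

Lemma measurable_map_tuple d' (T' : measurableType d') n (h : T -> T') :
  measurable_fun setT h -> measurable_fun setT (@map_tuple n _ _ h).
Proof.
move=> mh; apply/measurable_fun_tnthP => i.
rewrite (_ : _ \o _ = h \o (tnth (T:=T) ^~ i)).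
  exact: (measurableT_comp mh (measurable_tnth i)).
by apply/funext => t /=; rewrite tnth_map.
Qed.

(** Applied with whole blocks as letters and a swap of positions as [h]: permuting the positions
    inside every codeword of a bin preserves the law of the bin. *)
Lemma ge0_integral_iid_map n (h : T -> T) (f : n.-tuple T -> \bar R) :
  measurable_fun setT h ->
  (forall g : T -> \bar R, measurable_fun setT g -> (forall x, 0 <= g x) ->
    \int[P]_x g (h x) = \int[P]_x g x) ->
  measurable_fun setT f -> (forall t, 0 <= f t) ->
  \int[iid P n]_t f (map_tuple h t) = \int[iid P n]_t f t.
Proof.
move=> mh hP; elim: n f => [|n IH] f mf f0.
  rewrite (ge0_integral_iid0 mf f0).
  rewrite (ge0_integral_iid0 (measurableT_comp mf (measurable_map_tuple mh))
    (fun x => f0 _)) /=.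
  by congr f; apply: val_inj.
rewrite (ge0_integral_iidS mf f0).
rewrite (ge0_integral_iidS (measurableT_comp mf (measurable_map_tuple mh))
  (fun x => f0 _)) /=.
have E x t : map_tuple h (tuple_cons (x, t)) = tuple_cons (h x, map_tuple h t).
  by apply: val_inj.
under eq_integral => x _ do under eq_integral => t _ do rewrite E.
have mfc := measurableT_comp mf (@measurable_tuple_cons _ T n).
rewrite -[RHS](hP _ (measurable_integral_snd (iid P n) mfc (fun x => f0 _))).
  apply: eq_integral => x _ /=.
  exact: (IH _ (measurableT_comp mf (@measurable_tuple_cons2 n (h x))) (fun x => f0 _)).
by move=> x; apply: integral_ge0 => t _; exact: f0.
Qed.

Definition tuple_swap (U : Type) n (i j : 'I_n) (t : n.-tuple U) : n.-tuple U :=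
  [tuple tnth t (if k == i then j else if k == j then i else k) | k < n].

Lemma measurable_tuple_swap n (i j : 'I_n) :
  measurable_fun setT (@tuple_swap T n i j).
Proof.
apply/measurable_fun_tnthP => k.
set l := if k == i then j else if k == j then i else k.
rewrite (_ : _ \o _ = (tnth (T:=T) ^~ l)); first exact: measurable_tnth.
by apply/funext => t /=; rewrite tnth_mktuple.
Qed.

Lemma ge0_integral_iid_upd2 n (a b : 'I_n) (g : n.-tuple T -> \bar R) :
  measurable_fun setT g -> (forall t, 0 <= g t) ->
  \int[iid P n]_t g t = \int[iid P n]_t \int[P]_x \int[P]_y
    g (tuple_upd (tuple_upd t a x) b y).
Proof.
move=> mg g0; rewrite (ge0_integral_iid_upd b mg g0).
have mgb : measurable_fun setT (fun ta : n.-tuple T * T =>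
    g (tuple_upd ta.1 b ta.2)).
  apply: (measurableT_comp mg).
  exact: (measurable_tuple_upd b measurable_fst measurable_snd).
rewrite (ge0_integral_iid_upd a (measurable_integral_snd P mgb (fun x => g0 _)))//.
by move=> t; apply: integral_ge0 => y _; exact: g0.
Qed.

Lemma ge0_integral_iid_swap n (i j : 'I_n) (f : n.-tuple T -> \bar R) :
  measurable_fun setT f -> (forall t, 0 <= f t) ->
  \int[iid P n]_t f (tuple_swap i j t) = \int[iid P n]_t f t.
Proof.
move=> mf f0.
have [->|ij] := eqVneq i j.
  apply: eq_integral => t _; congr f; apply: eq_from_tnth => k.
  by rewrite tnth_mktuple; case: eqVneq => // ->.
have mfs := measurableT_comp mf (measurable_tuple_swap i j).
(* The two letters are resampled in opposite orders on the two sides, after which the integrands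
   coincide. *)
rewrite (ge0_integral_iid_upd2 i j mfs (fun x => f0 _)).
rewrite [RHS](ge0_integral_iid_upd2 j i mf f0).
apply: eq_integral => t _; apply: eq_integral => x _; apply: eq_integral => y _ /=.
congr f; apply: eq_from_tnth => k; rewrite tnth_mktuple !tnth_tuple_upd.
case: (eqVneq k i) => [ki|ki]; first by rewrite eqxx.
case: (eqVneq k j) => [kj|kj]; first by rewrite (negbTE ij) eqxx.
by rewrite (negbTE ki) (negbTE kj).
Qed.

End tuple_integrals.

(** Passes from a pair of independent blocks, the form in which the channel is given, to a block of
    independent pairs, the form to which the weak law applies. *)
Lemma ge0_integral_iid_prod d d' (S : measurableType d) (T : measurableType d')
    (R : realType) (P : probability S R) (Q : probability T R) n
    (f : n.-tuple S * n.-tuple T -> \bar R) :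
  measurable_fun setT f -> (forall x, 0 <= f x)%E ->
  (\int[iid P n]_s \int[iid Q n]_t f (s, t) =
   \int[iid (P \x Q) n]_w f (map_tuple fst w, map_tuple snd w))%E.
Proof.
elim: n f => [|n IH] f mf f0.
  have mfm := measurableT_comp mf (measurable_fun_pair
    (measurable_map_tuple (n := 0) measurable_fst)
    (measurable_map_tuple (n := 0) measurable_snd)).
  rewrite (ge0_integral_iid0 _ mfm (fun x => f0 _)).
  rewrite (ge0_integral_iid0 _ (measurable_integral_snd (iid Q 0) mf f0)); last first.
    by move=> t; apply: integral_ge0 => s _; exact: f0.
  rewrite (ge0_integral_iid0 _ (measurable_fun_pair2 _ mf) (fun x => f0 _)) /=.
  by congr (f (_, _)); apply: val_inj.
have mc2 := @measurable_tuple_cons2.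
have mfm := measurableT_comp mf (measurable_fun_pair
  (measurable_map_tuple (n := n.+1) measurable_fst)
  (measurable_map_tuple (n := n.+1) measurable_snd)).
have mc x y : measurable_fun setT (fun st : n.-tuple S * n.-tuple T =>
    f (tuple_cons (x, st.1), tuple_cons (y, st.2))).
  apply: (measurableT_comp mf); apply: measurable_fun_pair.
    exact: (measurableT_comp (mc2 _ _ _ x) measurable_fst).
  exact: (measurableT_comp (mc2 _ _ _ y) measurable_snd).
rewrite (ge0_integral_iidS _ (measurable_integral_snd (iid Q n.+1) mf f0)); last first.
  by move=> t; apply: integral_ge0 => s _; exact: f0.
rewrite (ge0_integral_iidS _ mfm (fun x => f0 _)).
have mfc := measurableT_comp mfm (@measurable_tuple_cons _ _ n).
transitivity (\int[P]_x \int[Q]_y \int[iid P n]_s \int[iid Q n]_t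
    f (tuple_cons (x, s), tuple_cons (y, t)))%E.
  apply: eq_integral => x _.
  under eq_integral => s _ do
    rewrite (ge0_integral_iidS _ (measurable_fun_pair2 _ mf) (fun x => f0 _)).
  have mg : measurable_fun setT (fun w : n.-tuple S * T * n.-tuple T =>
      f (tuple_cons (x, w.1.1), tuple_cons (w.1.2, w.2))).
    apply: (measurableT_comp mf); apply: measurable_fun_pair.
      apply: (measurableT_comp (mc2 _ _ _ x)).
      exact: (measurableT_comp measurable_fst measurable_fst).
    apply: measurable_tuple_consf => //.
    exact: (measurableT_comp measurable_snd measurable_fst).
  rewrite (fubini_tonelli _ (measurable_integral_snd (iid Q n) mg (fun x => f0 _)))//.
  by move=> y; apply: integral_ge0 => t _; exact: f0.
under eq_integral => x _ do under eq_integral => y _ do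
  rewrite (IH _ (mc x y) (fun x => f0 _)).
rewrite (fubini_tonelli1 _ (measurable_integral_snd (iid (P \x Q)%E n) mfc (fun x => f0 _))); last first.
  by move=> w; apply: integral_ge0 => t _; exact: f0.
apply: eq_integral => x _; apply: eq_integral => y _.
apply: eq_integral => t _ /=.
by congr (f (_, _)); apply: val_inj.
Qed.

Lemma measurable_sum_tnth d (T : measurableType d) (R : realType) n
    (g : 'I_n -> T -> R) : (forall i, measurable_fun setT (g i)) ->
  measurable_fun setT (fun t : n.-tuple T => \sum_(i < n) g i (tnth t i)).
Proof.
move=> mg; apply: measurable_sum => i; apply: measurableT_comp => //.
exact: measurable_tnth.
Qed.

Lemma measurable_expR_sum_tnth d (T : measurableType d) (R : realType) n
    (g : 'I_n -> T -> R) : (forall i, measurable_fun setT (g i)) ->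
  measurable_fun setT
    (fun t : n.-tuple T => (expR (\sum_(i < n) g i (tnth t i)))%:E).
Proof.
move=> mg; apply/measurable_EFinP.
apply: (measurableT_comp (@measurable_expR R)); exact: measurable_sum_tnth.
Qed.

(** The exponential moment factors over the letters; this feeds the Chernoff bound of
    [gp_packing]. *)
Lemma integral_iid_expR_le1 d (T : measurableType d) (R : realType)
    (P : probability T R) n (g : 'I_n -> T -> R) :
  (forall i, measurable_fun setT (g i)) ->
  (forall i, \int[P]_x (expR (g i x))%:E <= 1)%E ->
  (\int[iid P n]_t (expR (\sum_(i < n) g i (tnth t i)))%:E <= 1)%E.
Proof.
elim: n g => [|n IH] g mg g1.
  rewrite (ge0_integral_iid0 _ (measurable_expR_sum_tnth mg)).
    by rewrite big_ord0 expR0.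
  by move=> t; rewrite lee_fin expR_ge0.
have e0 x : (0 <= (expR x)%:E :> \bar R)%E by rewrite lee_fin expR_ge0.
rewrite (ge0_integral_iidS _ (measurable_expR_sum_tnth mg) (fun x => e0 _)).
have mS := measurable_expR_sum_tnth (fun i => mg (lift ord0 i)).
have E x t : ((expR (\sum_(i < n.+1) g i (tnth (tuple_cons (x, t)) i)))%:E =
    (expR (g ord0 x))%:E *
    (expR (\sum_(i < n) g (lift ord0 i) (tnth t i)))%:E)%E.
  rewrite big_ord_recl expRD EFinM.
  by congr (_ * (expR _)%:E)%E; apply: eq_bigr => i _; rewrite tnthS.
apply: le_trans (g1 ord0); apply: ge0_le_integral => //.
- by move=> x _; apply: integral_ge0.
- have mc := measurableT_comp (measurable_expR_sum_tnth mg) (@measurable_tuple_cons _ T n).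
  exact: (measurable_integral_snd (iid P n) mc (fun x => e0 _)).
- apply/measurable_EFinP; exact: (measurableT_comp (@measurable_expR R) (mg ord0)).
- move=> x _; under eq_integral => t _ do rewrite E.
  rewrite (ge0_integralTZl _ mS (fun t => e0 _) (expR_ge0 _)).
  rewrite -[leRHS]mule1 lee_pmul//; first exact: integral_ge0.
  exact: (IH (fun i => g (lift ord0 i))).
Qed.

Section change_of_measure.
Context d1 d2 d3 (U : measurableType d1) (V : measurableType d2)
  (S : measurableType d3) (R : realType).
Variables (PU : probability U R) (PV : probability V R).
Variables (phi : V * S -> U) (w : U * S -> R).
Hypothesis mphi : measurable_fun setT phi.
Hypothesis mw : measurable_fun setT w.
Hypothesis phiP : forall s (F : U -> \bar R), measurable_fun setT F ->
  (forall u, 0 <= F u)%E ->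
  (\int[PV]_v F (phi (v, s)) = \int[PU]_u ((expR (w (u, s)))%:E * F u))%E.

Definition tuple_map2 (A B C : Type) (f : A * B -> C) n (v : n.-tuple A)
  (s : n.-tuple B) : n.-tuple C := [tuple f (tnth v i, tnth s i) | i < n].

Lemma tuple_map2_cons (A B C : Type) (f : A * B -> C) n a (v : n.-tuple A) b
    (s : n.-tuple B) :
  tuple_map2 f [tuple of a :: v] [tuple of b :: s] =
  [tuple of f (a, b) :: tuple_map2 f v s].
Proof.
apply: eq_from_tnth => i; rewrite tnth_mktuple.
by case: (unliftP ord0 i) => [j ->|->] //; rewrite !tnthS tnth_mktuple.
Qed.

Lemma measurable_tuple_map2 d d' d4 (A : measurableType d)
    (B : measurableType d') (C : measurableType d4) (f : A * B -> C) n :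
  measurable_fun setT f ->
  measurable_fun setT (fun x : n.-tuple A * n.-tuple B => tuple_map2 f x.1 x.2).
Proof.
move=> mf; apply/measurable_fun_tnthP => i.
rewrite (_ : _ \o _ = fun x => f (tnth x.1 i, tnth x.2 i)).
  apply: (measurableT_comp mf); apply: measurable_fun_pair;
    by apply: (measurableT_comp (measurable_tnth i)).
by apply/funext => x /=; rewrite tnth_mktuple.
Qed.

(** Likelihood ratios multiply over independent letters, so the letterwise change of measure holds
    for blocks with [s] fixed. *)
Lemma ge0_integral_iid_change n (s : n.-tuple S) (F : n.-tuple U -> \bar R) :
  measurable_fun setT F -> (forall u, 0 <= F u)%E ->
  (\int[iid PV n]_v F (tuple_map2 phi v s) =
   \int[iid PU n]_u ((expR (\sum_(i < n) w (tnth u i, tnth s i)))%:E * F u))%E.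
Proof.
have e0 x : (0 <= (expR x)%:E :> \bar R)%E by rewrite lee_fin expR_ge0.
have mexp m (s' : m.-tuple S) := @measurable_expR_sum_tnth _ U R m
  (fun i u => w (u, tnth s' i)) (fun i => measurable_fun_pair1 _ mw).
have mmap m (s' : m.-tuple S) := measurable_fun_pair1 s' (measurable_tuple_map2 (n := m) mphi).
elim: n s F => [|n IH] s F mF F0.
  rewrite (ge0_integral_iid0 _ (measurableT_comp mF (mmap _ s)) (fun x => F0 _)).
  rewrite (ge0_integral_iid0 _ (emeasurable_funM (mexp _ s) mF)
    (fun u => mule_ge0 (e0 _) (F0 u))).
  by rewrite /= big_ord0 expR0 mul1e; congr F; apply: eq_from_tnth => -[].
rewrite (ge0_integral_iidS _ (measurableT_comp mF (mmap _ s)) (fun x => F0 _)).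
rewrite (ge0_integral_iidS _ (emeasurable_funM (mexp _ s) mF)
    (fun u => mule_ge0 (e0 _) (F0 u))).
case: s / tupleP => b s.
have E v v' : tuple_map2 phi (tuple_cons (v, v')) [tuple of b :: s] =
   tuple_cons (phi (v, b), tuple_map2 phi v' s) by exact: tuple_map2_cons.
under eq_integral => x _ do under eq_integral => t _ do rewrite /= E.
have mFc := measurableT_comp mF (@measurable_tuple_cons _ U n).
have mFs u := measurableT_comp mF (@measurable_tuple_cons2 _ U n u).
have mG0 : measurable_fun setT (fun ut : U * n.-tuple U =>
    (expR (\sum_(i < n) w (tnth ut.2 i, tnth s i)))%:E * F (tuple_cons ut))%E.
  exact: (emeasurable_funM (measurableT_comp (mexp _ s) measurable_snd) mFc).
have mG := measurable_integral_snd (iid PU n) mG0 (fun u => mule_ge0 (e0 _) (F0 _)).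
transitivity (\int[PU]_u ((expR (w (u, b)))%:E *
  \int[iid PU n]_t ((expR (\sum_(i < n) w (tnth t i, tnth s i)))%:E *
    F (tuple_cons (u, t)))))%E.
  rewrite -(phiP _ mG); last first.
    by move=> u; apply: integral_ge0 => t _; rewrite mule_ge0.
  by apply: eq_integral => v _; rewrite -(IH s _ (mFs (phi (v, b))) (fun x => F0 _)).
apply: eq_integral => u _.
rewrite -(ge0_integralTZl _ (emeasurable_funM (mexp _ s) (mFs u))
  (fun t => mule_ge0 (e0 _) (F0 _)) (expR_ge0 _)).
apply: eq_integral => t _ /=; rewrite muleA -EFinM -expRD big_ord_recl.
by congr ((expR (_ + _))%:E * _)%E; apply: eq_bigr => i _; rewrite !tnthS.
Qed.

End change_of_measure.

(** * Square-integrable functions with a given mean *)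

(** A finite second moment gives both integrability and Chebyshev's bound. The class is stable under
    linear combinations and under products of independent factors, which is how the means of the
    scores are assembled. *)
Definition L2mean d (T : measurableType d) (R : realType)
    (P : probability T R) (f : T -> R) (m : R) : Prop :=
  [/\ measurable_fun setT f, (\int[P]_x ((f x) ^+ 2)%:E < +oo)%E &
      (\int[P]_x (f x)%:E = m%:E)%E].

Lemma measurable_sqr_EFin d (T : measurableType d) (R : realType) (f : T -> R) :
  measurable_fun setT f -> measurable_fun setT (fun x => ((f x) ^+ 2)%:E).
Proof. by move=> mf; apply/measurable_EFinP; exact: measurable_funX. Qed.

Lemma sqr_EFin_ge0 (R : realType) (a : R) : (0 <= (a ^+ 2)%:E :> \bar R)%E.
Proof. by rewrite lee_fin sqr_ge0. Qed.

Lemma normM_le_sqrD (R : realFieldType) (a b : R) : `|a * b| <= a ^+ 2 + b ^+ 2.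
Proof.
rewrite ler_norml; have := sqr_ge0 (a - b); have := sqr_ge0 (a + b).
by move=> h1 h2; apply/andP; split; nra.
Qed.

Section L2mean.
Context d (T : measurableType d) (R : realType) (P : probability T R).
Implicit Types (f g : T -> R) (m k : R).

Lemma integrable_sqr f : measurable_fun setT f ->
  (\int[P]_x ((f x) ^+ 2)%:E < +oo)%E ->
  P.-integrable setT (fun x => ((f x) ^+ 2)%:E).
Proof.
move=> mf foo; apply/integrableP; split; first exact: measurable_sqr_EFin.
by under eq_integral do rewrite /= ger0_norm ?sqr_ge0//.
Qed.

Lemma sqr_integrable_mul f g : measurable_fun setT f -> measurable_fun setT g ->
  (\int[P]_x ((f x) ^+ 2)%:E < +oo)%E -> (\int[P]_x ((g x) ^+ 2)%:E < +oo)%E ->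
  P.-integrable setT (fun x => (f x * g x)%:E).
Proof.
move=> mf mg f2 g2.
have mfg : measurable_fun setT (fun x => (f x * g x)%:E).
  by apply/measurable_EFinP; exact: measurable_funM.
apply: (le_integrable measurableT mfg _
  (integrableD measurableT (integrable_sqr mf f2) (integrable_sqr mg g2))).
move=> x _; rewrite -EFinD !abse_EFin lee_fin.
by rewrite [leRHS]ger0_norm ?addr_ge0 ?sqr_ge0//; exact: normM_le_sqrD.
Qed.

Lemma integral_cst_prob (c : R) : (\int[P]_x c%:E = c%:E)%E.
Proof. by rewrite integral_cst//= probability_setT mule1. Qed.

Lemma sqr_cst_ltey (c : R) : (\int[P]_x ((cst c x) ^+ 2)%:E < +oo)%E.
Proof. by rewrite (integral_cst_prob (c ^+ 2)) ltry. Qed.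

Lemma L2mean_integrable f m : L2mean P f m -> P.-integrable setT (fun x => (f x)%:E).
Proof.
case=> mf f2 _; rewrite (_ : (fun x => _) = fun x => (f x * cst 1 x)%:E).
  exact: (sqr_integrable_mul mf (measurable_cst _) f2 (sqr_cst_ltey 1)).
by apply/funext => x; rewrite /= mulr1.
Qed.

Lemma L2mean_cst c : L2mean P (cst c) c.
Proof.
split; [exact: measurable_cst|exact: sqr_cst_ltey|exact: integral_cst_prob].
Qed.

Lemma L2meanZ c f m : L2mean P f m -> L2mean P (fun x => c * f x) (c * m).
Proof.
move=> fm; have fi := L2mean_integrable fm; case: fm => mf f2 fE; split.
- exact: measurable_funM (measurable_cst _) mf.
- under eq_integral do rewrite exprMn EFinM.
  rewrite (ge0_integralTZl _ (measurable_sqr_EFin mf) (fun x => sqr_EFin_ge0 _) (sqr_ge0 _)).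
  by rewrite lte_mul_pinfty// lee_fin sqr_ge0.
- under eq_integral do rewrite EFinM.
  by rewrite (integralZl measurableT fi) fE -EFinM.
Qed.

Lemma L2meanD f g m k : L2mean P f m -> L2mean P g k ->
  L2mean P (fun x => f x + g x) (m + k).
Proof.
move=> fm gk; have fi := L2mean_integrable fm; have gi := L2mean_integrable gk.
case: fm gk => mf f2 fE [mg g2 gE].
have mf2 := measurable_sqr_EFin mf; have mg2 := measurable_sqr_EFin mg.
have mfg : measurable_fun setT (fun x => f x + g x) by exact: measurable_funD mf mg.
split; first exact: mfg.
- have m2f (h : T -> R) : measurable_fun setT h ->
    measurable_fun setT (fun x => 2%:E * ((h x) ^+ 2)%:E)%E.
    by move=> mh; apply: measurable_funeM; exact: measurable_sqr_EFin.
  have m20 (h : T -> R) x : (0 <= 2%:E * ((h x) ^+ 2)%:E)%E.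
    by rewrite -EFinM lee_fin mulr_ge0// sqr_ge0.
  apply: (@le_lt_trans _ _
    (\int[P]_x (2%:E * ((f x) ^+ 2)%:E + 2%:E * ((g x) ^+ 2)%:E)%E)%E).
    apply: (ge0_le_integralT _ (measurable_sqr_EFin mfg) (fun x => sqr_EFin_ge0 _)).
      exact: emeasurable_funD (m2f _ mf) (m2f _ mg).
    move=> x; rewrite -!EFinM -EFinD lee_fin.
    by have := sqr_ge0 (f x - g x); nra.
  rewrite (ge0_integralTD _ (m2f _ mf) (m20 f) (m2f _ mg) (m20 g)).
  rewrite !ge0_integralTZl//; try by move=> x; exact: sqr_EFin_ge0.
  by apply: lte_add_pinfty; rewrite lte_mul_pinfty.
- under eq_integral do rewrite EFinD.
  by rewrite (integralD measurableT fi gi) fE gE -EFinD.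
Qed.

Lemma eq_L2mean f g m k : f =1 g -> m = k -> L2mean P f m -> L2mean P g k.
Proof. by move=> /funext -> ->. Qed.

Lemma bounded_L2mean f (B m : R) : measurable_fun setT f ->
  (forall x, `|f x| <= B) -> (\int[P]_x (f x)%:E = m%:E)%E -> L2mean P f m.
Proof.
move=> mf fB fE; split; [exact: mf| |exact: fE].
apply: (@le_lt_trans _ _ (\int[P]_x (B ^+ 2)%:E)%E); last first.
  by rewrite integral_cst_prob ltry.
apply: (ge0_le_integralT _ (measurable_sqr_EFin mf) (fun x => sqr_EFin_ge0 _)).
  exact: measurable_cst.
move=> x; rewrite lee_fin -(real_normK (num_real (f x))).
by rewrite lerXn2r// nnegrE// (le_trans _ (fB x)).
Qed.

End L2mean.

Lemma L2mean_distribution d d' (T : measurableType d) (T' : measurableType d')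
    (R : realType) (P : probability T R) (X : {mfun T >-> T'}) (f : T' -> R) m :
  measurable_fun setT f -> L2mean P (f \o X) m -> L2mean (distribution P X) f m.
Proof.
move=> mf fm; have fi := L2mean_integrable fm; case: fm => mfX f2 fE; split.
- exact: mf.
- by rewrite (ge0_integral_distribution _ (measurable_sqr_EFin mf) (fun x => sqr_EFin_ge0 _)).
- have mfE : measurable_fun setT (fun x => (f x)%:E) by exact/measurable_EFinP.
  by rewrite (integral_distribution mfE).
Qed.

Section L2mean_prod.
Context d d' (T : measurableType d) (T' : measurableType d') (R : realType)
  (P : probability T R) (Q : probability T' R).

Lemma L2mean_prod (f : T -> R) (g : T' -> R) (m k : R) :
  L2mean P f m -> L2mean Q g k ->
  L2mean (P \x Q)%E (fun x => f x.1 * g x.2) (m * k).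
Proof.
move=> fm gk; have fi := L2mean_integrable fm; have gi := L2mean_integrable gk.
case: fm gk => mf f2 fE [mg g2 gE].
have mf2 := measurable_sqr_EFin mf; have mg2 := measurable_sqr_EFin mg.
have s0 := @sqr_EFin_ge0 R.
have mfg : measurable_fun setT (fun x : T * T' => f x.1 * g x.2).
  exact: (measurable_funM (measurableT_comp mf measurable_fst)
   (measurableT_comp mg measurable_snd)).
have fg2 : (\int[P \x Q]_x ((f x.1 * g x.2) ^+ 2)%:E < +oo)%E.
  rewrite (fubini_tonelli1 _ (measurable_sqr_EFin mfg) (fun x => s0 _)) /fubini_F /=.
  under eq_integral => x _.
    under eq_integral do rewrite exprMn EFinM.
    rewrite (ge0_integralTZl _ mg2 (fun x => s0 _) (sqr_ge0 _)).
    over.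
  have Qfin : (\int[Q]_x (g x ^+ 2)%:E)%E \is a fin_num.
    by rewrite ge0_fin_numE// integral_ge0.
  rewrite -(fineK Qfin).
  under eq_integral do rewrite muleC.
  rewrite (ge0_integralTZl _ mf2 (fun x => s0 _)); last first.
    by rewrite fine_ge0// integral_ge0.
  by rewrite lte_mul_pinfty// lee_fin fine_ge0// integral_ge0.
split; [exact: mfg|exact: fg2|].
have ifg : (P \x Q)%E.-integrable setT (fun x => (f x.1 * g x.2)%:E).
  (* Integrability is needed before the mean is known, so [L2mean] is used with the integral itself
     as the mean. *)
  have /L2mean_integrable : L2mean (P \x Q)%E (fun x => f x.1 * g x.2)
     (fine (\int[P \x Q]_x (f x.1 * g x.2)%:E)%E); last by [].
  split; [exact: mfg|exact: fg2|].
  rewrite fineK//; apply: integrable_fin_num => //.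
  rewrite (_ : (fun x => _) = fun x => ((f x.1 * g x.2) * cst 1 x)%:E); last first.
    by apply/funext => x; rewrite /= mulr1.
  exact: (sqr_integrable_mul mfg (measurable_cst _) fg2 (sqr_cst_ltey _ 1)).
rewrite -(integral12_prod_meas1 ifg) /fubini_F /=.
under eq_integral => x _.
  under eq_integral do rewrite EFinM.
  rewrite (integralZl measurableT gi) gE muleC.
  over.
by rewrite (integralZl measurableT fi) fE -EFinM mulrC.
Qed.

Lemma L2mean_fst (f : T -> R) m : L2mean P f m ->
  L2mean (P \x Q)%E (fun x => f x.1) m.
Proof.
move=> fm; apply: eq_L2mean (L2mean_prod fm (L2mean_cst Q 1)) => [x|] /=;
  by rewrite mulr1.
Qed.

Lemma L2mean_snd (g : T' -> R) m : L2mean Q g m ->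
  L2mean (P \x Q)%E (fun x => g x.2) m.
Proof.
move=> gm; apply: eq_L2mean (L2mean_prod (L2mean_cst P 1) gm) => [x|] /=;
  by rewrite mul1r.
Qed.

End L2mean_prod.

Section iid_sums.
Context d (T : measurableType d) (R : realType) (P : probability T R).
Variables (f : T -> R) (v : R).
Hypothesis fm : L2mean P f 0.
Hypothesis fv : (\int[P]_x ((f x) ^+ 2)%:E = v%:E)%E.

Let s0 := @sqr_EFin_ge0 R.
Let mf : measurable_fun setT f. Proof. by case: fm. Qed.

(** The variances add because the cross term is a product of independent factors of mean 0. *)
Lemma L2mean_iid_sum n :
  L2mean (iid P n) (fun t => \sum_(i < n) f (tnth t i)) 0 /\
  (\int[iid P n]_t ((\sum_(i < n) f (tnth t i)) ^+ 2)%:E = (n%:R * v)%:E)%E.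
Proof.
elim: n => [|n [Sm Sv]].
  have e t : \sum_(i < 0) f (tnth t i) = cst 0 t by rewrite big_ord0.
  split; first by apply: eq_L2mean (L2mean_cst _ 0) => // t; rewrite e.
  under eq_integral do rewrite e expr0n/=.
  by rewrite integral_cst_prob mul0r.
have mS m : measurable_fun setT (fun t : m.-tuple T => \sum_(i < m) f (tnth t i)).
  by apply: (@measurable_sum_tnth _ _ _ _ (fun=> f)) => _; exact: mf.
have E (x : T * n.-tuple T) : \sum_(i < n.+1) f (tnth (tuple_cons x) i) =
    f x.1 + \sum_(i < n) f (tnth x.2 i).
  rewrite big_ord_recl; congr (_ + _).
  by apply: eq_bigr => i _; rewrite tnthS.
split.
  apply: L2mean_distribution; first exact: mS.
  apply: eq_L2mean (L2meanD (L2mean_fst (iid P n) fm) (L2mean_snd P Sm)) => [x|].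
    by rewrite /= E.
  by rewrite addr0.
rewrite /= (ge0_integral_distribution _ (measurable_sqr_EFin (mS _)) (fun x => s0 _)).
have m1 : measurable_fun setT (fun x : T * n.-tuple T => f x.1).
  exact: (measurableT_comp mf measurable_fst).
have m2 : measurable_fun setT (fun x : T * n.-tuple T => \sum_(i < n) f (tnth x.2 i)).
  exact: (measurableT_comp (mS n) measurable_snd).
have I1 : (\int[P \x iid P n]_x ((f x.1) ^+ 2)%:E = v%:E)%E.
  rewrite (fubini_tonelli1 _ (measurable_sqr_EFin m1) (fun x => s0 _)) /fubini_F /=.
  by under eq_integral do rewrite integral_cst_prob.
have I2 : (\int[P \x iid P n]_x ((\sum_(i < n) f (tnth x.2 i)) ^+ 2)%:E =
   (n%:R * v)%:E)%E.
  rewrite (fubini_tonelli1 _ (measurable_sqr_EFin m2) (fun x => s0 _)) /fubini_F /=.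
  by rewrite Sv integral_cst_prob.
have [_ _ I12] := L2mean_prod fm Sm.
have i1 : (P \x iid P n)%E.-integrable setT (fun x => ((f x.1) ^+ 2)%:E).
  by apply: (integrable_sqr m1); rewrite I1 ltry.
have i2 : (P \x iid P n)%E.-integrable setT
    (fun x => ((\sum_(i < n) f (tnth x.2 i)) ^+ 2)%:E).
  by apply: (integrable_sqr m2); rewrite I2 ltry.
have i12 := L2mean_integrable (L2meanZ 2 (L2mean_prod fm Sm)).
have [_ _ I12'] := L2meanZ 2 (L2mean_prod fm Sm).
transitivity (\int[P \x iid P n]_x (((f x.1) ^+ 2)%:E +
   (((\sum_(i < n) f (tnth x.2 i)) ^+ 2)%:E +
    (2 * (f x.1 * \sum_(i < n) f (tnth x.2 i)))%:E)))%E.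
  apply: eq_integral => x _; rewrite /= E -!EFinD; congr EFin.
  by rewrite sqrrD mulr_natl addrAC -addrA.
have iD := integrableD measurableT i2 i12.
rewrite (integralD measurableT i1 iD) (integralD measurableT i2 i12).
rewrite I1 I2 I12' -!EFinD; congr EFin.
by rewrite !mulr0 addr0 -addn1 natrD mulrDl mul1r addrC.
Qed.

End iid_sums.

(** * Chebyshev's inequality and the weak law of large numbers *)

Section weak_law.
Context d (T : measurableType d) (R : realType) (P : probability T R).

Lemma sqr_integral_fin (f : T -> R) : (\int[P]_x ((f x) ^+ 2)%:E < +oo)%E ->
  exists2 v, 0 <= v & (\int[P]_x ((f x) ^+ 2)%:E = v%:E)%E.
Proof.
move=> f2; exists (fine (\int[P]_x ((f x) ^+ 2)%:E)%E).
  by apply: fine_ge0; apply: integral_ge0 => x _; exact: sqr_EFin_ge0.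
rewrite fineK// ge0_fin_numE//.
by apply: integral_ge0 => x _; exact: sqr_EFin_ge0.
Qed.

Lemma markov_sqr (f : T -> R) (a v : R) : measurable_fun setT f -> 0 <= a ->
  (\int[P]_x ((f x) ^+ 2)%:E = v%:E)%E ->
  ((a ^+ 2)%:E * P [set x | (a <= `|f x|)%R] <= v%:E)%E.
Proof.
move=> mf a0 fv.
have mA : measurable [set x | a <= `|f x|].
  rewrite -[X in measurable X]setTI; apply: measurable_fun_le => //.
  exact: measurableT_comp.
rewrite -[X in P X]setIT -(integral_indic P measurableT mA) -fv.
have mi : measurable_fun setT (fun x => (\1_[set x | a <= `|f x|] x)%:E : \bar R).
  by apply/measurable_EFinP; exact: measurable_indic.
rewrite -(ge0_integralTZl _ mi)//; last exact: sqr_ge0.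
apply: ge0_le_integralT.
- exact: measurable_funeM.
- by move=> x; rewrite -EFinM lee_fin mulr_ge0// sqr_ge0.
- exact: measurable_sqr_EFin.
- move=> x; rewrite -EFinM lee_fin indicE.
  case: (boolP (x \in _)) => [|_]; last by rewrite mulr0 sqr_ge0.
  rewrite inE /= mulr1 => /(lerXn2r 2) => /(_ _ _)/le_trans; apply.
  - by rewrite nnegrE.
  - by rewrite nnegrE.
  - by rewrite real_normK// num_real.
Qed.

End weak_law.

(** [K] is the variance of [f]. It depends on neither [n] nor [delta], so all deviation
    probabilities can later be collected into one constant over the block length. *)
Lemma weak_law d (T : measurableType d) (R : realType) (P : probability T R)
    (f : T -> R) (m : R) : L2mean P f m ->
  exists2 K, 0 <= K & forall n (delta : R), (0 < n)%N -> 0 < delta ->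
  (iid P n [set t | (n%:R * delta <= `|\sum_(i < n) f (tnth t i) - n%:R * m|)%R]
    <= (K / (n%:R * delta ^+ 2))%:E)%E.
Proof.
move=> fm.
have gm : L2mean P (fun x => f x - m) 0.
  by apply: eq_L2mean (L2meanD fm (L2mean_cst P (- m))) => //; rewrite subrr.
have [_ g2 _] := gm; have [v v0 gv] := sqr_integral_fin g2.
exists v => // n delta n0 d0.
have [[mS _ _] Sv] := L2mean_iid_sum gm gv n.
have n0' : (0 : R) < n%:R by rewrite ltr0n.
have nd0 : 0 < n%:R * delta by rewrite mulr_gt0.
have := markov_sqr mS (ltW nd0) Sv.
have -> : [set t : n.-tuple T | n%:R * delta <= `|\sum_(i < n) (f (tnth t i) - m)|] =
  [set t | n%:R * delta <= `|\sum_(i < n) f (tnth t i) - n%:R * m|].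
  have E t : \sum_(i < n) (f (tnth t i) - m) = \sum_(i < n) f (tnth t i) - n%:R * m.
    by rewrite sumrB sumr_const card_ord mulr_natl.
  by apply/seteqP; split=> t /=; rewrite E.
rewrite -lee_pdivlMl ?exprn_gt0// => /le_trans; apply; rewrite -EFinM lee_fin.
rewrite le_eqVlt; apply/orP; left; apply/eqP; field.
by rewrite !gt_eqF.
Qed.

(** * One-shot random binning *)

Lemma measurable_preimageT d d' (T : measurableType d) (T' : measurableType d')
    (f : T -> T') (A : set T') :
  measurable_fun setT f -> measurable A -> measurable (f @^-1` A).
Proof. by move=> mf mA; rewrite -[X in measurable X]setTI; exact: mf. Qed.

Lemma measurable_forall_fin d (T : measurableType d) (I : finType) (F : I -> set T) :
  (forall i, measurable (F i)) -> measurable [set x | forall i, F i x].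
Proof.
move=> mF; rewrite [X in measurable X](_ : _ = \bigcap_(i in [set: I]) F i).
  by apply: fin_bigcap_measurable => // i _; exact: mF.
by apply/seteqP; split=> x /= Fx i; [move=> _|]; exact: Fx.
Qed.

Lemma measurable_exists_fin d (T : measurableType d) (I : finType) (F : I -> set T) :
  (forall i, measurable (F i)) -> measurable [set x | exists i, F i x].
Proof.
move=> mF; rewrite [X in measurable X](_ : _ = \bigcup_(i in [set: I]) F i).
  by apply: fin_bigcup_measurable => // i _; exact: mF.
by apply/seteqP; split=> x /= => [[i Fi]|[i _ Fi]]; exists i.
Qed.

Lemma measurable_mem_set d (T : measurableType d) (A : set T) :
  measurable A -> measurable_fun setT (fun x => x \in A).
Proof.
move=> mA; apply: (measurable_fun_bool true); rewrite setTI.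
rewrite [X in measurable X](_ : _ = A)//.
by apply/seteqP; split=> x /=; [move/set_mem|move/mem_set].
Qed.

Section tonelli_sets.
Context d1 d2 (T1 : measurableType d1) (T2 : measurableType d2) (R : realType)
  (P : probability T1 R) (Q : probability T2 R).
Variable G : set (T1 * T2).
Hypothesis mG : measurable G.

Let xsecE x : xsection G x = [set y | G (x, y)].
Proof. by rewrite xsectionE. Qed.

Let ysecE y : ysection G y = [set x | G (x, y)].
Proof. by rewrite ysectionE. Qed.

Lemma measurable_section1 x : measurable [set y | G (x, y)].
Proof. by rewrite -xsecE; exact: measurable_xsection. Qed.

Lemma measurable_section2 y : measurable [set x | G (x, y)].
Proof. by rewrite -ysecE; exact: measurable_ysection. Qed.

Lemma measurable_prob_section1 : measurable_fun setT (fun x => Q [set y | G (x, y)]).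
Proof.
by under eq_fun do rewrite -xsecE; exact: measurable_fun_xsection.
Qed.

Lemma prod_prob1 : ((P \x Q) G = \int[P]_x Q [set y | G (x, y)])%E.
Proof. by rewrite /product_measure1; under eq_integral do rewrite /= xsecE. Qed.

Lemma tonelli_sets :
  (\int[P]_x Q [set y | G (x, y)] = \int[Q]_y P [set x | G (x, y)])%E.
Proof.
have := @indic_fubini_tonelli _ _ T1 T2 R P Q G mG.
rewrite indic_fubini_tonelli_FE// indic_fubini_tonelli_GE//=.
by under eq_integral do rewrite xsecE;
  under [X in _ = X -> _]eq_integral do rewrite ysecE.
Qed.

End tonelli_sets.

(** The derandomization step: some codebook is no worse than the average, up to a margin. *)
Lemma exists_le_integral d (T : measurableType d) (R : realType)
    (P : probability T R) (f : T -> \bar R) (E E' : R) :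
  measurable_fun setT f -> (forall x, 0 <= f x)%E ->
  (\int[P]_x f x <= E%:E)%E -> 0 <= E -> E < E' -> exists x, (f x <= E'%:E)%E.
Proof.
move=> mf f0 fE E0 EE'; apply: contrapT => /forallNP H.
suff : (E'%:E <= E%:E)%E by rewrite lee_fin leNgt EE'.
apply: le_trans fE; rewrite -[leLHS](integral_cst_prob P E').
apply: ge0_le_integralT => //.
- by move=> x; rewrite lee_fin (le_trans E0)// ltW.
- by move=> x; rewrite ltW// ltNge; apply/negP; exact: H.
Qed.

Section gelfand_pinsker_encoder.
Context d1 d2 d4 (U : measurableType d1) (S : measurableType d2)
  (X : measurableType d4).
Variables (xin : U * S -> X) (x0 : X) (A : set (U * S)).

(** The first typical codeword of the bin is used. If there is none, [x0] is sent, which will be the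
    word of cost zero so that the power budget is never exceeded. *)
Fixpoint gp_enc (b : seq U) (s : S) : X :=
  if b is u :: b' then if (u, s) \in A then xin (u, s) else gp_enc b' s else x0.

Lemma gp_encP L (b : L.-tuple U) s :
  ((forall i, ~ A (tnth b i, s)) /\ gp_enc b s = x0) \/
  (exists2 i, A (tnth b i, s) & gp_enc b s = xin (tnth b i, s)).
Proof.
elim: L b => [|L IH] b; first by left; split=> [[]//|]; rewrite (tuple0 b).
case: b / tupleP => u b /=; case: ifPn => [/set_mem Au|/negP nAu].
  by right; exists ord0.
have {}nAu : ~ A (u, s) by move=> Au; apply: nAu; exact: mem_set.
have [[nA bE]|[i Ai bE]] := IH b.
  left; split=> // i; case: (unliftP ord0 i) => [j ->|-> //].
  by rewrite tnthS; exact: nA.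
by right; exists (lift ord0 i); rewrite tnthS.
Qed.

Hypothesis mxin : measurable_fun setT xin.
Hypothesis mA : measurable A.

Lemma measurable_gp_enc L :
  measurable_fun setT (fun bs : L.-tuple U * S => gp_enc bs.1 bs.2).
Proof.
elim: L => [|L IH].
  rewrite (_ : (fun _ => _) = cst x0); first exact: measurable_cst.
  by apply/funext => -[b s] /=; rewrite (tuple0 b).
have m0 : measurable_fun setT (fun bs : L.+1.-tuple U * S => (tnth bs.1 ord0, bs.2)).
  apply: measurable_fun_pair; last exact: measurable_snd.
  exact: (measurableT_comp (measurable_tnth ord0) measurable_fst).
have mb : measurable_fun setT
    (fun bs : L.+1.-tuple U * S => ([tuple of behead bs.1], bs.2)).
  apply: measurable_fun_pair; last exact: measurable_snd.
  exact: (measurableT_comp (@measurable_behead _ U L) measurable_fst).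
rewrite (_ : (fun _ => _) = (fun bs : L.+1.-tuple U * S =>
    if (tnth bs.1 ord0, bs.2) \in A then xin (tnth bs.1 ord0, bs.2)
    else gp_enc [tuple of behead bs.1] bs.2)); last first.
  by apply/funext => -[b s] /=; case: b / tupleP.
apply: measurable_fun_ifT.
- exact: (measurableT_comp (measurable_mem_set mA) m0).
- exact: (measurableT_comp mxin m0).
- exact: (measurableT_comp IH mb).
Qed.

End gelfand_pinsker_encoder.

Section gelfand_pinsker_decoder.
Context d1 d2 (U : measurableType d1) (Y : measurableType d2).
Variables (D : set (U * Y)) (M L : nat).
Hypothesis mD : measurable D.
Variable (m0 : 'I_M) (C : M.-tuple (L.-tuple U)).

Definition gp_dec (y : Y) : 'I_M :=
  odflt m0 [pick m | `[< exists i, D (tnth (tnth C m) i, y) >]].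

(** The decision depends on [y] only through the finite vector of acceptance tests, so the preimage
    is a finite union over the possible values [v] of that vector. *)
Lemma measurable_gp_dec w : measurable (gp_dec @^-1` [set w]).
Proof.
pose test m y := `[< exists i, D (tnth (tnth C m) i, y) >].
pose dec (v : {ffun 'I_M -> bool}) := odflt m0 [pick m | v m].
have decE y : gp_dec y = dec [ffun m => test m y].
  by congr odflt; apply: eq_pick => m; rewrite ffunE.
rewrite [X in measurable X](_ : _ = [set y | exists v,
  dec v = w /\ forall m, v m = test m y]); last first.
  apply/seteqP; split=> y /=.
    move=> <-; exists [ffun m => test m y]; split; first exact/esym/decE.
    by move=> m; rewrite ffunE.
  move=> [v [<- vE]]; rewrite decE; congr dec; apply/ffunP => m.
  by rewrite ffunE vE.
apply: measurable_exists_fin => v.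
have [vw|vw] := pselect (dec v = w); last first.
  rewrite [X in measurable X](_ : _ = set0)//.
  by apply/seteqP; split=> y // [].
rewrite [X in measurable X](_ : _ = [set y | forall m, v m = test m y]); last first.
  by apply/seteqP; split=> y /=; [case|].
apply: measurable_forall_fin => m.
have mt : measurable [set y | exists i, D (tnth (tnth C m) i, y)].
  by apply: measurable_exists_fin => i; exact: (measurable_section1 mD).
case: (v m).
  rewrite [X in measurable X](_ : _ = [set y | exists i, D (tnth (tnth C m) i, y)])//.
  by apply/seteqP; split=> y /=; [move=> /esym/asboolP|move=> ?; exact/esym/asboolP].
rewrite [X in measurable X](_ : _ = ~` [set y | exists i, D (tnth (tnth C m) i, y)]).
  exact: measurableC.
by apply/seteqP; split=> y /=; [move=> /esym/negbT/asboolPn|move=> ?; exact/esym/negbTE/asboolPn].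
Qed.

Lemma gp_decP w y : gp_dec y <> w ->
  (forall i, ~ D (tnth (tnth C w) i, y)) \/
  (exists m i, m != w /\ D (tnth (tnth C m) i, y)).
Proof.
rewrite /gp_dec; case: pickP => [m /asboolP [i Di] /= mw|none _].
  by right; exists m, i; split=> //; exact/eqP.
by left=> i Di; have /asboolP := none w; apply; exists i.
Qed.

End gelfand_pinsker_decoder.

Section union_bound.
Context d (T : measurableType d) (R : realType) (P : probability T R).
Local Open Scope ereal_scope.

Lemma prob_le (A B : set T) : measurable A -> measurable B -> A `<=` B -> P A <= P B.
Proof. by move=> mA mB; apply: le_measure; rewrite inE. Qed.

Lemma prob_leU (X A B : set T) : measurable X -> measurable A -> measurable B ->
  X `<=` A `|` B -> P X <= P A + P B.
Proof.
move=> mX mA mB XAB.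
have := @content_subadditive _ _ _ P X (fun i => if i is 0%N then A else B) 2%N.
rewrite !big_ord_recl !big_ord0 /= setU0 adde0; apply => //.
by move=> [|k] _.
Qed.

Lemma prob_exists_le (I : finType) (F : I -> set T) :
  (forall i, measurable (F i)) ->
  P [set x | exists i, F i x] <= \sum_i P (F i).
Proof.
move=> mF; rewrite (_ : [set x | _] =
    [set x | exists2 i, i \in index_enum I & F i x]); last first.
  apply/seteqP; split=> x /= => [[i Fi]|[i _ Fi]]; exists i => //.
  by rewrite mem_index_enum.
elim: (index_enum I) => [|i s IH].
  rewrite big_nil (_ : [set x | _] = set0) ?measure0//.
  by apply/seteqP; split=> x //= [].
have ms (r : seq I) : measurable [set x | exists2 i, i \in r & F i x].
  rewrite (_ : [set x | _] = [set x | exists i, i \in r /\ F i x]); last first.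
    by apply/seteqP; split=> x /= => [[j jr Fj]|[j [jr Fj]]]; exists j.
  apply: measurable_exists_fin => j; have [jr|jr] := pselect (j \in r).
    rewrite [X in measurable X](_ : _ = F j)//.
    by apply/seteqP; split=> x /=; [case|].
  rewrite [X in measurable X](_ : _ = set0)//.
  by apply/seteqP; split=> x //= [].
rewrite big_cons; apply: (@le_trans _ _ (P (F i) +
  P [set x | exists2 i, i \in s & F i x])); last by rewrite leeD2l.
apply: prob_leU => // x /= [j + Fj]; rewrite in_cons => /orP[/eqP <-|js].
  by left.
by right; exists j.
Qed.

End union_bound.

(** * Average performance of a random binned codebook *)

Section random_coding.
Context d1 d2 d3 d4 d5 (U : measurableType d1) (S : measurableType d2)
  (O : measurableType d3) (X : measurableType d4) (Y : measurableType d5)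
  (R : realType).
Variables (PU : probability U R) (PS : probability S R) (PO : probability O R).
Variables (xin : U * S -> X) (x0 : X) (out : X * (S * O) -> Y).
Variables (A : set (U * S)) (D : set (U * Y)) (M L : nat) (m0 : 'I_M).
Hypotheses (mxin : measurable_fun setT xin) (mout : measurable_fun setT out).
Hypotheses (mA : measurable A) (mD : measurable D).
Variables (eps eta1 eta : R).
Hypothesis reliable : forall u s, A (u, s) ->
  (PO [set o | ~ D (u, out (xin (u, s), (s, o)))] <= eps%:E)%E.
Hypothesis covering :
  (\int[PS]_s \prod_(i < L) PU [set u | ~ A (u, s)] <= eta1%:E)%E.
Hypothesis packing : forall y, (PU [set u | D (u, y)] <= eta%:E)%E.
Hypothesis eps_ge0 : 0 <= eps.

Local Notation block := (L.-tuple U).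
Local Notation book := (M.-tuple (L.-tuple U)).
Local Notation enc := (gp_enc xin x0 A).
Local Notation PSO := (PS \x PO)%E.

Let y_ (b : block) (so : S * O) : Y := out (enc b so.1, so).

Let mMO : measurable_fun setT (fun x : block * (S * O) => y_ x.1 x.2).
Proof.
apply: (measurableT_comp mout); apply: measurable_fun_pair; last exact: measurable_snd.
exact: (measurableT_comp (measurable_gp_enc (L := L) x0 mxin mA)
  (measurable_fun_pair measurable_fst (measurableT_comp measurable_fst measurable_snd))).
Qed.

Definition gp_err (C : book) (w : 'I_M) : \bar R :=
  PSO [set so | gp_dec D m0 C (out (enc (tnth C w) so.1, so)) <> w].

(* [Unc]: no codeword of the bin is typical with [s]. [Imp i]: the [i]-th
   codeword of the first bin is accepted for an output sent with the second. *)
Let Unc : set (block * S) := [set x | forall i, ~ A (tnth x.1 i, x.2)].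
Let e1 (b : block) : \bar R := PS [set s | Unc (b, s)].
Let Imp (i : 'I_L) : set ((block * block) * (S * O)) :=
  [set x | D (tnth x.1.1 i, y_ x.1.2 x.2)].
Let e3 i (bb : block * block) : \bar R := PSO [set so | Imp i (bb, so)].

Let mUnc : measurable Unc.
Proof.
apply: measurable_forall_fin => i; apply: measurableC.
apply: (measurable_preimageT _ mA).
apply: measurable_fun_pair; last exact: measurable_snd.
exact: (measurableT_comp (measurable_tnth i) measurable_fst).
Qed.

Let mImp i : measurable (Imp i).
Proof.
apply: (measurable_preimageT _ mD); apply: measurable_fun_pair.
  apply: (measurableT_comp (measurable_tnth i)).
  exact: (measurableT_comp measurable_fst measurable_fst).
exact: (measurableT_comp mMO (measurable_fun_pair
  (measurableT_comp measurable_snd measurable_fst) measurable_snd)).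
Qed.

Let me1 : measurable_fun setT e1. Proof. exact: measurable_prob_section1. Qed.
Let me3 i : measurable_fun setT (e3 i).
Proof. exact: (measurable_prob_section1 PSO (mImp i)). Qed.

(** Three causes of error: the bin has no typical codeword ([E1]), a typical codeword was sent and
    its whole bin is rejected ([E2]), a codeword of another bin is accepted ([E3]). *)
Lemma gp_err_le C w : (gp_err C w <= eps%:E + e1 (tnth C w) +
  \sum_(m | m != w) \sum_(i < L) e3 i (tnth C m, tnth C w))%E.
Proof.
set b := tnth C w.
have myb : measurable_fun setT (y_ b) by exact: (measurable_fun_pair2 b mMO).
pose E1 := [set so : S * O | Unc (b, so.1)].
pose F := [set so : S * O | forall i, ~ D (tnth b i, y_ b so)].
(* Off [E1] the encoder has sent a typical codeword, which is what [reliable] requires. *)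
pose E2 := F `&` ~` E1.
pose E3 := [set so | exists mi : 'I_M * 'I_L, mi.1 != w /\ Imp mi.2 ((tnth C mi.1, b), so)].
have mE1 : measurable E1.
  exact: (measurable_preimageT (measurable_fst) (measurable_section1 mUnc b)).
have mF : measurable F.
  apply: measurable_forall_fin => i; apply: measurableC.
  apply: (measurable_preimageT _ (measurable_section1 mD (tnth b i))); exact: myb.
have mE2 : measurable E2 by apply: measurableI => //; exact: measurableC.
pose G mi := [set so : S * O | mi.1 != w /\ Imp mi.2 ((tnth C mi.1, b), so)].
have mG mi : measurable (G mi).
  rewrite /G; case: (mi.1 != w).
    rewrite [X in measurable X](_ : _ = [set so | Imp mi.2 ((tnth C mi.1, b), so)]).
      exact: (measurable_section1 (mImp _)).
    by apply/seteqP; split=> x /=; [case|].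
  by rewrite [X in measurable X](_ : _ = set0)//; apply/seteqP; split=> x //= [].
have mE3 : measurable E3 by exact: measurable_exists_fin mG.
have merr : measurable [set so | gp_dec D m0 C (y_ b so) <> w].
  rewrite [X in measurable X](_ : _ = ~` ((gp_dec D m0 C \o y_ b) @^-1` [set w]))//.
  apply: measurableC.
  exact: (measurable_preimageT myb (measurable_gp_dec mD m0 C w)).
have sub : [set so | gp_dec D m0 C (y_ b so) <> w] `<=` (E2 `|` E1) `|` E3.
  move=> so /= /gp_decP[nD|[m [i [mw Di]]]]; last by right; exists (m, i).
  by left; have [H|H] := pselect (E1 so); [right|left].
have mE21 : measurable (E2 `|` E1) by exact: measurableU.
apply: (le_trans (prob_leU PSO merr mE21 mE3 sub)).
apply: leeD; first apply: (le_trans (prob_leU PSO mE21 mE2 mE1 (@subset_refl _ _))).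
  apply: leeD.
    rewrite [leLHS](_ : _ = (\int[PS]_s PO [set o | E2 (s, o)])%E); last exact: prod_prob1.
    rewrite -[leRHS](integral_cst_prob PS eps).
    apply: ge0_le_integralT => //; first exact: (measurable_prob_section1 PO mE2).
    move=> s; have [[nA _]|[i Ai bE]] := gp_encP xin x0 A b s.
      rewrite [X in PO X](_ : _ = set0) ?measure0 ?lee_fin//.
      by apply/seteqP; split=> o //= [_]; apply.
    apply: le_trans (reliable Ai); apply: prob_le.
    - exact: (measurable_section1 mE2).
    - apply: measurableC; apply: (measurable_preimageT (f := fun o => (tnth b i, out (xin (tnth b i, s), (s, o)))) _ mD).
      apply: measurable_fun_pair; first exact: measurable_cst.
      apply: (measurableT_comp mout); apply: measurable_fun_pair; first exact: measurable_cst.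
      by apply: measurable_fun_pair; [exact: measurable_cst|exact: measurable_id].
    - by move=> o [/= /(_ i) + _]; rewrite /y_ /= bE.
  rewrite [leLHS](_ : _ = (\int[PS]_s PO [set o | E1 (s, o)])%E); last exact: prod_prob1.
  rewrite /e1.
  under eq_integral => s _.
    rewrite (_ : PO _ = (\1_[set s | Unc (b, s)] s)%:E); last first.
      rewrite indicE; case: (boolP (s \in _)) => [|/negP] H.
        move/set_mem : H => /= H; rewrite (_ : [set y | _] = setT) ?probability_setT//.
        by apply/seteqP; split.
      rewrite (_ : [set y | _] = set0) ?measure0//.
      by apply/seteqP; split=> o //= H'; apply: H; exact: mem_set.
    over.
  by rewrite (integral_indic PS measurableT (measurable_section1 mUnc b)) setIT.
apply: (le_trans (prob_exists_le PSO mG)).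
(* The union bound runs over all pairs of a message and an index; those with [m = w] contribute
   empty events. *)
rewrite -(pair_bigA _ (fun m i => PSO (G (m, i))))/= (bigID (fun m => m != w))/=.
rewrite [X in (_ + X)%E]big1 ?adde0.
  apply: lee_sum => m mw; apply: lee_sum => i _; apply: prob_le => //.
  - exact: (measurable_section1 (mImp _)).
  - by move=> so [].
move=> m /negPn/eqP ->; rewrite big1// => i _.
rewrite (_ : G _ = set0) ?measure0//.
by apply/seteqP; split=> so //= []; rewrite eqxx.
Qed.

Lemma iid_tnth d (T : measurableType d) (P : probability T R) n (i : 'I_n)
    (B : set T) : measurable B -> iid P n [set t | B (tnth t i)] = P B.
Proof.
move=> mB; have mt := measurable_preimageT (measurable_tnth (T := T) i) mB.
rewrite -[X in _ = P X]setIT -(integral_indic P measurableT mB).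
rewrite -[X in iid P n X]setIT -(integral_indic (iid P n) measurableT mt).
have mi : measurable_fun setT (fun x => (\1_B x)%:E : \bar R).
  by apply/measurable_EFinP; exact: measurable_indic.
by rewrite -(@ge0_integral_iid_tnth _ _ _ P n i _ mi).
Qed.

(** Once Tonelli has put [s] outside, the codewords of a bin are independent and the probability
    that all miss [s] is the product in [covering]. *)
Let e1_le : (\int[iid PU L]_b e1 b <= eta1%:E)%E.
Proof.
rewrite /e1 (tonelli_sets (iid PU L) PS mUnc); apply: le_trans covering.
rewrite le_eqVlt; apply/orP; left; apply/eqP; apply: eq_integral => s _.
rewrite -(@iid_rect _ _ _ PU L (fun=> [set u | ~ A (u, s)])).
  by [].
by move=> _; apply: measurableC; exact: measurable_section2.
Qed.

(** Bin [m] is independent of bin [w], hence of the channel output. Resampling bin [m] makes this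
    explicit, and [packing] applies with the output frozen. *)
Let e3_le i m w : m != w ->
  (\int[iid (iid PU L) M]_C e3 i (tnth C m, tnth C w) <= eta%:E)%E.
Proof.
move=> mw.
have e30 bb : (0 <= e3 i bb)%E by exact: measure_ge0.
have mf : measurable_fun setT (fun C : book => e3 i (tnth C m, tnth C w)).
  exact: (measurableT_comp (me3 i)
    (measurable_fun_pair (measurable_tnth m) (measurable_tnth w))).
rewrite (ge0_integral_iid_upd _ m mf (fun C => e30 _)).
under eq_integral => C _ do under eq_integral => a _ do
  rewrite !tnth_tuple_upd eqxx eq_sym (negbTE mw).
have mfa : measurable_fun setT (fun C : book => \int[iid PU L]_a e3 i (a, tnth C w))%E.
  apply: (measurable_integral_snd (iid PU L) (f := fun Ca => e3 i (Ca.2, tnth Ca.1 w))).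
    exact: (measurableT_comp (me3 i) (measurable_fun_pair measurable_snd
      (measurableT_comp (measurable_tnth w) measurable_fst))).
  by move=> x; exact: e30.
rewrite -[leRHS](integral_cst_prob (iid (iid PU L) M) eta).
apply: (ge0_le_integralT _ mfa).
- by move=> C; apply: integral_ge0 => a _; exact: e30.
- exact: measurable_cst.
move=> C; set b := tnth C w.
pose G' := [set x : block * (S * O) | Imp i ((x.1, b), x.2)].
have mG' : measurable G'.
  apply: (measurable_preimageT _ (mImp i)); apply: measurable_fun_pair; last exact: measurable_snd.
  by apply: measurable_fun_pair; [exact: measurable_fst|exact: measurable_cst].
rewrite /e3 (tonelli_sets (iid PU L) PSO mG').
rewrite -[leRHS](integral_cst_prob PSO eta).
apply: ge0_le_integralT.
- have mG'' : measurable [set x : (S * O) * block | G' (x.2, x.1)].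
    exact: (measurable_preimageT (f := fun x : (S * O) * block => (x.2, x.1))
      (measurable_fun_pair measurable_snd measurable_fst) mG').
  exact: (measurable_prob_section1 (iid PU L) mG'').
- by move=> so; exact: measure_ge0.
- exact: measurable_cst.
move=> so; apply: le_trans (packing (y_ b so)).
by rewrite -(@iid_tnth _ U PU L i)//; exact: (measurable_section2 mD).
Qed.

Variables (N : nat) (c : 'I_N -> X -> R) (B p : R).
Hypothesis mc : forall j, measurable_fun setT (c j).
Hypothesis c_ge0 : forall j x, 0 <= c j x.
Hypothesis c_le : forall j (b : block) s, c j (enc b s) <= B.
Hypothesis mean_cost :
  forall j, (\int[iid PU L]_b \int[PS]_s (c j (enc b s))%:E <= p%:E)%E.

Let hE j (b : block) : \bar R := (\int[PS]_s (c j (enc b s))%:E)%E.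

Let mcE j : measurable_fun setT (fun bs : block * S => (c j (enc bs.1 bs.2))%:E).
Proof.
apply/measurable_EFinP.
exact: (measurableT_comp (mc j) (measurable_gp_enc (L := L) x0 mxin mA)).
Qed.

Let hE_ge0 j b : (0 <= hE j b)%E.
Proof. by apply: integral_ge0 => s _; rewrite lee_fin. Qed.

Let mhE j : measurable_fun setT (hE j).
Proof.
apply: (measurable_integral_snd PS (mcE j)) => x.
by rewrite lee_fin.
Qed.

Let hE_le j b : (hE j b <= B%:E)%E.
Proof.
rewrite -[leRHS](integral_cst_prob PS B); apply: ge0_le_integralT.
- exact: (measurable_fun_pair2 b (mcE j)).
- by move=> s; rewrite lee_fin.
- exact: measurable_cst.
- by move=> s; rewrite lee_fin.
Qed.

Let hfin j b : hE j b \is a fin_num.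
Proof. by rewrite ge0_fin_numE// (le_lt_trans (hE_le _ _))// ltry. Qed.

Let h j b : R := fine (hE j b).

Let h_ge0 j b : 0 <= h j b. Proof. exact: fine_ge0. Qed.

Let h_le j b : h j b <= B.
Proof. by rewrite -lee_fin fineK. Qed.

Let mh j : measurable_fun setT (h j).
Proof. by apply: (measurableT_comp _ (mhE j)). Qed.

Let hm j : exists2 m, 0 <= m <= p /\ m <= B & L2mean (iid PU L) (h j) m.
Proof.
have E b : (h j b)%:E = hE j b by rewrite fineK.
have I0 : (0 <= \int[iid PU L]_b hE j b)%E by exact: integral_ge0.
have Ip : (\int[iid PU L]_b hE j b <= p%:E)%E by exact: mean_cost.
have Ifin : (\int[iid PU L]_b hE j b)%E \is a fin_num.
  by rewrite ge0_fin_numE// (le_lt_trans Ip)// ltry.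
exists (fine (\int[iid PU L]_b hE j b)%E).
  split; first by rewrite fine_ge0//= -lee_fin fineK.
  rewrite -lee_fin fineK// -[leRHS](integral_cst_prob (iid PU L) B).
  by apply: ge0_le_integralT => //; exact: measurable_cst.
apply: (bounded_L2mean (B := B)) => //.
  by move=> b; rewrite ger0_norm.
by rewrite fineK//; apply: eq_integral => b _; rewrite E.
Qed.

(** The bins of distinct messages are independent, so the variances of the centred costs, which take
    values between [- B] and [B], add up. *)
Let cost_dev j : exists2 m, m <= p & measurable_fun setT (fun C : book =>
    \sum_(w < M) (h j (tnth C w) - m)) /\
  (\int[iid (iid PU L) M]_C ((\sum_(w < M) (h j (tnth C w) - m)) ^+ 2)%:E
   <= (M%:R * B ^+ 2)%:E)%E.
Proof.
have [m [/andP[mge mp] mB] hmm] := hm j; exists m => //.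
have gm : L2mean (iid PU L) (fun b => h j b - m) 0.
  by apply: eq_L2mean (L2meanD hmm (L2mean_cst _ (- m))) => //; rewrite subrr.
have [mg g2 _] := gm; have [v v0 gv] := sqr_integral_fin g2.
have [[mS _ _] Sv] := L2mean_iid_sum gm gv M.
split; first exact: mS.
rewrite Sv lee_fin ler_wpM2l// -lee_fin -gv -[leRHS](integral_cst_prob (iid PU L) (B ^+ 2)).
apply: (ge0_le_integralT _ (measurable_sqr_EFin mg) (fun x => sqr_EFin_ge0 _)).
  exact: measurable_cst.
move=> b; rewrite lee_fin -(real_normK (num_real (h j b - m))) lerXn2r ?nnegrE//.
  by rewrite (le_trans (h_ge0 j b)).
rewrite ler_norml; have := h_ge0 j b; have := h_le j b; move=> h1 h2.
by apply/andP; split; lra.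
Qed.

(** A majorant of [gp_err] whose measurability in the codebook follows from that of [e1] and [e3];
    the condition [m != w] sits inside the summand so that the sums range over all messages. *)
Let F w (C : book) : \bar R := (eps%:E + e1 (tnth C w) +
  \sum_(m < M) \sum_(i < L)
    (if m != w then e3 i (tnth C m, tnth C w) else 0))%E.

Let e1_ge0 b : (0 <= e1 b)%E. Proof. exact: measure_ge0. Qed.

Let e3if_ge0 w m i (C : book) :
  (0 <= (if m != w then e3 i (tnth C m, tnth C w) else 0))%E.
Proof. by case: ifP => // _; exact: measure_ge0. Qed.

Let me3if w m i : measurable_fun setT (fun C : book =>
  (if m != w then e3 i (tnth C m, tnth C w) else 0)%E).
Proof.
case: (m != w); last exact: measurable_cst.
exact: (measurableT_comp (me3 i)
    (measurable_fun_pair (measurable_tnth m) (measurable_tnth w))).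
Qed.

Let me1w w : measurable_fun setT (fun C : book => (eps%:E + e1 (tnth C w))%E).
Proof.
apply: emeasurable_funD; first exact: measurable_cst.
exact: (measurableT_comp me1 (measurable_tnth w)).
Qed.

Let me3s w m : measurable_fun setT (fun C : book => (\sum_(i < L)
    (if m != w then e3 i (tnth C m, tnth C w) else 0))%E).
Proof. by apply: emeasurable_sum => i; exact: me3if. Qed.

Let me3ss w : measurable_fun setT (fun C : book => (\sum_(m < M) \sum_(i < L)
    (if m != w then e3 i (tnth C m, tnth C w) else 0))%E).
Proof. by apply: emeasurable_sum => m; exact: me3s. Qed.

Let mF w : measurable_fun setT (F w).
Proof. exact: emeasurable_funD (me1w w) (me3ss w). Qed.

Let F_ge0 w C : (0 <= F w C)%E.
Proof.
rewrite adde_ge0//; first by rewrite adde_ge0// lee_fin.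
by apply: sume_ge0 => m _; apply: sume_ge0 => i _.
Qed.

Lemma sum_cst_EFin n (a : R) : (\sum_(i < n) a%:E = (n%:R * a)%:E)%E.
Proof. by rewrite sumEFin sumr_const card_ord mulr_natl. Qed.

Let F_le w : 0 <= eta ->
  (\int[iid (iid PU L) M]_C F w C <= (eps + eta1 + M%:R * L%:R * eta)%:E)%E.
Proof.
move=> eta_ge0.
rewrite (ge0_integralTD _ (me1w w) _ (me3ss w)); last 2 first.
- by move=> C; rewrite adde_ge0// lee_fin.
- by move=> C; apply: sume_ge0 => m _; apply: sume_ge0 => i _.
rewrite EFinD; apply: leeD.
  rewrite (ge0_integralTD _ (measurable_cst _) _
    (measurableT_comp me1 (measurable_tnth w)))//.
  by rewrite EFinD integral_cst_prob leeD2l// ge0_integral_iid_tnth.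
rewrite (ge0_integralT_sum _ _ (me3s w)); last first.
  by move=> m C; apply: sume_ge0 => i _.
rewrite -mulrA -sum_cst_EFin; apply: lee_sum => m _.
rewrite (ge0_integralT_sum _ _ (me3if w m)); last by move=> i C.
rewrite -sum_cst_EFin; apply: lee_sum => i _.
case: (boolP (m != w)) => mw; first exact: e3_le.
by rewrite integral_cst_prob lee_fin.
Qed.

(* One codebook must meet the error and all the power constraints at once, so a
   single expectation is bounded: the error plus the squared deviations of the
   message-averaged costs from their means. *)
Lemma random_coding (E : R) : 0 <= eta -> 0 <= eta1 ->
  eps + eta1 + M%:R * L%:R * eta + N%:R * (B ^+ 2 / M%:R) < E ->
  exists C : book, ((M%:R^-1)%:E * \sum_(w < M) gp_err C w <= E%:E)%E /\
    forall j, ((M%:R^-1)%:E * \sum_(w < M) hE j (tnth C w) <= (p + Num.sqrt E)%:E)%E.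
Proof.
move=> eta_ge0 eta1_ge0 EH.
have M0 : (0 < M%:R :> R) by rewrite ltr0n; case: m0 => i; exact: leq_ltn_trans.
have Mi0 : 0 <= M%:R^-1 :> R by rewrite invr_ge0 ltW.
have /choice[mu muP] : forall j, exists m, [/\ m <= p, measurable_fun setT (fun C : book =>
    \sum_(w < M) (h j (tnth C w) - m)) &
  (\int[iid (iid PU L) M]_C ((\sum_(w < M) (h j (tnth C w) - m)) ^+ 2)%:E
   <= (M%:R * B ^+ 2)%:E)%E].
  by move=> j; have [m mp [? ?]] := cost_dev j; exists m.
pose dev j (C : book) := \sum_(w < M) (h j (tnth C w) - mu j).
pose V j (C : book) : \bar R := (((M%:R^-1) ^+ 2)%:E * ((dev j C) ^+ 2)%:E)%E.
have mdev j : measurable_fun setT (dev j) by case: (muP j).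
have mV j : measurable_fun setT (V j).
  by apply: measurable_funeM; exact: measurable_sqr_EFin.
have V_ge0 j C : (0 <= V j C)%E by rewrite /V -EFinM lee_fin mulr_ge0// sqr_ge0.
pose SF (C : book) := ((M%:R^-1)%:E * \sum_(w < M) F w C)%E.
have SF_ge0 C : (0 <= SF C)%E by rewrite mule_ge0 ?lee_fin// sume_ge0.
have mSF0 : measurable_fun setT (fun C => \sum_(w < M) F w C)%E.
  by apply: emeasurable_sum => w; exact: mF.
have mSF : measurable_fun setT SF by exact: measurable_funeM.
have mSV : measurable_fun setT (fun C => \sum_(j < N) V j C)%E.
  by apply: emeasurable_sum => j; exact: mV.
have SV_ge0 C : (0 <= \sum_(j < N) V j C)%E by exact: sume_ge0.
have [||||C HC] := @exists_le_integral _ _ _ (iid (iid PU L) M)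
  (fun C => SF C + \sum_(j < N) V j C)%E _ E _ _ _ _ EH.
- exact: emeasurable_funD mSF mSV.
- by move=> C; rewrite adde_ge0.
- rewrite (ge0_integralTD _ mSF SF_ge0 mSV SV_ge0) EFinD; apply: leeD.
    rewrite (ge0_integralTZl _ mSF0 _ Mi0); last by move=> C; exact: sume_ge0.
    rewrite (ge0_integralT_sum _ _ mF)//.
    apply: (@le_trans _ _ ((M%:R^-1)%:E * \sum_(w < M)
      (eps + eta1 + M%:R * L%:R * eta)%:E)%E).
      by rewrite lee_wpmul2l ?lee_fin//; apply: lee_sum => w _; exact: F_le.
    by rewrite sum_cst_EFin -EFinM mulKf// gt_eqF.
  rewrite (ge0_integralT_sum _ _ mV)// -sum_cst_EFin; apply: lee_sum => j _.
  rewrite (ge0_integralTZl _ (measurable_sqr_EFin (mdev j)) (fun x => sqr_EFin_ge0 _) (sqr_ge0 _)).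
  have [_ _ dv] := muP j.
  apply: (@le_trans _ _ (((M%:R^-1) ^+ 2)%:E * (M%:R * B ^+ 2)%:E)%E).
    by rewrite lee_wpmul2l ?lee_fin ?sqr_ge0.
  rewrite -EFinM lee_fin le_eqVlt; apply/orP; left; apply/eqP; field.
  by rewrite gt_eqF.
- rewrite !addr_ge0//; first by rewrite !mulr_ge0.
  by rewrite mulr_ge0// divr_ge0// sqr_ge0.
exists C; split.
  apply: le_trans HC; apply: (@le_trans _ _ (SF C)); last by rewrite leeDl.
  rewrite lee_wpmul2l ?lee_fin//; apply: lee_sum => w _.
  apply: le_trans (gp_err_le C w) _; rewrite leeD2l// big_mkcond/=.
  by apply: lee_sum => m _; case: (m != w) => //; exact: sume_ge0.
move=> j; have [mup _ _] := muP j.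
(* Each squared deviation is at most the selected total, so the cost of letter [j], averaged over
   messages, is within the square root of [E] of its mean. *)
have : (V j C <= E%:E)%E.
  apply: le_trans HC; apply: (@le_trans _ _ (\sum_(j < N) V j C)%E); last first.
    by rewrite leeDr.
  by rewrite (bigD1 j)//= leeDl// sume_ge0.
rewrite /V -EFinM lee_fin -exprMn => /(@ler_wsqrtr R); rewrite sqrtr_sqr => H.
under eq_bigr => w _ do rewrite -(fineK (hfin j _)).
rewrite sumEFin -EFinM lee_fin.
have -> : M%:R^-1 * (\sum_(w < M) h j (tnth C w)) = mu j + M%:R^-1 * dev j C.
  rewrite /dev sumrB sumr_const card_ord -[mu j *+ M]mulr_natl mulrBr mulKf ?gt_eqF//.
  by rewrite addrC subrK.
by rewrite lerD// (le_trans (ler_norm _)).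
Qed.

End random_coding.

(** * Memoryless channels *)

Section complex_measurability.
Context d (T : measurableType d) (R : realType).

Lemma measurable_complexP (f : T -> R[i]) :
  measurable_fun setT (fun x => complex.Re (f x)) ->
  measurable_fun setT (fun x => complex.Im (f x)) -> measurable_fun setT f.
Proof.
move=> mr mi; rewrite (_ : f = fun x => mk_complex (complex.Re (f x), complex.Im (f x))).
  exact: (measurableT_comp (@measurable_mk_complex R) (measurable_fun_pair mr mi)).
by apply/funext => x; rewrite /mk_complex /=; case: (f x).
Qed.

Lemma normc_sqrE (z : R[i]) :
  ComplexField.Normc.normc z ^+ 2 = complex.Re z ^+ 2 + complex.Im z ^+ 2.
Proof. by case: z => a b /=; rewrite sqr_sqrtr// addr_ge0// sqr_ge0. Qed.

Lemma measurable_normc_sqr :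
  measurable_fun setT (fun z : R[i] => ComplexField.Normc.normc z ^+ 2).
Proof.
under eq_fun do rewrite normc_sqrE.
exact: (measurable_funD (measurable_funX 2 (@measurable_Re R))
  (measurable_funX 2 (@measurable_Im R))).
Qed.

End complex_measurability.

Section channel_letter.
Variable R : realType.

Definition channel_out (x : R[i] * (measurableTypeR R * (measurableTypeR R * R[i])))
    : R[i] := x.1 + cis x.2.2.1 * ((x.2.1 : R)%:C)%C + x.2.2.2.

Lemma channel_outE x s t z : channel_out (x, (s, (t, z))) =
  Complex (complex.Re x + cos t * s + complex.Re z)
          (complex.Im x + sin t * s + complex.Im z).
Proof.
rewrite /channel_out /cis /=; by case: x => a b; case: z => c d; simpc.
Qed.

Lemma measurable_channel_out : measurable_fun setT channel_out.
Proof.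
have mx := @measurable_fst _ _ R[i] (measurableTypeR R * (measurableTypeR R * R[i]))%type.
have m2 := @measurable_snd _ _ R[i] (measurableTypeR R * (measurableTypeR R * R[i]))%type.
have ms := measurableT_comp measurable_fst m2.
have m22 := measurableT_comp measurable_snd m2.
have mt := measurableT_comp measurable_fst m22.
have mz := measurableT_comp measurable_snd m22.
apply: measurable_complexP.
- rewrite (_ : (fun x => _) = fun x => complex.Re x.1 +
      cos (x.2.2.1 : R) * (x.2.1 : R) + complex.Re x.2.2.2); last first.
    by apply/funext => -[x [s [t z]]]; rewrite channel_outE.
  apply: measurable_funD; last exact: (measurableT_comp (@measurable_Re R) mz).
  apply: measurable_funD; first exact: (measurableT_comp (@measurable_Re R) mx).
  apply: measurable_funM; last exact: ms.
  exact: (measurableT_comp (continuous_measurable_fun (@continuous_cos R)) mt).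
- rewrite (_ : (fun x => _) = fun x => complex.Im x.1 +
      sin (x.2.2.1 : R) * (x.2.1 : R) + complex.Im x.2.2.2); last first.
    by apply/funext => -[x [s [t z]]]; rewrite channel_outE.
  apply: measurable_funD; last exact: (measurableT_comp (@measurable_Im R) mz).
  apply: measurable_funD; first exact: (measurableT_comp (@measurable_Im R) mx).
  apply: measurable_funM; last exact: ms.
  exact: (measurableT_comp (continuous_measurable_fun (@continuous_sin R)) mt).
Qed.

End channel_letter.

Section iid_products.
Context d1 d2 (T1 : measurableType d1) (T2 : measurableType d2) (R : realType)
  (P : probability T1 R) (Q : probability T2 R).

Lemma iid_prod_set n (B : set (n.-tuple T1 * n.-tuple T2)) : measurable B ->
  ((iid P n \x iid Q n) B =
   iid (P \x Q) n [set w | B (map_tuple fst w, map_tuple snd w)])%E.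
Proof.
move=> mB.
have mi : measurable_fun setT (fun x => (\1_B x)%:E : \bar R).
  by apply/measurable_EFinP; exact: measurable_indic.
have mm : measurable_fun setT (fun w : n.-tuple (T1 * T2) =>
    (map_tuple fst w, map_tuple snd w)).
  exact: (measurable_fun_pair (measurable_map_tuple (n := n) measurable_fst)
    (measurable_map_tuple (n := n) measurable_snd)).
have mB' := measurable_preimageT mm mB.
rewrite -[X in _ = iid _ _ X]setIT -(integral_indic (iid (P \x Q)%E n) measurableT mB').
rewrite -(@ge0_integral_iid_prod _ _ _ _ _ P Q n _ mi)//.
transitivity (\int[iid P n \x iid Q n]_x (\1_B x)%:E)%E.
  by rewrite integral_indic// setIT.
by rewrite (fubini_tonelli1 _ mi).
Qed.

End iid_products.

Section tuple_zip.
Context d1 d2 (T1 : measurableType d1) (T2 : measurableType d2).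

Definition tuple_zip n (x : n.-tuple T1 * n.-tuple T2) : n.-tuple (T1 * T2) :=
  tuple_map2 id x.1 x.2.

Lemma measurable_tuple_zip n : measurable_fun setT (@tuple_zip n).
Proof. exact: measurable_tuple_map2. Qed.

Lemma tuple_zip_map n (w : n.-tuple (T1 * T2)) :
  tuple_zip (map_tuple fst w, map_tuple snd w) = w.
Proof.
by apply: eq_from_tnth => i; rewrite tnth_mktuple /= !tnth_map; case: (tnth w i).
Qed.

Lemma ge0_integral_iid_zip (R : realType) (P : probability T1 R)
    (Q : probability T2 R) n (f : n.-tuple (T1 * T2) -> \bar R) :
  measurable_fun setT f -> (forall x, 0 <= f x)%E ->
  (\int[iid P n \x iid Q n]_x f (tuple_zip x) = \int[iid (P \x Q) n]_w f w)%E.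
Proof.
move=> mf f0; have mfz := measurableT_comp mf (@measurable_tuple_zip n).
rewrite (fubini_tonelli1 _ mfz (fun x => f0 _)) /fubini_F.
rewrite (@ge0_integral_iid_prod _ _ _ _ _ P Q n _ mfz (fun x => f0 _)).
by apply: eq_integral => w _; rewrite /= tuple_zip_map.
Qed.

Lemma iid_zip (R : realType) (P : probability T1 R) (Q : probability T2 R) n
    (B : set (n.-tuple (T1 * T2))) : measurable B ->
  ((iid P n \x iid Q n) [set x | B (tuple_zip x)] = iid (P \x Q) n B)%E.
Proof.
move=> mB; rewrite (iid_prod_set P Q (measurable_preimageT (@measurable_tuple_zip n) mB)).
congr (iid _ _ _); apply/seteqP; split=> w /=; by rewrite tuple_zip_map.
Qed.

End tuple_zip.

Lemma tnth_tuple_swap (U : Type) n (i j : 'I_n) (t : n.-tuple U) k :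
  tnth (tuple_swap i j t) k = tnth t (tperm i j k).
Proof.
by rewrite tnth_mktuple; case: tpermP => [->|->|/eqP/negbTE -> /eqP/negbTE ->];
  rewrite ?eqxx//; case: eqP => // ->.
Qed.

Lemma tuple_swapK (U : Type) n (i j : 'I_n) : involutive (@tuple_swap U n i j).
Proof. by move=> t; apply: eq_from_tnth => k; rewrite !tnth_tuple_swap tpermK. Qed.

Lemma sum_tuple_swap (R : realType) n (i j : 'I_n) (f : 'I_n -> R) :
  \sum_(k < n) f (tperm i j k) = \sum_(k < n) f k.
Proof. by rewrite [RHS](reindex_inj (@perm_inj _ (tperm i j))). Qed.

(** * Gelfand-Pinsker block codes for a memoryless channel *)

Section memoryless.
Context d1 d2 d3 d4 d5 d6 (U0 : measurableType d1) (S0 : measurableType d2)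
  (O0 : measurableType d3) (X0 : measurableType d4) (Y0 : measurableType d5)
  (V0 : measurableType d6) (R : realType).
Variables (PU : probability U0 R) (PV : probability V0 R)
  (PS : probability S0 R) (PO : probability O0 R).
Variables (phi : V0 * S0 -> U0) (xin : U0 * S0 -> X0)
  (chan : X0 * (S0 * O0) -> Y0) (x00 : X0) (cost : X0 -> R).
Variables (l : U0 * S0 -> R) (l' : U0 * Y0 -> R).
Hypotheses (mphi : measurable_fun setT phi) (mxin : measurable_fun setT xin)
  (mchan : measurable_fun setT chan) (mcost : measurable_fun setT cost)
  (ml : measurable_fun setT l) (ml' : measurable_fun setT l').
Hypothesis cost_ge0 : forall x, 0 <= cost x.
Hypothesis cost0 : cost x00 = 0.
(* [expR l] is the density of the codeword letter given the interference letter;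
   [expR l'] need not be a density, only have mean at most 1. *)
Hypothesis phiP : forall s (F : U0 -> \bar R), measurable_fun setT F ->
  (forall u, 0 <= F u)%E ->
  (\int[PV]_v F (phi (v, s)) = \int[PU]_u ((expR (l (u, s)))%:E * F u))%E.
Hypothesis l'P : forall y, (\int[PU]_u (expR (l' (u, y)))%:E <= 1)%E.

Variables (N : nat) (a b p eps : R).

Let xN (us : N.-tuple U0 * N.-tuple S0) : N.-tuple X0 := tuple_map2 xin us.1 us.2.

Definition block_out (xso : N.-tuple X0 * (N.-tuple S0 * N.-tuple O0)) : N.-tuple Y0 :=
  tuple_map2 chan xso.1 (tuple_zip xso.2).

Let D : set (N.-tuple U0 * N.-tuple Y0) :=
  [set uy | N%:R * b <= \sum_(j < N) l' (tnth uy.1 j, tnth uy.2 j)].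

Let miss : set ((N.-tuple U0 * N.-tuple S0) * N.-tuple O0) :=
  [set x | ~ D (x.1.1, block_out (xN x.1, (x.1.2, x.2)))].

(* Reliability of the decoding test is made part of typicality, which replaces
   the Markov lemma. *)
Let A : set (N.-tuple U0 * N.-tuple S0) :=
  [set us | [/\ \sum_(j < N) l (tnth us.1 j, tnth us.2 j) <= N%:R * a,
     \sum_(j < N) cost (tnth (xN us) j) <= N%:R * p &
     (iid PO N [set o | miss (us, o)] <= eps%:E)%E]].

Let mxN : measurable_fun setT xN.
Proof. exact: measurable_tuple_map2. Qed.

Let mout : measurable_fun setT block_out.
Proof.
exact: (measurableT_comp (measurable_tuple_map2 (n := N) mchan)
  (measurable_fun_pair measurable_fst
    (measurableT_comp (measurable_tuple_zip (n := N)) measurable_snd))).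
Qed.

Lemma measurable_sum_tnth2 d d' d'' (T : measurableType d) (T1 : measurableType d')
    (T2 : measurableType d'') (f : T1 * T2 -> R) (g : T -> N.-tuple T1 * N.-tuple T2) :
  measurable_fun setT f -> measurable_fun setT g ->
  measurable_fun setT (fun x => \sum_(j < N) f (tnth (g x).1 j, tnth (g x).2 j)).
Proof.
move=> mf mg; apply: measurable_sum => j.
exact: (measurableT_comp mf (measurable_fun_pair
  (measurableT_comp (measurable_tnth j) (measurableT_comp measurable_fst mg))
  (measurableT_comp (measurable_tnth j) (measurableT_comp measurable_snd mg)))).
Qed.

Lemma measurable_le_cst d (T : measurableType d) (f : T -> R) (r : R) :
  measurable_fun setT f -> measurable [set x | f x <= r].
Proof.
move=> mf; rewrite -[X in measurable X]setTI.
by apply: measurable_fun_le; [exact: measurableT|exact: mf|exact: measurable_cst].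
Qed.

Lemma measurable_ge_cst d (T : measurableType d) (f : T -> R) (r : R) :
  measurable_fun setT f -> measurable [set x | r <= f x].
Proof.
move=> mf; rewrite -[X in measurable X]setTI.
by apply: measurable_fun_le; [exact: measurableT|exact: measurable_cst|exact: mf].
Qed.

Let mD : measurable D.
Proof.
apply: measurable_ge_cst.
exact: (measurable_sum_tnth2 ml' (@measurable_id _ _ setT)).
Qed.

Let mmiss : measurable miss.
Proof.
apply: measurableC; apply: (measurable_preimageT _ mD); apply: measurable_fun_pair.
  exact: (measurableT_comp measurable_fst measurable_fst).
apply: (measurableT_comp mout); apply: measurable_fun_pair.
  exact: (measurableT_comp mxN measurable_fst).
apply: measurable_fun_pair; last exact: measurable_snd.
exact: (measurableT_comp measurable_snd measurable_fst).
Qed.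

Let mcostN : measurable_fun setT (fun x : N.-tuple X0 => \sum_(j < N) cost (tnth x j)).
Proof. by apply: (@measurable_sum_tnth _ _ _ _ (fun=> cost)). Qed.

Let mA1 : measurable [set us : N.-tuple U0 * N.-tuple S0 |
  \sum_(j < N) l (tnth us.1 j, tnth us.2 j) <= N%:R * a].
Proof.
apply: measurable_le_cst.
exact: (measurable_sum_tnth2 ml (@measurable_id _ _ setT)).
Qed.

Let mA2 : measurable [set us : N.-tuple U0 * N.-tuple S0 |
  \sum_(j < N) cost (tnth (xN us) j) <= N%:R * p].
Proof. exact: (measurable_le_cst _ (measurableT_comp mcostN mxN)). Qed.

Let mA3 : measurable [set us : N.-tuple U0 * N.-tuple S0 |
  (iid PO N [set o | miss (us, o)] <= eps%:E)%E].
Proof.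
have mpr := measurable_prob_section1 (iid PO N) mmiss.
rewrite -[X in measurable X]setTI.
apply: emeasurable_fun_le => //; exact: mpr.
Qed.

Let mA : measurable A.
Proof.
rewrite /A [X in measurable X](_ : _ = [set us : N.-tuple U0 * N.-tuple S0 |
   \sum_(j < N) l (tnth us.1 j, tnth us.2 j) <= N%:R * a] `&` ([set us |
   \sum_(j < N) cost (tnth (xN us) j) <= N%:R * p] `&` [set us |
  (iid PO N [set o | miss (us, o)] <= eps%:E)%E])).
  exact: (measurableI _ _ mA1 (measurableI _ _ mA2 mA3)).
by apply/seteqP; split=> us /= => [[? ? ?]|[? [? ?]]]; split.
Qed.

(** Chernoff bound: the exponential of the total score has mean at most 1 under the codebook law,
    whatever the output [y]. *)
Lemma gp_packing y : (iid PU N [set u | D (u, y)] <= (expR (- (N%:R * b)))%:E)%E.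
Proof.
have ml'y j : measurable_fun setT (fun u => l' (u, tnth y j)).
  exact: measurable_fun_pair1.
have mS := measurable_expR_sum_tnth (fun j => ml'y j).
rewrite -[X in iid PU N X]setIT.
have mDy := measurable_section2 mD y.
rewrite -(integral_indic (iid PU N) measurableT mDy).
have H := @integral_iid_expR_le1 _ _ _ PU N _ (fun j => ml'y j) (fun j => l'P (tnth y j)).
apply: (@le_trans _ _ ((expR (- (N%:R * b)))%:E * 1)%E); last by rewrite mule1.
apply: (le_trans _ (lee_wpmul2l _ H)); last by rewrite lee_fin expR_ge0.
rewrite -(ge0_integralTZl _ mS _ (expR_ge0 _)); last by move=> t; rewrite lee_fin expR_ge0.
apply: ge0_le_integralT.
- by apply/measurable_EFinP; exact: measurable_indic.
- by move=> u; rewrite lee_fin.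
- by apply: measurable_funeM; exact: mS.
- move=> u; rewrite -EFinM lee_fin -expRD indicE.
  case: (boolP (u \in _)) => [|_]; last by rewrite expR_ge0.
  move=> /set_mem /= Du; rewrite (_ : true%:R = expR 0); last by rewrite expR0.
  by rewrite ler_expR addrC subr_ge0.
Qed.

Local Notation phiN := (fun vs => tuple_map2 phi vs.1 vs.2).

Let mphiN : measurable_fun setT (fun vs : N.-tuple V0 * N.-tuple S0 => phiN vs).
Proof. exact: measurable_tuple_map2. Qed.

Let mphis : measurable_fun setT (fun vs : N.-tuple V0 * N.-tuple S0 => (phiN vs, vs.2)).
Proof. exact: (measurable_fun_pair mphiN measurable_snd). Qed.

Let typical (s : N.-tuple S0) : \bar R := iid PV N [set v | A (tuple_map2 phi v s, s)].

Let mtypical : measurable [set vs : N.-tuple V0 * N.-tuple S0 | A (phiN vs, vs.2)].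
Proof. exact: (measurable_preimageT mphis mA). Qed.

(** Read backwards, it bounds from below the chance that a fresh codeword is typical with [s]: on
    typical pairs the density of the conditional law with respect to the codebook law is at most
    [expR (N * a)]. *)
Lemma typical_le s : (typical s <= (expR (N%:R * a))%:E * iid PU N [set u | A (u, s)])%E.
Proof.
have mAs := measurable_section2 mA s.
have mAv : measurable [set v : N.-tuple V0 | A (tuple_map2 phi v s, s)].
  exact: (measurable_section2 mtypical s).
have mi : measurable_fun setT (fun u => (\1_[set u | A (u, s)] u)%:E : \bar R).
  by apply/measurable_EFinP; exact: measurable_indic.
have i0 u : (0 <= (\1_[set u | A (u, s)] u)%:E :> \bar R)%E by rewrite lee_fin.
rewrite /typical -[X in iid PV N X]setIT -(integral_indic (iid PV N) measurableT mAv).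
rewrite -[X in (_ * iid PU N X)%E]setIT -(integral_indic (iid PU N) measurableT mAs).
rewrite (ge0_integral_iid_change mphi ml phiP s mi i0).
rewrite -(ge0_integralTZl _ mi i0 (expR_ge0 _)).
have mS := @measurable_expR_sum_tnth _ U0 R N (fun i u => l (u, tnth s i))
  (fun i => measurable_fun_pair1 _ ml).
apply: ge0_le_integralT.
- exact: (emeasurable_funM mS mi).
- by move=> u; rewrite mule_ge0// lee_fin expR_ge0.
- exact: measurable_funeM.
- move=> u; rewrite -!EFinM lee_fin indicE.
  case: (boolP (u \in _)) => [|_]; last by rewrite !mulr0.
  by move=> /set_mem[/= Au _ _]; rewrite !mulr1 ler_expR.
Qed.

(** Here [q] is the chance that one codeword is typical and [t] the conditional typical probability.
    Bernoulli's inequality gives the bound 1 / (1 + K t), which is convex in [t] and so lies below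
    its chord on the unit interval. The resulting bound is affine in [t] and can be averaged over
    the interference. *)
Lemma one_sub_expn_le (q t K : R) L : 0 <= q <= 1 -> 0 <= t <= 1 -> 0 <= K ->
  K * t <= L%:R * q -> (1 - q) ^+ L <= (1 - t) + (1 + K)^-1.
Proof.
move=> /andP[q0 q1] /andP[t0 t1] K0 Kt.
have B n : (1 - q) ^+ n * (1 + n%:R * q) <= 1.
  elim: n => [|n IH]; first by rewrite expr0 mul0r addr0 mulr1.
  apply: le_trans IH; rewrite exprS -mulrA mulrCA; apply: ler_wpM2l.
    by rewrite exprn_ge0// subr_ge0.
  rewrite -natr1; have : 0 <= n%:R * q * q + q * q by rewrite addr_ge0 ?mulr_ge0.
  by move=> h; lra.
have Kt0 : 0 <= K * t by rewrite mulr_ge0.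
have K1 : 0 < 1 + K by lra.
apply: (@le_trans _ _ (1 + K * t)^-1).
  rewrite -[leRHS]mul1r ler_pdivlMr; last by lra.
  apply: le_trans (B L); apply: ler_wpM2l; last by lra.
  by rewrite exprn_ge0// subr_ge0.
rewrite -[leLHS]mul1r ler_pdivrMr; last by lra.
have -> : (1 - t + (1 + K)^-1) * (1 + K * t) =
  1 + (1 - t) * (1 + K * t + K ^+ 2 * t) / (1 + K).
  by field; rewrite gt_eqF.
rewrite lerDl divr_ge0//; last exact: ltW.
by rewrite mulr_ge0 ?subr_ge0// !addr_ge0// mulr_ge0// exprn_ge0.
Qed.

Lemma prob_real d (T : measurableType d) (P : probability T R) (B : set T) :
  measurable B -> exists2 r, 0 <= r <= 1 & P B = r%:E.
Proof.
move=> mB; have Pfin : P B \is a fin_num by exact: fin_num_measure.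
exists (fine (P B)); last by rewrite fineK.
by rewrite fine_ge0//= -lee_fin fineK// probability_le1.
Qed.

Lemma markov_ge0 d (T : measurableType d) (P : probability T R) (f : T -> \bar R)
    (e : R) : measurable_fun setT f -> (forall x, 0 <= f x)%E -> 0 <= e ->
  (e%:E * P [set x | (e%:E < f x)%E] <= \int[P]_x f x)%E.
Proof.
move=> mf f0 e0.
have mB : measurable [set x | (e%:E < f x)%E].
  rewrite -[X in measurable X]setTI.
  apply: emeasurable_fun_lt; [exact: measurableT|exact: measurable_cst|exact: mf].
have mi : measurable_fun setT (fun x => (\1_[set x | (e%:E < f x)%E] x)%:E : \bar R).
  by apply/measurable_EFinP; exact: measurable_indic.
rewrite -[X in P X]setIT -(integral_indic P measurableT mB).
rewrite -(ge0_integralTZl _ mi)//; apply: ge0_le_integralT => //.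
- exact: measurable_funeM.
- by move=> x; rewrite mule_ge0// lee_fin.
- move=> x; rewrite indicE; case: (boolP (x \in _)) => [/set_mem/= /ltW|_].
    by rewrite mule1.
  by rewrite mule0.
Qed.

(** [K] is the factor by which the bin size exceeds [expR (N * a)]; the price of a finite bin is the
    single term 1 / (1 + K). *)
Lemma gp_covering_typical L K : 0 <= K -> K * expR (N%:R * a) <= L%:R ->
  (\int[iid PS N]_s \prod_(i < L) iid PU N [set u | ~ A (u, s)] <=
   \int[iid PS N]_s iid PV N [set v | ~ A (tuple_map2 phi v s, s)] +
   ((1 + K)^-1)%:E)%E.
Proof.
move=> K0 KL.
have mnA : measurable (~` A) by exact: measurableC.
have mnt : measurable (~` [set vs : N.-tuple V0 * N.-tuple S0 | A (phiN vs, vs.2)]).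
  exact: measurableC.
have mu : measurable_fun setT (fun s => iid PU N [set u | ~ A (u, s)]).
  have mnA' : measurable [set x : N.-tuple S0 * N.-tuple U0 | ~ A (x.2, x.1)].
    exact: (measurable_preimageT (f := fun x => (x.2, x.1))
      (measurable_fun_pair measurable_snd measurable_fst) mnA).
  exact: (measurable_prob_section1 (iid PU N) mnA').
have mv : measurable_fun setT
    (fun s => iid PV N [set v | ~ A (tuple_map2 phi v s, s)]).
  have mnt' := measurable_preimageT (f := fun x : N.-tuple S0 * N.-tuple V0 => (x.2, x.1))
    (measurable_fun_pair measurable_snd measurable_fst) mnt.
  exact: (measurable_prob_section1 (iid PV N) mnt').
have Ki0 : (0 <= ((1 + K)^-1)%:E :> \bar R)%E.
  by rewrite lee_fin invr_ge0 addr_ge0.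
rewrite -[X in (_ <= _ + X)%E](integral_cst_prob (iid PS N)).
rewrite -(ge0_integralTD _ mv (fun s => measure_ge0 _ _) (measurable_cst _) (fun s => Ki0)).
have mprod n : measurable_fun setT
    (fun s => \prod_(i < n) iid PU N [set u | ~ A (u, s)])%E.
  elim: n => [|n IH]; first by under eq_fun do rewrite big_ord0; exact: measurable_cst.
  under eq_fun do rewrite big_ord_recl; exact: emeasurable_funM.
have prod_ge0 n s : (0 <= \prod_(i < n) iid PU N [set u | ~ A (u, s)])%E.
  by elim: n => [|n IH]; rewrite ?big_ord0// big_ord_recl mule_ge0.
apply: (ge0_le_integralT _ (mprod L) (prod_ge0 L)).
  exact: (emeasurable_funD mv (measurable_cst _)).
move=> s; have mAs := measurable_section2 mA s.
have mAv : measurable [set v : N.-tuple V0 | A (tuple_map2 phi v s, s)].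
  exact: (measurable_section2 mtypical s).
have [q q01 qE] := prob_real (iid PU N) mAs.
have [t t01 tE] := prob_real (iid PV N) mAv.
have := typical_le s; rewrite /typical qE tE -EFinM lee_fin => tq.
rewrite (_ : [set v | ~ _] = ~` [set v | A (tuple_map2 phi v s, s)])//.
rewrite (_ : [set u | ~ _] = ~` [set u | A (u, s)])//.
rewrite !probability_setC// qE tE.
rewrite (_ : \prod_(i < L) _ = ((1 - q) ^+ L)%:E)%E; last first.
  elim: (L) => [|n IH]; first by rewrite big_ord0 expr0.
  by rewrite big_ord_recl IH exprS.
rewrite lee_fin; apply: one_sub_expn_le => //.
apply: (@le_trans _ _ (K * (expR (N%:R * a) * q))); first by rewrite ler_wpM2l.
by rewrite mulrA; apply: ler_wpM2r => //; case/andP: q01.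
Qed.

Let PVS := (PV \x PS)%E.
Let f1 (w : V0 * S0) : R := l (phi w, w.2).
Let f3 (w : V0 * S0) : R := cost (xin (phi w, w.2)).
Let f2 (w : (V0 * S0) * O0) : R :=
  l' (phi w.1, chan (xin (phi w.1, w.1.2), (w.1.2, w.2))).

Let mps : measurable_fun setT (fun w : V0 * S0 => (phi w, w.2)).
Proof. exact: (measurable_fun_pair mphi measurable_snd). Qed.
Let mf1 : measurable_fun setT f1. Proof. exact: (measurableT_comp ml mps). Qed.
Let mxps := measurableT_comp mxin mps.
Let mf3 : measurable_fun setT f3. Proof. exact: (measurableT_comp mcost mxps). Qed.
Let mf2 : measurable_fun setT f2.
Proof.
apply: (measurableT_comp ml'); apply: measurable_fun_pair.
  exact: (measurableT_comp mphi measurable_fst).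
apply: (measurableT_comp mchan); apply: measurable_fun_pair.
  exact: (measurableT_comp mxps measurable_fst).
apply: measurable_fun_pair; last exact: measurable_snd.
exact: (measurableT_comp measurable_snd measurable_fst).
Qed.

(** The third requirement of typicality bounds a conditional probability of rejection. Its mean is
    the joint probability of rejection, at most [r2], so by Markov it exceeds [eps] with probability
    at most [r2 / eps]. *)
Lemma gp_atypical r1 r2 r3 : 0 < eps ->
  (iid PVS N [set w | (N%:R * a < \sum_(j < N) f1 (tnth w j))%R] <= r1%:E)%E ->
  (iid PVS N [set w | (N%:R * p < \sum_(j < N) f3 (tnth w j))%R] <= r3%:E)%E ->
  (iid (PVS \x PO) N [set w | (\sum_(j < N) f2 (tnth w j) < N%:R * b)%R] <= r2%:E)%E ->
  (\int[iid PS N]_s iid PV N [set v | ~ A (tuple_map2 phi v s, s)]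
    <= (r1 + r3 + r2 / eps)%:E)%E.
Proof.
move=> eps0 H1 H3 H2.
set J := (iid PV N \x iid PS N)%E.
have mW1 : measurable [set w : N.-tuple (V0 * S0) | (N%:R * a < \sum_(j < N) f1 (tnth w j))%R].
  rewrite (_ : [set w | _] = ~` [set w : N.-tuple (V0 * S0) | \sum_(j < N) f1 (tnth w j) <= N%:R * a]).
    apply: measurableC; apply: measurable_le_cst.
    by apply: (@measurable_sum_tnth _ _ _ _ (fun=> f1)) => _; exact: mf1.
  by apply/seteqP; split=> w /=; rewrite ltNge => /negP.
have mW3 : measurable [set w : N.-tuple (V0 * S0) | (N%:R * p < \sum_(j < N) f3 (tnth w j))%R].
  rewrite (_ : [set w | _] = ~` [set w : N.-tuple (V0 * S0) | \sum_(j < N) f3 (tnth w j) <= N%:R * p]).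
    apply: measurableC; apply: measurable_le_cst.
    by apply: (@measurable_sum_tnth _ _ _ _ (fun=> f3)) => _; exact: mf3.
  by apply/seteqP; split=> w /=; rewrite ltNge => /negP.
set W2 := [set w : N.-tuple ((V0 * S0) * O0) | (\sum_(j < N) f2 (tnth w j) < N%:R * b)%R].
have mW2 : measurable W2.
  rewrite (_ : W2 = ~` [set w : N.-tuple ((V0 * S0) * O0) | N%:R * b <= \sum_(j < N) f2 (tnth w j)]).
    apply: measurableC; apply: measurable_ge_cst.
    by apply: (@measurable_sum_tnth _ _ _ _ (fun=> f2)) => _; exact: mf2.
  by rewrite /W2; apply/seteqP; split=> w /=; rewrite ltNge => /negP.
have mW2' := measurable_preimageT (@measurable_tuple_zip _ _ _ _ N) mW2.
pose g (w : N.-tuple (V0 * S0)) : \bar R := iid PO N [set o | W2 (tuple_zip (w, o))].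
have mg : measurable_fun setT g by exact: (measurable_prob_section1 (iid PO N) mW2').
have g0 w : (0 <= g w)%E by exact: measure_ge0.
have mz := @measurable_tuple_zip _ _ V0 S0 N.
have mgz := measurableT_comp mg mz.
have missE v s o : miss ((tuple_map2 phi v s, s), o) = W2 (tuple_zip (tuple_zip (v, s), o)).
  rewrite /miss /D /W2 /=; apply/propext.
  rewrite (_ : \sum_(j < N) l' _ = \sum_(j < N) f2 (tnth (tuple_zip (tuple_zip (v, s), o)) j)).
    by split=> [/negP|H]; [rewrite -ltNge|apply/negP; rewrite -ltNge].
  by apply: eq_bigr => j _; rewrite /f2 !tnth_mktuple /= ?tnth_mktuple.
have gE v s : iid PO N [set o | miss ((tuple_map2 phi v s, s), o)] = g (tuple_zip (v, s)).
  by congr (iid PO N _); apply/seteqP; split=> o /=; rewrite missE.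
pose B1 := (@tuple_zip _ _ V0 S0 N) @^-1` [set w | (N%:R * a < \sum_(j < N) f1 (tnth w j))%R].
pose B3 := (@tuple_zip _ _ V0 S0 N) @^-1` [set w | (N%:R * p < \sum_(j < N) f3 (tnth w j))%R].
pose B2 := [set vs : N.-tuple V0 * N.-tuple S0 | (eps%:E < g (tuple_zip vs))%E].
have mB1 : measurable B1 by exact: measurable_preimageT mz mW1.
have mB3 : measurable B3 by exact: measurable_preimageT mz mW3.
have mB2 : measurable B2.
  rewrite -[X in measurable X]setTI.
  by apply: emeasurable_fun_lt; [exact: measurableT|exact: measurable_cst|exact: mgz].
have mnt : measurable (~` [set vs : N.-tuple V0 * N.-tuple S0 | A (phiN vs, vs.2)]).
  exact: measurableC.
have sub : ~` [set vs : N.-tuple V0 * N.-tuple S0 | A (phiN vs, vs.2)] `<=` (B1 `|` B3) `|` B2.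
  move=> [v s] /= nA; apply: contrapT => nB; apply: nA; split.
  - rewrite leNgt; apply/negP => H; apply: nB; left; left.
    rewrite /B1 /preimage /= (eq_bigr (fun j => l (tnth (tuple_map2 phi v s) j, tnth s j)))//.
    by move=> j _; rewrite /f1 !tnth_mktuple.
  - rewrite leNgt; apply/negP => H; apply: nB; left; right.
    rewrite /B3 /preimage /= (eq_bigr (fun j => cost (tnth (xN (tuple_map2 phi v s, s)) j)))//.
    by move=> j _; rewrite /f3 /xN !tnth_mktuple.
  - rewrite leNgt; apply/negP => H; apply: nB; right.
    by rewrite /B2 /= -gE.
rewrite -[leLHS](tonelli_sets (iid PV N) (iid PS N) mnt) -prod_prob1.
have mB13 : measurable (B1 `|` B3) by exact: measurableU.
apply: (le_trans (prob_leU J mnt mB13 mB2 sub)).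
rewrite [leRHS]EFinD; apply: leeD.
  apply: (le_trans (prob_leU J mB13 mB1 mB3 (@subset_refl _ _))).
  rewrite EFinD; apply: leeD.
    by apply: le_trans H1; rewrite -(iid_zip PV PS mW1).
  by apply: le_trans H3; rewrite -(iid_zip PV PS mW3).
have := markov_ge0 J mgz (fun vs => g0 _) (ltW eps0).
rewrite -lee_pdivlMl// => /le_trans; apply.
rewrite mulrC EFinM lee_pmul2l//; last by rewrite lte_fin invr_gt0.
rewrite (ge0_integral_iid_zip PV PS mg g0).
apply: le_trans H2; rewrite -(iid_zip PVS PO mW2).
by rewrite [leRHS](@prod_prob1 _ _ _ _ _ (iid PVS N) (iid PO N)).
Qed.

Hypothesis p_ge0 : 0 <= p.
Let x0N : N.-tuple X0 := [tuple x00 | _ < N].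
Local Notation encN := (gp_enc xN x0N A).

Let cost_le_sum (x : N.-tuple X0) j : cost (tnth x j) <= \sum_(k < N) cost (tnth x k).
Proof. by rewrite (bigD1 j)//= lerDl sumr_ge0. Qed.

Let sum_cost_enc L (c : L.-tuple (N.-tuple U0)) s :
  \sum_(k < N) cost (tnth (encN c s) k) <= N%:R * p.
Proof.
have [[_ ->]|[i [_ H _] ->]] := gp_encP xN x0N A c s; last exact: H.
rewrite big1 ?mulr_ge0// => k _; by rewrite tnth_mktuple.
Qed.

Lemma tuple_map2_swap (T1 T2 T3 : Type) (f : T1 * T2 -> T3) (i j : 'I_N) u s :
  tuple_map2 f (tuple_swap i j u) (tuple_swap i j s) = tuple_swap i j (tuple_map2 f u s).
Proof.
apply: eq_from_tnth => k.
by rewrite tnth_mktuple !tnth_tuple_swap tnth_mktuple.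
Qed.

Let D_swap i j u y : D (tuple_swap i j u, tuple_swap i j y) = D (u, y).
Proof.
rewrite /D /=; congr (is_true (_ <= _)).
rewrite -[RHS](sum_tuple_swap i j); apply: eq_bigr => k _.
by rewrite !tnth_tuple_swap.
Qed.

Let miss_swap i j u s o : miss ((tuple_swap i j u, tuple_swap i j s), o) =
  miss ((u, s), tuple_swap i j o).
Proof.
rewrite /miss /=; congr (~ _).
rewrite -(D_swap i j u); congr (D (_, _)).
rewrite -[in LHS](tuple_swapK i j o).
by rewrite /block_out /tuple_zip /xN /= !tuple_map2_swap.
Qed.

Lemma iid_swap_set d (T : measurableType d) (P : probability T R) n (i j : 'I_n)
    (B : set (n.-tuple T)) : measurable B ->
  iid P n [set t | B (tuple_swap i j t)] = iid P n B.
Proof.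
move=> mB; have mB' := measurable_preimageT (measurable_tuple_swap (T := T) i j) mB.
have mi : measurable_fun setT (fun x => (\1_B x)%:E : \bar R).
  by apply/measurable_EFinP; exact: measurable_indic.
rewrite -[X in _ = iid P n X]setIT -(integral_indic (iid P n) measurableT mB).
rewrite -[X in iid P n X = _]setIT -(integral_indic (iid P n) measurableT mB').
by rewrite -(ge0_integral_iid_swap P i j mi).
Qed.

(** The two sums are symmetric in the positions; the reliability condition is invariant because a
    swap of codeword and interference can be moved onto the noise, whose law is exchangeable. *)
Let A_swap i j u s : A (tuple_swap i j u, tuple_swap i j s) = A (u, s).
Proof.
have mm := measurable_section1 mmiss (u, s).
rewrite /A /=; congr [/\ is_true _ , is_true _ & is_true _].
- congr (_ <= _); rewrite -[RHS](sum_tuple_swap i j); apply: eq_bigr => k _.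
  by rewrite !tnth_tuple_swap.
- congr (_ <= _); rewrite -[RHS](sum_tuple_swap i j); apply: eq_bigr => k _.
  by rewrite /xN /= tuple_map2_swap tnth_tuple_swap.
- congr (_ <= _)%E; rewrite -(iid_swap_set _ i j mm).
  by congr (iid PO N _); apply/seteqP; split=> o /=; rewrite miss_swap.
Qed.

(** Typicality is invariant, so the search stops at the same index after all positions have been
    permuted. *)
Let enc_swap i j (c : seq (N.-tuple U0)) s :
  encN (map (tuple_swap i j) c) (tuple_swap i j s) = tuple_swap i j (encN c s).
Proof.
elim: c => [|u c IH] /=.
  by apply: eq_from_tnth => k; rewrite tnth_tuple_swap !tnth_mktuple.
have -> : ((tuple_swap i j u, tuple_swap i j s) \in A) = ((u, s) \in A).
  by rewrite /in_mem /mem /= /in_set A_swap.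
by case: ifP => _; [rewrite /xN /= tuple_map2_swap|exact: IH].
Qed.

Lemma ge0_sum_cst n (x : \bar R) : (0 <= x)%E -> (\sum_(i < n) x = n%:R%:E * x)%E.
Proof.
move=> x0; elim: n => [|n IH]; first by rewrite big_ord0 mul0e.
by rewrite big_ord_recr /= IH -[X in (_ + X)%E]mul1e -ge0_muleDl ?lee_fin// -EFinD natr1.
Qed.

Section mean_cost.
Variable L : nat.

Let fc j (bs : L.-tuple (N.-tuple U0) * N.-tuple S0) : \bar R :=
  (cost (tnth (encN bs.1 bs.2) j))%:E.

Let fc0 j bs : (0 <= fc j bs)%E. Proof. by rewrite lee_fin. Qed.

Let mfc j : measurable_fun setT (fc j).
Proof.
apply/measurable_EFinP; apply: (measurableT_comp mcost).
exact: (measurableT_comp (measurable_tnth j) (measurable_gp_enc (L := L) x0N mxN mA)).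
Qed.

Let Phi j : \bar R := (\int[iid (iid PU N) L]_c \int[iid PS N]_s fc j (c, s))%E.

(* Codebook and interference are exchangeable over the letters, so a bound on the
   total power gives the letterwise one. *)
Let Phi_swap i j : Phi j = Phi i.
Proof.
rewrite /Phi.
have mG := measurable_integral_snd (iid PS N) (mfc j) (fc0 j).
rewrite -(@ge0_integral_iid_map _ _ _ (iid PU N) L (tuple_swap i j) _ _ _ mG); last 3 first.
- exact: measurable_tuple_swap.
- by move=> g mg g0; exact: ge0_integral_iid_swap.
- by move=> c; exact: integral_ge0.
apply: eq_integral => c _.
rewrite -(ge0_integral_iid_swap PS i j (measurable_fun_pair2 (map_tuple (tuple_swap i j) c) (mfc j)) (fun s => fc0 _ _)).
apply: eq_integral => s _.
by rewrite /fc /= enc_swap tnth_tuple_swap tpermR.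
Qed.

Lemma gp_mean_cost j : (Phi j <= p%:E)%E.
Proof.
have N0 : (0 < N%:R :> R) by rewrite ltr0n; case: j => k; exact: leq_ltn_trans.
have E : (\sum_(i < N) Phi i = N%:R%:E * Phi j)%E.
  under eq_bigr => i _ do rewrite (Phi_swap j i).
  by apply: ge0_sum_cst; apply: integral_ge0 => c _; exact: integral_ge0.
rewrite -(@lee_pmul2l _ N%:R%:E)// -E.
rewrite /Phi -ge0_integralT_sum; last 2 first.
- by move=> i; exact: (measurable_integral_snd (iid PS N) (mfc i) (fc0 i)).
- by move=> i c; exact: integral_ge0.
rewrite -EFinM -[leRHS](integral_cst_prob (iid (iid PU N) L)).
apply: ge0_le_integralT.
- by apply: emeasurable_sum => i; exact: (measurable_integral_snd (iid PS N) (mfc i) (fc0 i)).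
- by move=> c; apply: sume_ge0 => i _; exact: integral_ge0.
- exact: measurable_cst.
(* For every codebook and every interference the total cost is at most [N * p], by typicality or by
   the free fallback word. *)
move=> c; rewrite -ge0_integralT_sum; last 2 first.
- by move=> i; exact: (measurable_fun_pair2 c (mfc i)).
- by move=> i s.
rewrite -[leRHS](integral_cst_prob (iid PS N)).
apply: ge0_le_integralT.
- by apply: emeasurable_sum => i; exact: (measurable_fun_pair2 c (mfc i)).
- by move=> s; apply: sume_ge0 => i _.
- exact: measurable_cst.
- by move=> s; rewrite /fc sumEFin lee_fin /=; exact: sum_cost_enc.
Qed.

End mean_cost.

(** The terms below [E] are, in order: rejection of the bin that was used, failure to find a typical
    codeword, acceptance of a wrong codeword, and the spread of the power over messages. The last
    one uses [B = N * p], since one letter costs at most the whole block. *)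
Theorem gelfand_pinsker_block M L K r1 r2 r3 E : (0 < M)%N -> 0 < eps -> 0 <= K ->
  K * expR (N%:R * a) <= L%:R -> 0 <= r1 -> 0 <= r2 -> 0 <= r3 ->
  (iid PVS N [set w | (N%:R * a < \sum_(j < N) f1 (tnth w j))%R] <= r1%:E)%E ->
  (iid PVS N [set w | (N%:R * p < \sum_(j < N) f3 (tnth w j))%R] <= r3%:E)%E ->
  (iid (PVS \x PO) N [set w | (\sum_(j < N) f2 (tnth w j) < N%:R * b)%R] <= r2%:E)%E ->
  eps + (r1 + r3 + r2 / eps + (1 + K)^-1) + M%:R * L%:R * expR (- (N%:R * b)) +
    N%:R * ((N%:R * p) ^+ 2 / M%:R) < E ->
  exists (e : 'I_M -> N.-tuple S0 -> N.-tuple X0) (dec : N.-tuple Y0 -> 'I_M),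
  [/\ forall w, measurable_fun setT (e w),
      forall w, measurable (dec @^-1` [set w]),
      ((M%:R^-1)%:E * \sum_(w < M) (iid PS N \x iid PO N)
        [set so | dec (block_out (e w so.1, so)) <> w] <= E%:E)%E &
      forall j, ((M%:R^-1)%:E * \sum_(w < M)
        \int[iid PS N]_s (cost (tnth (e w s) j))%:E <= (p + Num.sqrt E)%:E)%E].
Proof.
move=> M0 eps0 K0 KL r10 r20 r30 H1 H3 H2 HE.
have cov : (\int[iid PS N]_s \prod_(i < L) iid PU N [set u | ~ A (u, s)] <=
    (r1 + r3 + r2 / eps + (1 + K)^-1)%:E)%E.
  apply: (le_trans (gp_covering_typical K0 KL)); rewrite EFinD; apply: leeD => //.
  exact: gp_atypical.
have rel u s : A (u, s) ->
    (iid PO N [set o | ~ D (u, block_out (xN (u, s), (s, o)))] <= eps%:E)%E.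
  by case.
have mcj j : measurable_fun setT (fun x : N.-tuple X0 => cost (tnth x j)).
  exact: (measurableT_comp mcost (measurable_tnth j)).
have cle j (c : L.-tuple (N.-tuple U0)) s : cost (tnth (encN c s) j) <= N%:R * p.
  exact: le_trans (cost_le_sum _ j) (sum_cost_enc c s).
have [|C [CE Cp]] := @random_coding _ _ _ _ _ _ _ _ _ _ _ (iid PU N) (iid PS N) (iid PO N)
  xN x0N block_out A D M L (Ordinal M0) mxN mout mA mD eps _ _ rel cov gp_packing
  (ltW eps0) N (fun j x => cost (tnth x j)) (N%:R * p) p mcj (fun j x => cost_ge0 _)
  cle (@gp_mean_cost L) E (expR_ge0 _) _ HE.
  by rewrite !addr_ge0// ?divr_ge0// ?invr_ge0 ?addr_ge0// ltW.
exists (fun w => encN (tnth C w)), (gp_dec D (Ordinal M0) C); split.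
- by move=> w; exact: (measurable_fun_pair2 (tnth C w) (measurable_gp_enc (L := L) x0N mxN mA)).
- by move=> w; exact: measurable_gp_dec.
- exact: CE.
- exact: Cp.
Qed.

End memoryless.

(** * The phase-fading channel *)

Section eventually_good_codes.
Variables (R : realType) (P Q : R) (phase : probability (measurableTypeR R) R).

Lemma nb_messagesE (r : R) N :
  (nb_messages r N)%:R = (Num.ceil (2 `^ (N%:R * r)))%:~R :> R.
Proof.
rewrite /nb_messages natr_absz ger0_norm//.
by rewrite -(@ler_int R) (le_trans _ (ceil_ge _))// powR_ge0.
Qed.

Lemma le_nb_messages (r : R) N : 2 `^ (N%:R * r) <= (nb_messages r N)%:R.
Proof. by rewrite nb_messagesE ceil_ge. Qed.

Lemma nb_messages_le (r : R) N : (nb_messages r N)%:R <= 2 `^ (N%:R * r) + 1.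
Proof.
rewrite nb_messagesE; have /andP[/ltW + _] := ceil_itv (2 `^ (N%:R * r)).
by rewrite intrB lerBlDr.
Qed.

Lemma nb_messages_gt0 (r : R) N : (0 < nb_messages r N)%N.
Proof.
by rewrite -(@ltr0n R) (lt_le_trans _ (le_nb_messages r N))// powR_gt0.
Qed.

Definition power_ok M N (c : Defs.code R M N) : Prop :=
  forall j, (input_power Q c j <= P%:E)%E.

Lemma silent_code M N : 0 <= P -> (0 < M)%N -> exists c : Defs.code R M N, power_ok c.
Proof.
move=> P0 M0; pose x0 : N.-tuple R[i] := [tuple 0 | _ < N].
have mdec w : measurable ((fun=> Ordinal M0 : 'I_M) @^-1` [set w] :
    set (N.-tuple R[i] * N.-tuple (measurableTypeR R))%type).
  have [H|H] := pselect (Ordinal M0 = w).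
    by rewrite [X in measurable X](_ : _ = setT)//; apply/seteqP; split.
  by rewrite [X in measurable X](_ : _ = set0)//; apply/seteqP; split.
exists (Code (fun=> cst x0) mdec) => j.
rewrite /input_power /= big1 ?mule0 ?lee_fin// => w _.
by rewrite tnth_mktuple normc_sqrE /= expr0n /= addr0 integral0.
Qed.

Lemma error_prob_ge0 M N (c : Defs.code R M N) : (0 <= error_prob Q phase c)%E.
Proof. by rewrite mule_ge0 ?lee_fin ?invr_ge0// sume_ge0. Qed.

(** A diagonal choice turns the family of codes indexed by the accuracy into one sequence. Silent
    codes fill the lengths at which nothing better is known, since the power constraint is imposed
    at every length. *)
Lemma achievable_eventually (r : R) : 0 <= P -> 0 <= r ->
  (forall e : R, 0 < e -> exists N0, forall N, (N0 <= N)%N ->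
    exists c : Defs.code R (nb_messages r N) N,
      power_ok c /\ (error_prob Q phase c <= e%:E)%E) ->
  achievable P Q phase r.
Proof.
move=> P0 r0 H.
pose good N k (c : Defs.code R (nb_messages r N) N) :=
  power_ok c /\ (error_prob Q phase c <= (k.+1%:R^-1)%:E)%E.
(* At length [N] one code can meet all attainable accuracies 1/(k+1) with [k < K]: the code for the
   finest of them serves the coarser ones. *)
have step N K : exists c : Defs.code R (nb_messages r N) N, power_ok c /\
    forall k, (k < K)%N -> (exists c', @good N k c') ->
      (error_prob Q phase c <= (k.+1%:R^-1)%:E)%E.
  elim: K => [|K [c [pc cP]]].
    by have [c pc] := silent_code N P0 (nb_messages_gt0 r N); exists c.
  have [[c' [pc' c'P]]|nc] := pselect (exists c', @good N K c').
    exists c'; split=> // k; rewrite ltnS => kK _; apply: le_trans c'P _.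
    by rewrite lee_fin lef_pV2 ?posrE ?ltr0n// ler_nat.
  exists c; split=> // k; rewrite ltnS leq_eqVlt => /orP[/eqP -> //|]; exact: cP.
split=> //.
pose c N := projT1 (cid (step N N)).
have cP N : power_ok (c N) /\ forall k, (k < N)%N -> (exists c', @good N k c') ->
    (error_prob Q phase (c N) <= (k.+1%:R^-1)%:E)%E.
  exact: projT2 (cid (step N N)).
exists c; split; first by move=> N; case: (cP N).
have key e : 0 < e -> exists N0, forall N, (N0 <= N)%N -> (error_prob Q phase (c N) <= e%:E)%E.
  move=> e0; have [k ke] : exists k, k.+1%:R^-1 <= e.
    exists (Num.trunc e^-1).
    rewrite -[leRHS]invrK lef_pV2 ?posrE ?invr_gt0 ?ltr0n//.
    by rewrite ltW// truncnS_gt.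
  have k0 : 0 < k.+1%:R^-1 :> R by rewrite invr_gt0.
  have [N0 N0P] := H _ k0.
  exists (maxn N0 k.+1) => N; rewrite geq_max => /andP[N0N kN].
  apply: (@le_trans _ _ (k.+1%:R^-1)%:E); last by rewrite lee_fin.
  have [_] := cP N; apply => //; have [c' [? ?]] := N0P _ N0N.
  by exists c'.
have efin N e : (error_prob Q phase (c N) <= e%:E)%E ->
    error_prob Q phase (c N) \is a fin_num.
  by move=> h; rewrite ge0_fin_numE ?error_prob_ge0// (le_lt_trans h)// ltry.
apply: cvg_EFin.
  have [N0 N0P] := key 1 ltr01; exists N0 => // N /= N0N.
  exact: efin (N0P N N0N).
apply/cvgrPdist_le => e e0; have [N0 N0P] := key e e0; exists N0 => // N /= N0N.
have h := N0P N N0N; rewrite sub0r normrN ger0_norm ?fine_ge0 ?error_prob_ge0//.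
by rewrite -lee_fin fineK// (efin _ _ h).
Qed.

End eventually_good_codes.

Section channel_codes.
Variables (R : realType) (P Q : R) (phase : probability (measurableTypeR R) R).

Local Notation RR := (measurableTypeR R).
Local Notation noise := (phase \x circular_gaussian R)%E.

(** The receiver knows the phase, so it is made part of the output; phase and additive noise
    together form the randomness of the memoryless channel. *)
Definition channel_letter (x : R[i] * (RR * (RR * R[i]))) : R[i] * RR :=
  (channel_out x, x.2.2.1).

Lemma measurable_channel_letter : measurable_fun setT channel_letter.
Proof.
apply: measurable_fun_pair; first exact: measurable_channel_out.
exact: (measurableT_comp measurable_fst (measurableT_comp measurable_snd measurable_snd)).
Qed.

Lemma channel_law_integral N (B : set (N.-tuple RR * N.-tuple RR * N.-tuple R[i])) :
  measurable B -> (channel_law Q phase N B = \int[iid (gaussian Q) N]_s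
    (iid phase N \x iid (circular_gaussian R) N) [set tz | B (s, tz.1, tz.2)])%E.
Proof.
move=> mB.
have mg := measurable_prob_section1 (iid (circular_gaussian R) N) mB.
transitivity (\int[iid (gaussian Q) N \x iid phase N]_x
  iid (circular_gaussian R) N [set z | B (x, z)])%E; first exact: prod_prob1.
rewrite (fubini_tonelli1 _ mg (fun x => measure_ge0 _ _)) /fubini_F.
by apply: eq_integral => s _; exact/esym/prod_prob1.
Qed.

(** Only a regrouping of the randomness: the block code sees letters of phase and noise, whereas
    [channel_law] has separate blocks for interference, phases and noise. *)
Lemma block_to_code M N (e : 'I_M -> N.-tuple RR -> N.-tuple R[i])
    (dec : N.-tuple (R[i] * RR) -> 'I_M) :
  (forall w, measurable_fun setT (e w)) ->
  (forall w, measurable (dec @^-1` [set w])) ->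
  exists c : Defs.code R M N, (forall w s, enc c w s = e w s) /\
   forall w, channel_law Q phase N (error_event c w) =
     (iid (gaussian Q) N \x iid noise N)%E
       [set so | dec (block_out channel_letter (e w so.1, so)) <> w].
Proof.
move=> me mdec.
pose mfun_e w : {mfun N.-tuple RR >-> N.-tuple R[i]} :=
  HB.pack (e w) (isMeasurableFun.Build _ _ _ _ (e w) (me w)).
pose dec' (yt : N.-tuple R[i] * N.-tuple RR) := dec (tuple_zip yt).
have mdec' w : measurable (dec' @^-1` [set w]).
  exact: (measurable_preimageT (@measurable_tuple_zip _ _ _ _ N) (mdec w)).
exists (Code mfun_e mdec'); split=> // w.
have mblock : measurable_fun setT (fun so : N.-tuple RR * N.-tuple (RR * R[i]) =>
    block_out channel_letter (e w so.1, so)).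
  exact: (measurableT_comp (measurable_tuple_map2 (n := N) measurable_channel_letter)
    (measurable_fun_pair (measurableT_comp (me w) measurable_fst)
      (@measurable_tuple_zip _ _ _ _ N))).
have mE : measurable [set so : N.-tuple RR * N.-tuple (RR * R[i]) |
    dec (block_out channel_letter (e w so.1, so)) <> w].
  by apply: measurableC; exact: (measurable_preimageT mblock (mdec w)).
have outE s t z : tuple_zip (output (e w s) s t z, t) =
    block_out channel_letter (e w s, (s, tuple_zip (t, z))).
  by apply: eq_from_tnth => j; rewrite !tnth_mktuple.
have errE : error_event (Code mfun_e mdec') w = (fun o : N.-tuple RR * N.-tuple RR * N.-tuple R[i] =>
    (o.1.1, tuple_zip (o.1.2, o.2))) @^-1`
    [set so | dec (block_out channel_letter (e w so.1, so)) <> w].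
  by apply/seteqP; split=> -[[s t] z] /=; rewrite /dec' outE.
have mmap : measurable_fun setT (fun o : N.-tuple RR * N.-tuple RR * N.-tuple R[i] =>
    (o.1.1, tuple_zip (o.1.2, o.2))).
  apply: measurable_fun_pair.
    exact: (measurableT_comp measurable_fst measurable_fst).
  apply: (measurableT_comp (@measurable_tuple_zip _ _ RR R[i] N)).
  apply: measurable_fun_pair; last exact: measurable_snd.
  exact: (measurableT_comp measurable_snd measurable_fst).
rewrite errE (channel_law_integral (measurable_preimageT mmap mE)).
rewrite [RHS](_ : _ = (\int[iid (gaussian Q) N]_s iid noise N [set o |
  dec (block_out channel_letter (e w s, (s, o))) <> w])%E); last exact: prod_prob1.
apply: eq_integral => s _.
rewrite -(iid_zip phase (circular_gaussian R) (measurable_section1 mE s)).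
by congr (product_measure1 _ _ _); apply/seteqP; split=> -[t z].
Qed.

End channel_codes.

(** * From single-letter means to achievable rates *)

Section single_letter.
Context d1 d2 (U0 : measurableType d1) (V0 : measurableType d2) (R : realType).
Variables (P Q : R) (phase : probability (measurableTypeR R) R).
Local Notation RR := (measurableTypeR R).
Local Notation noise := (phase \x circular_gaussian R)%E.
Variables (PU : probability U0 R) (PV : probability V0 R).
Variables (phi : V0 * RR -> U0) (xin : U0 * RR -> R[i]).
Variables (l : U0 * RR -> R) (l' : U0 * (R[i] * RR) -> R).
Hypotheses (mphi : measurable_fun setT phi) (mxin : measurable_fun setT xin)
  (ml : measurable_fun setT l) (ml' : measurable_fun setT l').
Hypothesis phiP : forall s (F : U0 -> \bar R), measurable_fun setT F ->
  (forall u, 0 <= F u)%E ->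
  (\int[PV]_v F (phi (v, s)) = \int[PU]_u ((expR (l (u, s)))%:E * F u))%E.
Hypothesis l'P : forall y, (\int[PU]_u (expR (l' (u, y)))%:E <= 1)%E.
Variables (m1 m2 m3 r : R).
Hypothesis mean1 : L2mean (PV \x gaussian Q)%E (fun w => l (phi w, w.2)) m1.
Hypothesis mean3 : L2mean (PV \x gaussian Q)%E
  (fun w => ComplexField.Normc.normc (xin (phi w, w.2)) ^+ 2) m3.
Hypothesis mean2 : L2mean ((PV \x gaussian Q) \x noise)%E
  (fun w => l' (phi w.1, channel_letter (xin (phi w.1, w.1.2), (w.1.2, w.2)))) m2.
Hypotheses (m1_ge0 : 0 <= m1) (m3P : m3 < P) (r_gt0 : 0 < r)
  (rate_lt : r * ln 2 < m2 - m1).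

Lemma weak_law_gt d (T : measurableType d) (PT : probability T R) (f : T -> R) m :
  L2mean PT f m -> exists2 K, 0 <= K & forall n (delta : R), (0 < n)%N -> 0 < delta ->
  (iid PT n [set t | (n%:R * (m + delta) < \sum_(i < n) f (tnth t i))%R]
    <= (K / (n%:R * delta ^+ 2))%:E)%E /\
  (iid PT n [set t | (\sum_(i < n) f (tnth t i) < n%:R * (m - delta))%R]
    <= (K / (n%:R * delta ^+ 2))%:E)%E.
Proof.
move=> fm; have [K K0 H] := weak_law fm; exists K => // n delta n0 d0.
have mf : measurable_fun setT f by case: fm.
have mS : measurable_fun setT (fun t : n.-tuple T => \sum_(i < n) f (tnth t i)).
  by apply: (@measurable_sum_tnth _ _ _ _ (fun=> f)) => _; exact: mf.
have mL c : measurable [set t : n.-tuple T | (c < \sum_(i < n) f (tnth t i))%R].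
  rewrite [X in measurable X](_ : _ = ~` [set t | \sum_(i < n) f (tnth t i) <= c]).
    by apply: measurableC; exact: measurable_le_cst.
  by apply/seteqP; split=> t /=; rewrite ltNge => /negP.
have mG c : measurable [set t : n.-tuple T | (\sum_(i < n) f (tnth t i) < c)%R].
  rewrite [X in measurable X](_ : _ = ~` [set t | c <= \sum_(i < n) f (tnth t i)]).
    by apply: measurableC; exact: measurable_ge_cst.
  by apply/seteqP; split=> t /=; rewrite ltNge => /negP.
have mA : measurable [set t : n.-tuple T |
    (n%:R * delta <= `|\sum_(i < n) f (tnth t i) - n%:R * m|)%R].
  apply: measurable_ge_cst; apply: (measurableT_comp (@normr_measurable R setT)).
  exact: (measurable_funB mS (measurable_cst _)).
split; apply: le_trans (H n delta n0 d0); apply: prob_le => // t /= tH.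
  by rewrite ler_normr; apply/orP; left; rewrite mulrDr in tH; lra.
by rewrite ler_normr; apply/orP; right; rewrite mulrBr in tH; lra.
Qed.

Lemma expRN_le_inv (x : R) : 0 < x -> expR (- x) <= x^-1.
Proof.
move=> x0; rewrite expRN lef_pV2 ?posrE ?expR_gt0//.
by rewrite (le_trans _ (expR_ge1Dx x))// lerDr.
Qed.

(** The messages outnumber any power of [N]. The constant 24 is 4! in the bound of exp x below by
    x^4 / 4!, taken at x = N r ln 2. *)
Lemma cube_div_messages N : (0 < N)%N ->
  N%:R * ((N%:R * P) ^+ 2 / (nb_messages r N)%:R) <=
  24 * P ^+ 2 / (r * ln 2) ^+ 4 / N%:R.
Proof.
move=> N0; have N0' : (0 : R) < N%:R by rewrite ltr0n.
set c := r * ln 2; have c0 : 0 < c by rewrite mulr_gt0// ln_gt0// ltr1n.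
have M0 : (0 : R) < (nb_messages r N)%:R by rewrite ltr0n nb_messages_gt0.
have MB : (N%:R * c) ^+ 4 / 24 <= (nb_messages r N)%:R.
  apply: le_trans (le_nb_messages r N); rewrite /powR pnatr_eq0/= -mulrA -/c.
  have Nc0 : 0 <= N%:R * c by rewrite mulr_ge0 ?ltW.
  have := expR_ge1Dxn 3 Nc0; rewrite (_ : 4`! = 24)//.
  by apply: le_trans; rewrite lerDr.
rewrite mulrA ler_pdivrMr//.
apply: (@le_trans _ _ (24 * P ^+ 2 / c ^+ 4 / N%:R * ((N%:R * c) ^+ 4 / 24))).
  rewrite le_eqVlt; apply/orP; left; apply/eqP; field.
  by rewrite !gt_eqF.
apply: ler_wpM2l => //.
by rewrite divr_ge0// divr_ge0 ?exprn_ge0 ?(ltW c0)// mulr_ge0 ?sqr_ge0.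
Qed.

Lemma add1_le_double (x : R) : 1 <= x -> x + 1 <= 2 * x.
Proof. by move=> x1; lra. Qed.

Lemma midpoint_bounds (x y : R) : x < y ->
  x + (y - x) / 2 <= y /\ x + (y - x) / 2 + (y - x) / 2 <= y.
Proof. by move=> xy; split; lra. Qed.

Lemma quarter_half_lt (E x : R) : 0 < E -> x <= E / 2 -> E / 4 + x < E.
Proof. by move=> E0 xE; lra. Qed.

Lemma error_budget_le (e x1 x2 x3 x4 x5 x6 y4 y5 y6 : R) :
  x4 <= y4 -> x5 <= y5 -> x6 <= y6 ->
  e + (x1 + x2 + x3 + x4) + x5 + x6 <= e + (x1 + x2 + x3 + y4 + y5 + y6).
Proof. by move=> h4 h5 h6; lra. Qed.

Theorem single_letter_achievable : achievable P Q phase r.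
Proof.
have [_ _ E3] := mean3.
have m3_ge0 : 0 <= m3.
  by rewrite -lee_fin -E3; apply: integral_ge0 => w _; exact: sqr_EFin_ge0.
have P0 : 0 <= P by rewrite ltW// (le_lt_trans m3_ge0).
apply: achievable_eventually => //; first exact: ltW.
move=> e e0.
pose c := r * ln 2; have c0 : 0 < c by rewrite mulr_gt0// ln_gt0// ltr1n.
(* The gap is five [delta]. One is spent on the input threshold [a], one on the bin size [L], one on
   the output threshold [b]; the two left make the number of competing codewords times
   [expR (- (N * b))] vanish. *)
pose delta := (m2 - m1 - c) / 5.
have d0 : 0 < delta by rewrite divr_gt0// subr_gt0.
(* Half of the spare power covers the fluctuation of the block cost; the other half covers the term
   [Num.sqrt E] of the codebook selection, hence the cap [gamma ^+ 2] in [E]. *)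
pose gamma := (P - m3) / 2.
have g0 : 0 < gamma by rewrite divr_gt0// subr_gt0.
pose E := Num.min e (gamma ^+ 2).
have E0 : 0 < E by rewrite lt_min e0 exprn_gt0.
pose eps := E / 4; have eps0 : 0 < eps by rewrite divr_gt0.
have [K1 K10 W1] := weak_law_gt mean1.
have [K2 K20 W2] := weak_law_gt mean2.
have [K3 K30 W3] := weak_law_gt mean3.
pose C := K1 / delta ^+ 2 + K3 / gamma ^+ 2 + K2 / delta ^+ 2 / eps + delta^-1 +
  2 / delta + 24 * P ^+ 2 / c ^+ 4.
have [N0 N0C] : exists N0, forall N, (N0 <= N)%N -> (0 < N)%N /\ C / N%:R <= E / 2.
  exists (Num.trunc (2 * C / E)).+1 => N N0N.
  have Npos : (0 < N)%N by exact: leq_trans N0N.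
  split=> //; rewrite ler_pdivrMr ?ltr0n// -ler_pdivrMl ?divr_gt0//.
  rewrite (_ : (E / 2)^-1 * C = 2 * C / E); last by field; rewrite gt_eqF.
  by rewrite (le_trans (ltW (truncnS_gt _)))// ler_nat.
exists N0 => N /N0C[Npos CN].
have Npos' : (0 : R) < N%:R by rewrite ltr0n.
pose a := m1 + delta; pose b := m2 - delta; pose p := m3 + gamma.
pose L := (Num.trunc (expR (N%:R * (a + delta)))).+1.
(* The extra exponent [delta] in the bin size leaves a factor [expR (N * delta)], which is at least
   [N * delta]; growth linear in [N] matches the 1/N of the other terms. *)
pose K := N%:R * delta; have K0 : 0 < K by rewrite mulr_gt0.
have LE : expR (N%:R * (a + delta)) <= L%:R by rewrite ltW// truncnS_gt.
have KL : K * expR (N%:R * a) <= L%:R.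
  apply: le_trans LE; rewrite [leRHS](_ : _ = expR (N%:R * delta) * expR (N%:R * a)); last first.
    by rewrite -expRD; congr expR; ring.
  apply: ler_wpM2r; first exact: expR_ge0.
  by rewrite (le_trans _ (expR_ge1Dx _))// lerDr.
have [H1 _] := W1 N delta Npos d0.
have [H3 _] := W3 N gamma Npos g0.
have [_ H2] := W2 N delta Npos d0.
pose M := nb_messages r N.
have M0 : (0 : R) < M%:R by rewrite ltr0n nb_messages_gt0.
have a_ge0 : 0 <= a + delta by rewrite !addr_ge0// ltW.
have ML : M%:R * L%:R * expR (- (N%:R * b)) <= 2 / delta / N%:R.
  have M2 : M%:R <= 2 * expR (N%:R * c).
    apply: (le_trans (nb_messages_le r N)); rewrite /powR pnatr_eq0/= -mulrA -/c.
    by apply: add1_le_double; rewrite -expR0 ler_expR mulr_ge0// ltW.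
  have L2 : L%:R <= 2 * expR (N%:R * (a + delta)).
    apply: (@le_trans _ _ (expR (N%:R * (a + delta)) + 1)).
      by rewrite /L -natr1 lerD2r; have := truncn_le (expR (N%:R * (a + delta))); rewrite expR_ge0.
    by apply: add1_le_double; rewrite -expR0 ler_expR mulr_ge0// ltW.
  apply: (@le_trans _ _ (4 * expR (- (2 * N%:R * delta)))).
    rewrite (_ : 4 * _ = (2 * expR (N%:R * c)) * (2 * expR (N%:R * (a + delta))) *
      expR (- (N%:R * b))); last first.
      rewrite (_ : - _ = N%:R * c + N%:R * (a + delta) + - (N%:R * b)); last first.
        by rewrite /b /a /delta; field.
      by rewrite !expRD; ring.
    by rewrite ler_wpM2r ?expR_ge0// ler_pM.
  have h2 : 0 < 2 * N%:R * delta by rewrite mulr_gt0// mulr_gt0.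
  apply: (@le_trans _ _ (4 * (2 * N%:R * delta)^-1)); first by rewrite ler_wpM2l// expRN_le_inv.
  rewrite le_eqVlt; apply/orP; left; apply/eqP; field.
  by rewrite !gt_eqF.
have p0 : 0 <= p by rewrite addr_ge0// ltW.
have [pP pgP] := midpoint_bounds m3P.
have NM : N%:R * ((N%:R * p) ^+ 2 / M%:R) <= 24 * P ^+ 2 / c ^+ 4 / N%:R.
  apply: le_trans (cube_div_messages Npos); apply: ler_wpM2l => //.
  apply: ler_wpM2r; first by rewrite invr_ge0.
  apply: lerXn2r; rewrite ?nnegrE; [by rewrite mulr_ge0|by rewrite mulr_ge0|].
  by apply: ler_wpM2l.
have invK_le : (1 + K)^-1 <= delta^-1 / N%:R.
  have dN : 0 < delta * N%:R by rewrite mulr_gt0.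
  have K1' : 0 < 1 + K by rewrite addr_gt0.
  by rewrite -invfM lef_pV2 ?posrE// mulrC lerDr.
have mcost : measurable_fun setT (fun z : R[i] => ComplexField.Normc.normc z ^+ 2).
  exact: measurable_normc_sqr.
have cost_ge0 (z : R[i]) : 0 <= ComplexField.Normc.normc z ^+ 2 by exact: sqr_ge0.
have cost0 : ComplexField.Normc.normc (0 : R[i]) ^+ 2 = 0 by rewrite normc_sqrE /= expr0n /= addr0.
have r10 : 0 <= K1 / (N%:R * delta ^+ 2) by rewrite divr_ge0// mulr_ge0 ?sqr_ge0// ltW.
have r20 : 0 <= K2 / (N%:R * delta ^+ 2) by rewrite divr_ge0// mulr_ge0 ?sqr_ge0// ltW.
have r30 : 0 <= K3 / (N%:R * gamma ^+ 2) by rewrite divr_ge0// mulr_ge0 ?sqr_ge0// ltW.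
have total : eps + (K1 / (N%:R * delta ^+ 2) + K3 / (N%:R * gamma ^+ 2) +
    K2 / (N%:R * delta ^+ 2) / eps + (1 + K)^-1) +
    M%:R * L%:R * expR (- (N%:R * b)) + N%:R * ((N%:R * p) ^+ 2 / M%:R) < E.
  apply: (@le_lt_trans _ _ (eps + C / N%:R)); last exact: quarter_half_lt.
  have -> : C / N%:R = K1 / (N%:R * delta ^+ 2) + K3 / (N%:R * gamma ^+ 2) +
      K2 / (N%:R * delta ^+ 2) / eps + delta^-1 / N%:R + 2 / delta / N%:R +
      24 * P ^+ 2 / c ^+ 4 / N%:R.
    by rewrite /C !mulrDl !invfM !mulrA; do 2 congr (_ + _); ring.
  exact: (error_budget_le _ _ _ _ invK_le ML NM).
have [enc0 [dec0 [menc mdec Herr Hpow]]] := @gelfand_pinsker_block _ _ _ _ _ _ _ _ _ _ _ _ _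
  PU PV (gaussian Q) noise phi xin (@channel_letter R) 0
  (fun z => ComplexField.Normc.normc z ^+ 2) l l' mphi mxin
  (@measurable_channel_letter R) mcost ml ml' cost_ge0 cost0 phiP l'P N a b p eps p0
  M L K _ _ _ E (nb_messages_gt0 r N) eps0 (ltW K0) KL r10 r20 r30 H1 H3 H2 total.
have [cd [cdE cderr]] := block_to_code Q phase menc mdec.
exists cd; split.
  move=> j; rewrite /input_power.
  under eq_bigr => w _ do under eq_integral => s _ do rewrite cdE.
  apply: (le_trans (Hpow j)); rewrite lee_fin.
  apply: le_trans pgP; rewrite lerD2l.
  rewrite -[leRHS]ger0_norm ?(ltW g0)// -sqrtr_sqr ler_wsqrtr//.
  by rewrite ge_min lexx orbT.
rewrite /error_prob; under eq_bigr => w _ do rewrite cderr.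
by apply: (le_trans Herr); rewrite lee_fin ge_min lexx.
Qed.

End single_letter.

(** * Gaussian changes of measure *)

Section density.
Context d (T : measurableType d) (R : realType).
Variables (mu nu : {measure set T -> \bar R}) (g : T -> R).
Hypotheses (mg : measurable_fun setT g) (g_ge0 : forall x, 0 <= g x).
Hypothesis nuE : forall A, measurable A -> nu A = (\int[mu]_(x in A) (g x)%:E)%E.
Import HBNNSimple.

Let integral_density_nnsfun (h : {nnsfun T >-> R}) :
  (\int[nu]_x (h x)%:E = \int[mu]_x ((h x)%:E * (g x)%:E))%E.
Proof.
have hE x : (h x)%:E =
    (\sum_(k \in range h) k%:E * (\1_(h @^-1` [set k]) x)%:E)%E.
  by rewrite fsumEFin //= fimfunE.
have mi k : measurable_fun setT (fun x => (k%:E * (\1_(h @^-1` [set k]) x)%:E)%E : \bar R).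
  by apply: measurable_funeM; apply/measurable_EFinP; exact: measurable_indic.
under eq_integral do rewrite hE.
rewrite ge0_integral_fsum//; last first.
  by move=> r x _; exact: nnfun_muleindic_ge0.
have hgE x : ((h x)%:E * (g x)%:E = \sum_(k \in range h)
    (g x)%:E * (k%:E * (\1_(h @^-1` [set k]) x)%:E))%E.
  rewrite hE muleC ge0_mule_fsumr// => r; exact: nnfun_muleindic_ge0.
under [RHS]eq_integral do rewrite hgE.
rewrite ge0_integral_fsum//; last 2 first.
- by move=> r; apply: emeasurable_funM => //; exact/measurable_EFinP.
- by move=> r x _; rewrite mule_ge0 ?lee_fin//; exact: nnfun_muleindic_ge0.
apply: eq_fsbigr => k; rewrite inE => -[x0 _ <-].
have mA : measurable (h @^-1` [set h x0]) by exact: measurable_sfunP.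
have h0 : 0 <= h x0 by [].
have mik : measurable_fun setT (fun x => (\1_(h @^-1` [set h x0]) x)%:E : \bar R).
  by apply/measurable_EFinP; exact: measurable_indic.
rewrite (ge0_integralTZl _ mik)//.
rewrite integral_indic// setIT nuE//.
under [RHS]eq_integral => x _ do rewrite muleCA.
rewrite (ge0_integralTZl _ (f := fun x => ((g x)%:E * (\1_(h @^-1` [set h x0]) x)%:E)%E))//; last 2 first.
- by apply: emeasurable_funM => //; exact/measurable_EFinP.
- by move=> x; rewrite -EFinM lee_fin mulr_ge0.
congr (_ * _)%E; rewrite integral_mkcond; apply: eq_integral => x _.
by rewrite patchE indicE; case: (x \in _); rewrite ?mule1 ?mule0.
Qed.

Lemma ge0_integral_density (f : T -> \bar R) : measurable_fun setT f ->
  (forall x, 0 <= f x)%E -> (\int[nu]_x f x = \int[mu]_x (f x * (g x)%:E))%E.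
Proof.
move=> mf f0; pose f_ := nnsfun_approx measurableT mf.
have f_ge0 n x : (0 <= (f_ n x)%:E :> \bar R)%E by rewrite lee_fin.
have mf_ n : measurable_fun setT (fun x => (f_ n x)%:E) by exact/measurable_EFinP.
have nd x : {homo (fun n => (f_ n x)%:E) : a b / (a <= b)%N >-> (a <= b)%E}.
  by move=> a b ab; rewrite lee_fin; exact/lefP/nd_nnsfun_approx.
have lim_f x : lim ((f_ n x)%:E @[n --> \oo]) = f x.
  by apply/cvg_lim => //; exact: cvg_nnsfun_approx.
transitivity (lim (\int[nu]_x (f_ n x)%:E @[n --> \oo])%E).
  rewrite -monotone_convergence//=.
  by apply: eq_integral => x _; rewrite lim_f.
under eq_fun do rewrite integral_density_nnsfun.
rewrite -monotone_convergence//=.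
- apply: eq_integral => x _; rewrite limeMr ?lim_f//.
  exact: cvg_nnsfun_approx.
- by move=> n; apply: emeasurable_funM => //; exact/measurable_EFinP.
- by move=> n x _; rewrite mule_ge0// lee_fin.
- by move=> x _ a b ab; rewrite lee_wpmul2r ?lee_fin//; exact: nd.
Qed.

End density.

Section translation.
Variable R : realType.
Local Notation RR := (measurableTypeR R).
Local Notation leb := (@lebesgue_measure R).

Lemma measurable_shift (a : R) : measurable_fun setT (fun x : RR => x + a : RR).
Proof. by apply: (@measurable_funD _ RR R setT (fun x => x) (cst a)). Qed.

Lemma lebesgue_shift (a : R) (A : set RR) : measurable A ->
  leb ((fun x => x + a) @^-1` A) = leb A.
Proof.
move=> mA; apply/esym.
pose sh : {mfun RR >-> RR} := HB.pack (fun x : RR => x + a : RR)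
  (isMeasurableFun.Build _ _ _ _ _ (measurable_shift a)).
apply: (@lebesgue_measure_unique R (pushforward leb sh)) => // X [[x y] _ <-].
rewrite /pushforward /=.
rewrite [X in _ = lebesgue_measure X](_ : _ = `]x - a, y - a]%classic).
  rewrite !lebesgue_measure_itv /= !lte_fin ltrD2r.
  by case: ifP => // _; rewrite -!EFinD; congr EFin; ring.
by apply/seteqP; split=> z /=; rewrite !in_itv/= lerBrDr ltrBlDr.
Qed.

Lemma ge0_integral_shift (a : R) (f : RR -> \bar R) : measurable_fun setT f ->
  (forall x, 0 <= f x)%E -> (\int[leb]_x f (x + a)%R = \int[leb]_x f x)%E.
Proof.
move=> mf f0.
have := ge0_integral_pushforward (measurable_shift a) leb measurableT mf
  (fun x _ => f0 x).
rewrite preimage_setT => <-; apply: eq_measure_integral; first exact: measurable_shift.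
by move=> ? A mA _; exact: lebesgue_shift.
Qed.

End translation.

Section gaussian_shift.
Variable R : realType.
Local Notation RR := (measurableTypeR R).
Local Notation leb := (@lebesgue_measure R).
Implicit Types v a x : R.

Lemma ge0_integral_normal (m s : R) (f : RR -> \bar R) : measurable_fun setT f ->
  (forall x, 0 <= f x)%E ->
  (\int[normal_prob m s]_x f x = \int[leb]_x (f x * (normal_pdf m s x)%:E))%E.
Proof.
move=> mf f0; exact: (@ge0_integral_density _ RR R leb (normal_prob m s)
  (normal_pdf m s) (measurable_normal_pdf m s) (normal_pdf_ge0 m s)
  (fun A mA => erefl) f mf f0).
Qed.

Lemma normal_pdf_sqrtE v a x : 0 < v -> normal_pdf a (Num.sqrt v) x =
  (Num.sqrt (v * pi *+ 2))^-1 * expR (- (x - a) ^+ 2 / (v *+ 2)).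
Proof.
move=> v0; rewrite normal_pdfE ?gt_eqF ?sqrtr_gt0//.
by rewrite /normal_peak /normal_fun sqr_sqrtr// ltW.
Qed.

Lemma expR_half_ln x : 0 < x -> expR (2^-1 * ln x) = Num.sqrt x.
Proof.
move=> x0; have e0 := expR_ge0 (2^-1 * ln x).
rewrite -[LHS](ger0_norm e0) -sqrtr_sqr; congr Num.sqrt.
by rewrite -expRM_natl mulrA divff// mul1r lnK// posrE.
Qed.

(* log-likelihood ratio of N(a, v) against N(0, v') *)
Definition gauss_llr v v' a x : R :=
  2^-1 * ln (v' / v) - (x - a) ^+ 2 / (2 * v) + x ^+ 2 / (2 * v').

Lemma measurable_gauss_llr v v' a : measurable_fun setT (gauss_llr v v' a).
Proof.
apply: measurable_funD; last by apply: measurable_funM => //; exact: measurable_funX.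
apply: measurable_funB => //; apply: measurable_funM => //.
by apply: measurable_funX; exact: measurable_funB.
Qed.

Lemma gauss_llr_pdf v v' a x : 0 < v -> 0 < v' ->
  expR (gauss_llr v v' a x) * normal_pdf 0 (Num.sqrt v') x =
  normal_pdf a (Num.sqrt v) x.
Proof.
move=> v0 v'0; rewrite !normal_pdf_sqrtE// subr0.
rewrite /gauss_llr -addrA expRD expR_half_ln ?divr_gt0//.
move: (pi : R) (@pi_gt0 R) => q p0.
have -> : Num.sqrt (v' / v) = Num.sqrt (v' * q *+ 2) / Num.sqrt (v * q *+ 2).
  have vq : v * q != 0 by rewrite mulf_neq0 ?gt_eqF.
  have -> : v' / v = (v' * q *+ 2) * (v * q *+ 2)^-1.
    by rewrite !mulr2n; field; rewrite -mulr2n mulrn_eq0 vq gt_eqF.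
  by rewrite sqrtrM ?sqrtrV// mulrn_wge0// mulr_ge0// ltW.
set A := Num.sqrt (v' * q *+ 2); set B := Num.sqrt (v * q *+ 2).
have A0 : A != 0 by rewrite gt_eqF// sqrtr_gt0 pmulrn_lgt0// mulr_gt0.
rewrite mulrACA (mulrC A) mulfK//; congr (_ * _).
rewrite -expRD; congr expR; rewrite !mulr2n; field.
by rewrite -?mulr2n ?mulrn_eq0 !gt_eqF.
Qed.

(** Shifting by [a] turns N(0, v) into N(a, v), whose density is that of N(0, v') times the
    exponential of [gauss_llr]. With [a] a multiple of the interference this is the hypothesis
    [phiP] for one component. *)
Lemma ge0_integral_gauss_shift v v' a (F : RR -> \bar R) : 0 < v -> 0 < v' ->
  measurable_fun setT F -> (forall x, 0 <= F x)%E ->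
  (\int[gaussian v]_x F (x + a)%R =
   \int[gaussian v']_x ((expR (gauss_llr v v' a x))%:E * F x))%E.
Proof.
move=> v0 v'0 mF F0.
have me : measurable_fun setT (fun x : RR => (expR (gauss_llr v v' a x))%:E).
  apply/measurable_EFinP; apply: (measurableT_comp (@measurable_expR R)).
  exact: measurable_gauss_llr.
have mFa : measurable_fun setT (fun x : RR => F (x + a)%R).
  exact: (measurableT_comp mF (measurable_shift a)).
have mpdf := @measurable_normal_pdf R a (Num.sqrt v).
rewrite [LHS](ge0_integral_normal 0 (Num.sqrt v) mFa (fun x => F0 _)).
have eF0 x : (0 <= (expR (gauss_llr v v' a x))%:E * F x)%E.
  by rewrite mule_ge0// lee_fin expR_ge0.
rewrite [RHS](ge0_integral_normal 0 (Num.sqrt v') (emeasurable_funM me mF) eF0).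
have mG : measurable_fun setT (fun x : RR => (F x * (normal_pdf a (Num.sqrt v) x)%:E)%E).
  by apply: (emeasurable_funM mF); exact/measurable_EFinP.
rewrite -[LHS](_ : \int[leb]_x (F (x + a)%R *
    (normal_pdf a (Num.sqrt v) (x + a)%R)%:E) = _)%E; last first.
  apply: eq_integral => x _; congr (_ * _%:E)%E.
  by rewrite !normal_pdf_sqrtE// addrK subr0.
rewrite (ge0_integral_shift a mG); last first.
  by move=> x; rewrite mule_ge0// lee_fin normal_pdf_ge0.
apply: eq_integral => x _.
by rewrite -(gauss_llr_pdf a x v0 v'0) EFinM muleCA muleA.
Qed.

Lemma integral_gauss_llr v v' a : 0 < v -> 0 < v' ->
  (\int[gaussian v']_x (expR (gauss_llr v v' a x))%:E = 1)%E.
Proof.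
move=> v0 v'0.
have H := @ge0_integral_gauss_shift v v' a (cst 1%E) v0 v'0 (measurable_cst _) (fun=> lee01).
transitivity (\int[gaussian v']_x ((expR (gauss_llr v v' a x))%:E * cst 1 x))%E.
  by apply: eq_integral => x _; rewrite mule1.
by rewrite -H; exact: (integral_cst_prob (gaussian v) 1).
Qed.

End gaussian_shift.

(** * Moments of the centred Gaussian law *)

Section gaussian_moments.
Variables (R : realType) (v : R).
Hypothesis v0 : 0 < v.
Local Notation RR := (measurableTypeR R).

Let sq0 (x : RR) : (0 <= (x ^+ 2)%:E :> \bar R)%E.
Proof. exact: sqr_EFin_ge0. Qed.

Let msq : measurable_fun setT (fun x : RR => (x ^+ 2)%:E).
Proof. by apply/measurable_EFinP; exact: measurable_funX. Qed.

Let mllr v1 v2 a : measurable_fun setT (fun x : RR => (expR (gauss_llr v1 v2 a x))%:E).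
Proof.
apply/measurable_EFinP; apply: (measurableT_comp (@measurable_expR R)).
exact: measurable_gauss_llr.
Qed.

Let e0 (x : R) : (0 <= (expR x)%:E :> \bar R)%E.
Proof. by rewrite lee_fin expR_ge0. Qed.

(* The tilted law N(0, v / w^2) has density w exp(- (w^2 - 1) x^2 / 2v) with
   respect to N(0, v); bounding exp y below by 1 + y for w on both sides of 1
   pins down the second moment. *)
Let tiltE (w x : R) : 0 < w -> expR (gauss_llr (v / w ^+ 2) v 0 x) =
  w * expR (- ((w ^+ 2 - 1) / (2 * v) * x ^+ 2)).
Proof.
move=> w0; rewrite /gauss_llr -addrA expRD expR_half_ln; last first.
  by rewrite !divr_gt0// exprn_gt0.
rewrite (_ : v / (v / w ^+ 2) = w ^+ 2); last by field; rewrite !gt_eqF// exprn_gt0.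
rewrite sqrtr_sqr gtr0_norm//; congr (_ * expR _); field.
by rewrite !gt_eqF.
Qed.

Let tilt1 w : 0 < w ->
  (\int[gaussian v]_x (expR (gauss_llr (v / w ^+ 2) v 0 x))%:E = 1)%E.
Proof. by move=> w0; apply: integral_gauss_llr => //; rewrite divr_gt0// exprn_gt0. Qed.

Let M := (\int[gaussian v]_x (x ^+ 2)%:E)%E.

Let M_ge0 : (0 <= M)%E. Proof. by apply: integral_ge0 => x _. Qed.

Let M_le w : 0 < w -> w < 1 ->
  (w%:E + (w * ((1 - w ^+ 2) / (2 * v)))%:E * M <= 1)%E.
Proof.
move=> w0 w1; rewrite -(tilt1 w0).
have k0 : 0 <= w * ((1 - w ^+ 2) / (2 * v)).
  by rewrite mulr_ge0 ?divr_ge0 ?mulr_ge0 ?(ltW v0) ?(ltW w0)// subr_ge0 expr_le1// ltW.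
rewrite -(integral_cst_prob (gaussian v) w) -(ge0_integralTZl _ msq sq0 k0).
rewrite -(ge0_integralTD _ (measurable_cst _) _ (measurable_funeM _ msq)); last 2 first.
- by move=> x; rewrite lee_fin ltW.
- by move=> x; rewrite mule_ge0// lee_fin.
apply: ge0_le_integralT.
- exact: (emeasurable_funD (measurable_cst _) (measurable_funeM _ msq)).
- by move=> x; rewrite adde_ge0// ?mule_ge0// lee_fin// ltW.
- exact: mllr.
- move=> x; rewrite -EFinM -EFinD lee_fin tiltE//.
  rewrite (_ : _ + _ = w * (1 + (1 - w ^+ 2) / (2 * v) * x ^+ 2)); last by ring.
  have -> : - ((w ^+ 2 - 1) / (2 * v) * x ^+ 2) = (1 - w ^+ 2) / (2 * v) * x ^+ 2 by ring.
  rewrite ler_pM2l//.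
  exact: expR_ge1Dx.
Qed.

Let M_ge w : 1 < w ->
  (w%:E <= 1 + (w * ((w ^+ 2 - 1) / (2 * v)))%:E * M)%E.
Proof.
move=> w1; have w0 : 0 < w by exact: lt_trans w1.
rewrite -(tilt1 w0).
have k0 : 0 <= w * ((w ^+ 2 - 1) / (2 * v)).
  by rewrite mulr_ge0 ?divr_ge0 ?mulr_ge0 ?(ltW v0) ?(ltW w0)// subr_ge0 expr_ge1// ltW.
rewrite -(integral_cst_prob (gaussian v) w) -(ge0_integralTZl _ msq sq0 k0).
rewrite -(ge0_integralTD _ (mllr _ _ _) (fun x => e0 _) (measurable_funeM _ msq)); last first.
  by move=> x; rewrite mule_ge0// lee_fin.
apply: ge0_le_integralT.
- exact: measurable_cst.
- by move=> x; rewrite lee_fin ltW.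
- exact: (emeasurable_funD (mllr _ _ _) (measurable_funeM _ msq)).
- move=> x; rewrite -EFinM -EFinD lee_fin tiltE//.
  have := expR_ge1Dx (- ((w ^+ 2 - 1) / (2 * v) * x ^+ 2)).
  set E := expR _; rewrite lerBlDr => HE.
  rewrite (_ : w * E + _ = w * (E + (w ^+ 2 - 1) / (2 * v) * x ^+ 2)); last by ring.
  by rewrite -[leLHS]mulr1 ler_pM2l.
Qed.

Lemma tilt_upper (m : R) : 0 <= m ->
  (forall w, 0 < w -> w < 1 -> w + w * ((1 - w ^+ 2) / (2 * v)) * m <= 1) -> m <= v.
Proof.
move=> m0 H; rewrite leNgt; apply/negP => vm.
have m1 : 0 < m by exact: lt_trans vm.
(* After division by [1 - w] the hypothesis reads w (1 + w) m <= 2 v, and w = 1 would be the claim.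
   The midpoint of [v / m] and 1 already contradicts it, through (m - v)(3m - v) > 0. *)
pose w := (m + v) / (2 * m).
have w0 : 0 < w by rewrite divr_gt0 ?mulr_gt0 ?addr_gt0.
have w1 : w < 1 by rewrite ltr_pdivrMr ?mulr_gt0// mul1r mulr_natl mulr2n ltrD2l.
have wm : w * (2 * m) = m + v by rewrite /w divfK// mulf_neq0// gt_eqF.
have h : w * (1 + w) * m <= 2 * v.
  rewrite -(ler_pM2l (_ : 0 < (1 - w) / (2 * v))); last first.
    by rewrite divr_gt0 ?mulr_gt0// subr_gt0.
  rewrite (_ : _ * (2 * v) = 1 - w); last by field; rewrite gt_eqF.
  rewrite (_ : (1 - w) / (2 * v) * _ = w * ((1 - w ^+ 2) / (2 * v)) * m); last by ring.
  by rewrite lerBrDl; exact: H.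
have m4 : 0 <= 4 * m by rewrite mulr_ge0.
have := ler_wpM2l m4 h.
rewrite (_ : 4 * m * _ = w * (2 * m) * (2 * m + w * (2 * m))); last by ring.
rewrite wm; have : 0 < (m - v) * (3 * m - v).
  by rewrite mulr_gt0 ?subr_gt0// (lt_trans vm)// ltr_pMl// ltr1n.
by move=> h1 h2; lra.
Qed.

Lemma tilt_lower (m : R) : 0 <= m ->
  (forall w, 1 < w -> w <= 1 + w * ((w ^+ 2 - 1) / (2 * v)) * m) -> v <= m.
Proof.
move=> m0 H; rewrite leNgt; apply/negP => mv.
have vm0 : 0 < v + m by rewrite ltr_wpDr.
(* Same argument from above 1: this choice reduces the inequality to v (v - m) <= 0. *)
pose w := 2 * v / (v + m).
have w1 : 1 < w by rewrite ltr_pdivlMr// mul1r mulr_natl mulr2n ltrD2l.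
have wm : w * (v + m) = 2 * v by rewrite /w divfK// gt_eqF.
have h : 2 * v <= w * (1 + w) * m.
  rewrite -(ler_pM2l (_ : 0 < (w - 1) / (2 * v))); last first.
    by rewrite divr_gt0 ?mulr_gt0// subr_gt0.
  rewrite (_ : _ * (2 * v) = w - 1); last by field; rewrite gt_eqF.
  rewrite (_ : (w - 1) / (2 * v) * _ = w * ((w ^+ 2 - 1) / (2 * v)) * m); last by ring.
  by rewrite lerBlDl; exact: H.
have := ler_wpM2l (sqr_ge0 (v + m)) h.
rewrite (_ : _ * (w * (1 + w) * m) = w * (v + m) * (v + m + w * (v + m)) * m); last by ring.
rewrite wm; have : 0 < v * (v * (v - m)) by rewrite !mulr_gt0// subr_gt0.
by move=> h1 h2; lra.
Qed.

Lemma gaussian_second_moment : (\int[gaussian v]_x (x ^+ 2)%:E = v%:E)%E.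
Proof.
rewrite -/M.
have h1 : (0 : R) < 2^-1 by rewrite invr_gt0.
have h2 : 2^-1 < 1 :> R by rewrite invf_lt1// ltr1n.
have Mfin : M \is a fin_num.
  (* The upper bound on the moment at [w = 1/2] already excludes an infinite value. *)
  rewrite ge0_fin_numE// ltNge leye_eq; apply/eqP => My.
  have := M_le h1 h2; rewrite My gt0_muley ?addey// lte_fin.
  by rewrite mulr_gt0// divr_gt0 ?mulr_gt0// subr_gt0 expr_lt1.
have [m mE] : exists m, M = m%:E by exists (fine M); rewrite fineK.
move: M_ge0 M_le M_ge; rewrite mE lee_fin => m0 Mle Mge; congr EFin.
apply/eqP; rewrite eq_le; apply/andP; split.
  exact: (tilt_upper m0 Mle).
exact: (tilt_lower m0 Mge).
Qed.

Lemma gaussian_fourth_moment : (\int[gaussian v]_x ((x ^+ 2) ^+ 2)%:E < +oo)%E.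
Proof.
have h1 : (0 : R) < 2^-1 by rewrite invr_gt0.
(* The tilt at [w = 1/2] says that exp y has mean 2 for y = 3 x^2 / (8 v). One factor 2 cancels the
   1/2 in the tilted density, the other comes from y^2 <= 2 exp y. *)
pose K : R := 2 * 2 * (8 * v / 3) ^+ 2.
have K0 : 0 <= K by rewrite mulr_ge0 ?sqr_ge0.
apply: (@le_lt_trans _ _ (\int[gaussian v]_x (K%:E *
    (expR (gauss_llr (v / 2^-1 ^+ 2) v 0 x))%:E))%E); last first.
  rewrite (ge0_integralTZl _ (mllr _ _ _) (fun x => e0 _) K0) tilt1//.
  by rewrite mule1 ltry.
apply: ge0_le_integralT.
- by apply: (measurable_sqr_EFin (f := fun x : RR => x ^+ 2)); exact: measurable_funX.
- by move=> x; exact: sqr_EFin_ge0.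
- by apply: measurable_funeM; exact: mllr.
- move=> x; rewrite -EFinM lee_fin tiltE//.
  set y := - (_ * x ^+ 2).
  have yE : x ^+ 2 = y * (8 * v / 3) by rewrite /y; field; rewrite gt_eqF.
  have y0 : 0 <= y.
    have : 0 <= y * (8 * v / 3) by rewrite -yE sqr_ge0.
    by rewrite pmulr_lge0// divr_gt0// mulr_gt0.
  have := expR_ge1Dxn 1 y0; set E := expR y => H.
  have yy : y ^+ 2 <= 2 * E by move: H; rewrite (_ : 2`! = 2)//; lra.
  rewrite yE exprMn (_ : K * _ = 2 * E * (8 * v / 3) ^+ 2); last first.
    by rewrite /K; field.
  by rewrite ler_wpM2r ?sqr_ge0.
Qed.

Lemma L2mean_gaussian_sqr : L2mean (gaussian v) (fun x : RR => x ^+ 2) v.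
Proof.
split; [exact: measurable_funX|exact: gaussian_fourth_moment|].
exact: gaussian_second_moment.
Qed.

(* By translation, 1 = E exp(a X/v - a^2/2v) >= 1 + a E X/v - a^2/2v for every a;
   take a = E X. *)
Lemma L2mean_gaussian_id : L2mean (gaussian v) (fun x : RR => x) 0.
Proof.
have mid : measurable_fun setT (fun x : RR => x : R) by exact: measurable_id.
have m2 : (\int[gaussian v]_x ((fun x : RR => x : R) x ^+ 2)%:E < +oo)%E.
  by rewrite gaussian_second_moment ltry.
have ix : (gaussian v).-integrable setT (fun x : RR => x%:E).
  have := sqr_integrable_mul mid (measurable_cst (1 : R)) m2 (sqr_cst_ltey _ 1).
  by under eq_fun do rewrite mulr1.
split=> //.
have fin := integrable_fin_num measurableT ix.
rewrite -(fineK fin); congr EFin; set mu := fine _.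
have H a : a / v * mu + (1 - a ^+ 2 / (2 * v)) <= 1.
  have lm : L2mean (gaussian v) (fun x : RR => x : R) mu by split=> //; rewrite fineK.
  have la := L2meanD (L2meanZ (a / v) lm) (L2mean_cst (gaussian v) (1 - a ^+ 2 / (2 * v))).
  have il := L2mean_integrable la; have [_ _ El] := la.
  rewrite -lee_fin -El -(integral_gauss_llr a v0 v0).
  apply: le_integral => //.
    apply/integrableP; split; first exact: mllr.
    under eq_integral => x _ do rewrite gee0_abs//.
    by rewrite integral_gauss_llr// ltry.
  move=> x _; rewrite lee_fin /=.
  rewrite (_ : gauss_llr v v a x = a / v * x - a ^+ 2 / (2 * v)); last first.
    by rewrite /gauss_llr divff ?gt_eqF// ln1; field; rewrite gt_eqF.
  by rewrite addrCA addrA; have := expR_ge1Dx (a / v * x - a ^+ 2 / (2 * v)); rewrite addrA addrAC.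
have := H mu; rewrite -lerBrDr => h.
have : mu ^+ 2 / (2 * v) <= 0 by move: h; rewrite (_ : mu / v * mu = 2 * (mu ^+ 2 / (2 * v))); [lra|field; rewrite gt_eqF].
rewrite pmulr_lle0 ?invr_gt0 ?mulr_gt0// => mu2.
by apply/eqP; rewrite -sqrf_eq0 eq_le mu2 sqr_ge0.
Qed.

End gaussian_moments.

Section letter_laws.
Variable R : realType.
Local Notation RR := (measurableTypeR R).

Lemma L2mean_bernoulli (f : bool -> R) :
  L2mean (bernoulli_prob (2^-1 : R)) f ((f true + f false) / 2).
Proof.
have half : 0 <= (2^-1 : R) <= 1 by rewrite invr_ge0 ler0n /= invf_le1// ler1n.
have mf (h : bool -> R) : measurable_fun setT h by [].
have pos (h : bool -> R) : (forall b, 0 <= h b) ->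
    L2mean (bernoulli_prob (2^-1 : R)) h ((h true + h false) / 2).
  move=> h0; apply: (bounded_L2mean (B := h true + h false)) => //.
    by move=> [] /=; rewrite ger0_norm// ?lerDl ?lerDr.
  rewrite integral_bernoulli_prob//.
  by rewrite -!EFinM -EFinD; congr EFin; rewrite /unstable.onem; field.
(* Adding the constant [c] makes [f] nonnegative, which reduces to [pos]. *)
set c := `|f true| + `|f false|.
have fc b : 0 <= f b + c.
  have := ler_norm (- f true); have := ler_norm (- f false); rewrite !normrN.
  by have := normr_ge0 (f true); have := normr_ge0 (f false); rewrite /c; case: b; lra.
apply: eq_L2mean (L2meanD (pos _ fc) (L2mean_cst _ (- c))) => [b|].
  by rewrite addrK.
by field.
Qed.

Lemma L2mean_circular_binomial (Delta : R) (g : RR -> R) : measurable_fun setT g ->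
  L2mean (circular_binomial Delta) g ((g Delta + g (- Delta)) / 2).
Proof.
move=> mg; apply: L2mean_distribution => //.
exact: (L2mean_bernoulli (g \o sign_phase Delta)).
Qed.

Let half_gt0 : 0 < 2^-1 :> R. Proof. by rewrite invr_gt0. Qed.

Lemma L2mean_circular_Re : L2mean (circular_gaussian R) (@complex.Re R) 0 /\
  L2mean (circular_gaussian R) (fun z => complex.Re z ^+ 2) 2^-1.
Proof.
split; apply: L2mean_distribution.
- exact: measurable_Re.
- exact: (L2mean_fst (gaussian 2^-1) (L2mean_gaussian_id half_gt0)).
- exact: (measurable_funX 2 (@measurable_Re R)).
- exact: (L2mean_fst (gaussian 2^-1) (L2mean_gaussian_sqr half_gt0)).
Qed.

Lemma L2mean_circular_Im : L2mean (circular_gaussian R) (@complex.Im R) 0 /\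
  L2mean (circular_gaussian R) (fun z => complex.Im z ^+ 2) 2^-1.
Proof.
split; apply: L2mean_distribution.
- exact: measurable_Im.
- exact: (L2mean_snd (gaussian 2^-1) (L2mean_gaussian_id half_gt0)).
- exact: (measurable_funX 2 (@measurable_Im R)).
- exact: (L2mean_snd (gaussian 2^-1) (L2mean_gaussian_sqr half_gt0)).
Qed.

End letter_laws.

Section quadratic_forms.
Context d (A : measurableType d) (R : realType) (PA : probability A R).
Local Notation RR := (measurableTypeR R).
Variables (X S : A -> R) (p q : R).
Hypotheses (X2 : L2mean PA (fun w => X w ^+ 2) p)
  (S2 : L2mean PA (fun w => S w ^+ 2) q)
  (XS : L2mean PA (fun w => X w * S w) 0)
  (X1 : L2mean PA X 0) (S1 : L2mean PA S 0).

Lemma L2mean_sqr_sum (c : R) :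
  L2mean PA (fun w => (X w + c * S w) ^+ 2) (p + c ^+ 2 * q).
Proof.
apply: eq_L2mean (L2meanD (L2meanD X2 (L2meanZ (2 * c) XS)) (L2meanZ (c ^+ 2) S2)).
- by move=> w /=; ring.
- by rewrite mulr0 addr0.
Qed.

Variables (Delta : R) (Z : R[i] -> R).
Hypotheses (Z1 : L2mean (circular_gaussian R) Z 0)
  (Z2 : L2mean (circular_gaussian R) (fun z => Z z ^+ 2) 2^-1).
Local Notation noise := (circular_binomial Delta \x circular_gaussian R)%E.

(** Second moment of an estimation error whose coefficients depend on the phase: the cross terms
    have mean 0, and the phase contributes the average over its two values. *)
Lemma L2mean_quadratic (a b c h : RR -> R) :
  measurable_fun setT a -> measurable_fun setT b -> measurable_fun setT c ->
  measurable_fun setT h ->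
  let g t := h t * (a t ^+ 2 * p + b t ^+ 2 * q + c t ^+ 2 / 2) in
  L2mean (PA \x noise)%E (fun w : A * (RR * R[i]) =>
    h w.2.1 * (a w.2.1 * X w.1 + b w.2.1 * S w.1 + c w.2.1 * Z w.2.2) ^+ 2)
    ((g Delta + g (- Delta)) / 2).
Proof.
move=> ma mb mc mh g.
have L (f : RR -> R) := @L2mean_circular_binomial R Delta f.
have mM := measurable_funM.
have ma2 := measurable_funX 2 ma; have mb2 := measurable_funX 2 mb.
have mc2 := measurable_funX 2 mc.
have T1 (f : RR -> R) (mf : measurable_fun setT f) :=
  L2mean_fst (circular_gaussian R) (L f mf).
have Taa := L2mean_prod X2 (T1 _ (mM _ _ _ _ _ _ mh ma2)).
have Tbb := L2mean_prod S2 (T1 _ (mM _ _ _ _ _ _ mh mb2)).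
have Tab := L2mean_prod XS (T1 _ (mM _ _ _ _ _ _ mh (mM _ _ _ _ _ _ ma mb))).
have Tcc := L2mean_snd PA (L2mean_prod (L _ (mM _ _ _ _ _ _ mh mc2)) Z2).
have Tac := L2mean_prod X1 (L2mean_prod (L _ (mM _ _ _ _ _ _ mh (mM _ _ _ _ _ _ ma mc))) Z1).
have Tbc := L2mean_prod S1 (L2mean_prod (L _ (mM _ _ _ _ _ _ mh (mM _ _ _ _ _ _ mb mc))) Z1).
apply: eq_L2mean (L2meanD (L2meanD (L2meanD Taa Tbb) Tcc)
  (L2meanZ 2 (L2meanD (L2meanD Tab Tac) Tbc))).
- by move=> w /=; ring.
- by rewrite /g /=; field.
Qed.

End quadratic_forms.

(** * The dirty paper scheme *)

Section linear_estimation.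
Variable R : realType.
Implicit Types p q mu c : R.

Definition output_var p q c : R := p + c ^+ 2 * q + 2^-1.

Definition codeword_var p q mu : R := p + mu ^+ 2 * q.

(** Regression coefficient: covariance of the codeword with the output over the variance of the
    output. *)
Definition estimator_gain p q mu c : R := (p + mu * c * q) / output_var p q c.

(* Error variance of the linear estimate of [X + mu S] from [X + c S + Z],
   where [X], [S], [Z] have variances [p], [q], [1/2]. *)
Definition estimator_var p q mu c : R :=
  codeword_var p q mu - (p + mu * c * q) ^+ 2 / output_var p q c.

Lemma output_var_gt0 p q c : 0 < p -> 0 < q -> 0 < output_var p q c.
Proof.
move=> p0 q0; rewrite /output_var addr_gt0 ?invr_gt0// ltr_wpDr//.
by rewrite mulr_ge0 ?sqr_ge0// ltW.
Qed.

Lemma codeword_var_gt0 p q mu : 0 < p -> 0 < q -> 0 < codeword_var p q mu.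
Proof. by move=> p0 q0; rewrite ltr_wpDr// mulr_ge0 ?sqr_ge0// ltW. Qed.

(** The left side is the determinant of the covariance matrix of codeword and output; the right side
    shows that it is positive. *)
Lemma estimator_varE p q mu c : 0 < p -> 0 < q ->
  estimator_var p q mu c * output_var p q c =
  p * q * (c - mu) ^+ 2 + codeword_var p q mu / 2.
Proof.
move=> p0 q0; have := output_var_gt0 c p0 q0; rewrite /estimator_var => V0.
by rewrite mulrBl divfK ?gt_eqF// /codeword_var /output_var; field.
Qed.

Lemma estimator_var_gt0 p q mu c : 0 < p -> 0 < q -> 0 < estimator_var p q mu c.
Proof.
move=> p0 q0; rewrite -(pmulr_lgt0 _ (output_var_gt0 c p0 q0)) estimator_varE//.
apply: ltr_wpDl; last by rewrite divr_gt0 ?codeword_var_gt0.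
by rewrite mulr_ge0 ?sqr_ge0// ltW// mulr_gt0.
Qed.

(** The left side is the mean square of (1 - k) X + (mu - k c) S - k Z, the error of estimating the
    codeword by [k] times the output. *)
Lemma estimator_error_var p q mu c : 0 < p -> 0 < q ->
  let k := estimator_gain p q mu c in
  (1 - k) ^+ 2 * p + (mu - k * c) ^+ 2 * q + (- k) ^+ 2 / 2 =
  estimator_var p q mu c.
Proof.
move=> p0 q0; have V0 := output_var_gt0 c p0 q0.
rewrite /= /estimator_var /estimator_gain /codeword_var.
set V := output_var p q c; have VE : p = V - c ^+ 2 * q - 2^-1.
  by rewrite /V /output_var; field.
rewrite -/V in V0; move: V V0 VE => V V0 VE; rewrite {}VE.
by field; rewrite gt_eqF.
Qed.

End linear_estimation.

Section score.
Context d (A : measurableType d) (R : realType) (PA : probability A R).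
Local Notation RR := (measurableTypeR R).
Variable Delta : R.

(* Identity on the support of [circular_binomial Delta], and two-valued, so
   that every function of it is measurable. *)
Definition snap (t : RR) : RR := if t == Delta then Delta else - Delta.

Lemma snap_pos : snap Delta = Delta. Proof. by rewrite /snap eqxx. Qed.

Lemma snap_neg : snap (- Delta) = - Delta.
Proof. by rewrite /snap; case: eqP. Qed.

Lemma measurable_snap (f : RR -> R) : measurable_fun setT (fun t => f (snap t)).
Proof.
rewrite (_ : (fun t => _) = fun t : RR => if t == Delta then f Delta else f (- Delta)).
  apply: measurable_fun_ifT; [|exact: measurable_cst|exact: measurable_cst].
  exact: (measurable_fun_eqr (@measurable_id _ RR setT) (measurable_cst Delta)).
by apply/funext => t; rewrite /snap; case: ifP.
Qed.

Variables (p q mu : R) (c : RR -> R).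

(** Log-likelihood ratio of the conditional law of the codeword given phase and output component
    against its codebook law. *)
Definition output_score (t y u : R) : R :=
  let cc := c (snap t) in
  gauss_llr (estimator_var p q mu cc) (codeword_var p q mu)
    (estimator_gain p q mu cc * y) u.

Lemma measurable_output_score d' (T : measurableType d') (t y u : T -> RR) :
  measurable_fun setT t -> measurable_fun setT y -> measurable_fun setT u ->
  measurable_fun setT (fun w => output_score (t w) (y w) (u w)).
Proof.
move=> mt my mu'; rewrite /output_score /gauss_llr.
have ms f := measurableT_comp (measurable_snap f) mt.
apply: measurable_funD; last first.
  apply: measurable_funM; last exact: measurable_cst.
  exact: (measurable_funX 2 mu').
apply: measurable_funB.
  exact: (ms (fun t => 2^-1 * ln (codeword_var p q mu / estimator_var p q mu (c t)))).
apply: measurable_funM; last exact: (ms (fun t => (2 * estimator_var p q mu (c t))^-1)).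
apply: (measurable_funX 2); apply: (measurable_funB mu').
exact: (measurable_funM (ms (fun t => estimator_gain p q mu (c t))) my).
Qed.

Hypotheses (p_gt0 : 0 < p) (q_gt0 : 0 < q) (mc : measurable_fun setT c).
Variables (X S : A -> R).
Hypotheses (X2 : L2mean PA (fun w => X w ^+ 2) p)
  (S2 : L2mean PA (fun w => S w ^+ 2) q)
  (XS : L2mean PA (fun w => X w * S w) 0)
  (X1 : L2mean PA X 0) (S1 : L2mean PA S 0).

(** The two quadratic terms have means -1/2 and 1/2, so only the logarithm survives: the mutual
    information between codeword and interference. *)
Lemma L2mean_input_score :
  L2mean PA (fun w => gauss_llr p (codeword_var p q mu) (mu * S w) (X w + mu * S w))
    (2^-1 * ln (codeword_var p q mu / p)).
Proof.
have W0 := codeword_var_gt0 mu p_gt0 q_gt0.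
apply: eq_L2mean (L2meanD (L2meanD
  (L2mean_cst PA (2^-1 * ln (codeword_var p q mu / p)))
  (L2meanZ (- (2 * p)^-1) X2))
  (L2meanZ (2 * codeword_var p q mu)^-1 (L2mean_sqr_sum X2 S2 XS mu))).
- by move=> w; rewrite /gauss_llr /= addrK -/(codeword_var p q mu); ring.
- by rewrite -/(codeword_var p q mu); field; rewrite !gt_eqF.
Qed.

Variable Z : R[i] -> R.
Hypotheses (Z1 : L2mean (circular_gaussian R) Z 0)
  (Z2 : L2mean (circular_gaussian R) (fun z => Z z ^+ 2) 2^-1).
Local Notation noise := (circular_binomial Delta \x circular_gaussian R)%E.

(** Again the quadratic terms cancel in the mean, for each phase separately, because [estimator_var]
    is the mean square error of the estimate. *)
Lemma L2mean_output_score :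
  L2mean (PA \x noise)%E (fun w : A * (RR * R[i]) =>
    output_score w.2.1 (X w.1 + c w.2.1 * S w.1 + Z w.2.2) (X w.1 + mu * S w.1))
    ((2^-1 * ln (codeword_var p q mu / estimator_var p q mu (c Delta)) +
      2^-1 * ln (codeword_var p q mu / estimator_var p q mu (c (- Delta)))) / 2).
Proof.
have W0 := codeword_var_gt0 mu p_gt0 q_gt0.
pose k t := estimator_gain p q mu (c (snap t)).
pose h t := (2 * estimator_var p q mu (c (snap t)))^-1.
have mk : measurable_fun setT (k : RR -> R).
  exact: (measurable_snap (fun t => estimator_gain p q mu (c t))).
have mh : measurable_fun setT (h : RR -> R).
  exact: (measurable_snap (fun t => (2 * estimator_var p q mu (c t))^-1)).
have L := L2mean_quadratic X2 S2 XS X1 S1 Delta Z1 Z2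
  (measurable_funB (measurable_cst (1 : R)) mk)
  (measurable_funB (measurable_cst (mu : R)) (measurable_funM mk mc))
  (measurableT_comp (@oppr_measurable R setT) mk) mh.
have T := L2mean_snd PA (L2mean_fst (circular_gaussian R)
  (L2mean_circular_binomial Delta (measurable_snap (fun t => 2^-1 *
     ln (codeword_var p q mu / estimator_var p q mu (c t)))))).
apply: eq_L2mean (L2meanD (L2meanD T (L2meanZ (-1) L))
  (L2meanZ (2 * codeword_var p q mu)^-1
    (L2mean_fst noise (L2mean_sqr_sum X2 S2 XS mu)))).
- move=> w /=; rewrite /output_score /gauss_llr -/(k w.2.1) -/(h w.2.1).
  by rewrite -/(codeword_var p q mu); ring.
- rewrite /= /h /k snap_pos snap_neg !estimator_error_var//.
  rewrite -/(codeword_var p q mu).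
  have v1 := estimator_var_gt0 mu (c Delta) p_gt0 q_gt0.
  have v2 := estimator_var_gt0 mu (c (- Delta)) p_gt0 q_gt0.
  by field; rewrite !gt_eqF.
Qed.

End score.

Section gaussian_pair.
Variable R : realType.
Local Notation RR := (measurableTypeR R).
Variables v1 v2 v1' v2' : R.
Hypotheses (v1_gt0 : 0 < v1) (v2_gt0 : 0 < v2) (v1'_gt0 : 0 < v1') (v2'_gt0 : 0 < v2').

Definition gauss_llr2 (a b : R) (x : RR * RR) : R :=
  gauss_llr v1 v1' a x.1 + gauss_llr v2 v2' b x.2.

Lemma measurable_gauss_llr2 a b : measurable_fun setT (gauss_llr2 a b).
Proof.
apply: measurable_funD.
- exact: (measurableT_comp (measurable_gauss_llr v1 v1' a) measurable_fst).
- exact: (measurableT_comp (measurable_gauss_llr v2 v2' b) measurable_snd).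
Qed.

Lemma ge0_integral_gauss_shift2 (a b : R) (F : RR * RR -> \bar R) :
  measurable_fun setT F -> (forall x, 0 <= F x)%E ->
  (\int[gaussian v1 \x gaussian v2]_x F (x.1 + a, x.2 + b)%R =
   \int[gaussian v1' \x gaussian v2']_x ((expR (gauss_llr2 a b x))%:E * F x))%E.
Proof.
move=> mF F0.
have me : measurable_fun setT (fun x => (expR (gauss_llr2 a b x))%:E).
  apply/measurable_EFinP; apply: (measurableT_comp (@measurable_expR R)).
  exact: measurable_gauss_llr2.
have me1 : measurable_fun setT (fun x : RR => (expR (gauss_llr v1 v1' a x))%:E).
  apply/measurable_EFinP; apply: (measurableT_comp (@measurable_expR R)).
  exact: measurable_gauss_llr.
have me2 : measurable_fun setT (fun x : RR => (expR (gauss_llr v2 v2' b x))%:E).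
  apply/measurable_EFinP; apply: (measurableT_comp (@measurable_expR R)).
  exact: measurable_gauss_llr.
have e0 (y : R) : (0 <= (expR y)%:E)%E by rewrite lee_fin expR_ge0.
have mFa : measurable_fun setT (fun x : RR * RR => F (x.1 + a, x.2 + b)%R).
  apply: (measurableT_comp mF); apply: measurable_fun_pair.
  - exact: (measurableT_comp (measurable_shift a) measurable_fst).
  - exact: (measurableT_comp (measurable_shift b) measurable_snd).
have meF := emeasurable_funM me mF.
have eF0 x : (0 <= (expR (gauss_llr2 a b x))%:E * F x)%E by rewrite mule_ge0.
have mFx (x : RR) : measurable_fun setT (fun y : RR => F (x, y)).
  exact: (measurableT_comp mF (measurable_pair1 x)).
pose G (x : RR) : \bar R :=
  (\int[gaussian v2']_y ((expR (gauss_llr v2 v2' b y))%:E * F (x, y)))%E.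
have G0 x : (0 <= G x)%E by apply: integral_ge0 => y _; rewrite mule_ge0.
have mG : measurable_fun setT G.
  apply: (measurable_integral_snd (gaussian v2')
    (f := fun x : RR * RR => ((expR (gauss_llr v2 v2' b x.2))%:E * F x)%E)).
    exact: (emeasurable_funM (measurableT_comp me2 measurable_snd) mF).
  by move=> x; rewrite mule_ge0.
transitivity (\int[gaussian v1]_x \int[gaussian v2]_y F (x + a, y + b)%R)%E.
  exact: (@fubini_tonelli1 _ _ RR RR R (gaussian v1) (gaussian v2) _ mFa (fun x => F0 _)).
transitivity (\int[gaussian v1']_x \int[gaussian v2']_y
    ((expR (gauss_llr2 a b (x, y)))%:E * F (x, y)))%E; last first.
  by rewrite (@fubini_tonelli1 _ _ RR RR R (gaussian v1') (gaussian v2') _ meF eF0).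
transitivity (\int[gaussian v1]_x G (x + a)%R)%E.
  apply: eq_integral => x _.
  exact: (ge0_integral_gauss_shift b v2_gt0 v2'_gt0 (mFx (x + a)) (fun y => F0 _)).
transitivity (\int[gaussian v1']_x ((expR (gauss_llr v1 v1' a x))%:E * G x))%E.
  exact: (ge0_integral_gauss_shift a v1_gt0 v1'_gt0 mG G0).
apply: eq_integral => x _.
transitivity (\int[gaussian v2']_y ((expR (gauss_llr v1 v1' a x))%:E *
    ((expR (gauss_llr v2 v2' b y))%:E * F (x, y))))%E; last first.
  by apply: eq_integral => y _; rewrite /gauss_llr2 /= expRD EFinM muleA.
apply: esym; apply: (ge0_integralTZl _ (emeasurable_funM me2 (mFx x)) _ (expR_ge0 _)).
by move=> y; apply: mule_ge0; [exact: e0|exact: F0].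
Qed.

Lemma integral_gauss_llr2 a b :
  (\int[gaussian v1' \x gaussian v2']_x (expR (gauss_llr2 a b x))%:E = 1)%E.
Proof.
have := ge0_integral_gauss_shift2 a b (measurable_cst 1%E) (fun=> lee01).
have E1 : (\int[gaussian v1 \x gaussian v2]_x (cst 1%E (x.1 + a, x.2 + b)%R : \bar R) = 1)%E.
  exact: (integral_cst_prob (gaussian v1 \x gaussian v2)%E (1 : R)).
move=> E2; apply: etrans E1; apply: etrans (esym E2).
by apply: eq_integral => x _; apply: esym; exact: mule1.
Qed.

End gaussian_pair.

Section gaussian_scheme.
Variable R : realType.
Local Notation RR := (measurableTypeR R).
Variables (P Q Delta p1 p2 mu1 mu2 : R).
Hypotheses (Q_gt0 : 0 < Q) (p1_gt0 : 0 < p1) (p2_gt0 : 0 < p2).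
Local Notation W1 := (codeword_var p1 Q mu1).
Local Notation W2 := (codeword_var p2 Q mu2).
Local Notation PV := (gaussian p1 \x gaussian p2)%E.

Definition dpc_codeword (w : (RR * RR) * RR) : RR * RR :=
  (w.1.1 + mu1 * w.2, w.1.2 + mu2 * w.2).

(** Subtracting the interference from the codeword leaves the independent pair with variances [p1],
    [p2], so the power does not depend on [mu1], [mu2]. *)
Definition dpc_input (w : (RR * RR) * RR) : R[i] :=
  mk_complex (w.1.1 - mu1 * w.2, w.1.2 - mu2 * w.2).

Definition dpc_input_score (w : (RR * RR) * RR) : R :=
  gauss_llr2 p1 p2 W1 W2 (mu1 * w.2) (mu2 * w.2) w.1.

(** Both output components carry the same interference, yet the scores are added as if they were
    independent. The sum is a mismatched score, but a legitimate one: for each output its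
    exponential integrates to 1 against the codebook law. *)
Definition dpc_output_score (w : (RR * RR) * (R[i] * RR)) : R :=
  output_score Delta p1 Q mu1 cos w.2.2 (complex.Re w.2.1) w.1.1 +
  output_score Delta p2 Q mu2 sin w.2.2 (complex.Im w.2.1) w.1.2.

Lemma measurable_affine_fst d (T : measurableType d) (f g : T -> RR) (c : R) :
  measurable_fun setT f -> measurable_fun setT g ->
  measurable_fun setT (fun x => f x + c * g x : RR).
Proof.
move=> mf mg; exact: (measurable_funD mf (measurable_funM (measurable_cst c) mg)).
Qed.

Let m11 : measurable_fun setT (fun w : (RR * RR) * RR => w.1.1).
Proof. exact: (measurableT_comp measurable_fst measurable_fst). Qed.
Let m12 : measurable_fun setT (fun w : (RR * RR) * RR => w.1.2).
Proof. exact: (measurableT_comp measurable_snd measurable_fst). Qed.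
Let m2 : measurable_fun setT (fun w : (RR * RR) * RR => w.2).
Proof. exact: measurable_snd. Qed.

Lemma measurable_dpc_codeword : measurable_fun setT dpc_codeword.
Proof.
exact: (measurable_fun_pair (measurable_affine_fst mu1 m11 m2)
  (measurable_affine_fst mu2 m12 m2)).
Qed.

Lemma measurable_dpc_input : measurable_fun setT dpc_input.
Proof.
apply: (measurableT_comp (@measurable_mk_complex R)); apply: measurable_fun_pair.
- exact: (measurable_funB m11 (measurable_funM (measurable_cst mu1) m2)).
- exact: (measurable_funB m12 (measurable_funM (measurable_cst mu2) m2)).
Qed.

Lemma measurable_gauss_llr_affine v v' d (T : measurableType d) (f g : T -> RR) (c : R) :
  measurable_fun setT f -> measurable_fun setT g ->
  measurable_fun setT (fun x => gauss_llr v v' (c * g x) (f x)).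
Proof.
move=> mf mg; rewrite /gauss_llr; apply: measurable_funD; last first.
  exact: (measurable_funM (measurable_funX 2 mf) (measurable_cst _)).
apply: measurable_funB; first exact: measurable_cst.
apply: measurable_funM; last exact: measurable_cst.
apply: (measurable_funX 2).
exact: (measurable_funB mf (measurable_funM (measurable_cst c) mg)).
Qed.

Lemma measurable_dpc_input_score : measurable_fun setT dpc_input_score.
Proof.
exact: (measurable_funD (measurable_gauss_llr_affine p1 W1 mu1 m11 m2)
  (measurable_gauss_llr_affine p2 W2 mu2 m12 m2)).
Qed.

Lemma measurable_dpc_output_score : measurable_fun setT dpc_output_score.
Proof.
have mt := measurableT_comp (@measurable_snd _ _ R[i] RR)
  (@measurable_snd _ _ (RR * RR)%type (R[i] * RR)%type).
have my := measurableT_comp (@measurable_fst _ _ R[i] RR)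
  (@measurable_snd _ _ (RR * RR)%type (R[i] * RR)%type).
have mu := @measurable_fst _ _ (RR * RR)%type (R[i] * RR)%type.
apply: measurable_funD.
- exact: (measurable_output_score Delta p1 Q mu1 cos mt
    (measurableT_comp (@measurable_Re R) my) (measurableT_comp measurable_fst mu)).
- exact: (measurable_output_score Delta p2 Q mu2 sin mt
    (measurableT_comp (@measurable_Im R) my) (measurableT_comp measurable_snd mu)).
Qed.

End gaussian_scheme.

Section gaussian_scheme_rate.
Variable R : realType.
Local Notation RR := (measurableTypeR R).
Variables (P Q Delta p1 p2 mu1 mu2 : R).
Hypotheses (Q_gt0 : 0 < Q) (p1_gt0 : 0 < p1) (p2_gt0 : 0 < p2).
Local Notation W1 := (codeword_var p1 Q mu1).
Local Notation W2 := (codeword_var p2 Q mu2).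
Local Notation PV := (gaussian p1 \x gaussian p2)%E.
Local Notation PVS := (PV \x gaussian Q)%E.
Local Notation noise := (circular_binomial Delta \x circular_gaussian R)%E.

Let X1 : L2mean PVS (fun w => w.1.1) 0 /\ L2mean PVS (fun w => w.1.1 ^+ 2) p1.
Proof.
split; apply: (L2mean_fst (gaussian Q) (f := fun v : RR * RR => v.1) _) ||
  apply: (L2mean_fst (gaussian Q) (f := fun v : RR * RR => v.1 ^+ 2) _).
- exact: (L2mean_fst (gaussian p2) (L2mean_gaussian_id p1_gt0)).
- exact: (L2mean_fst (gaussian p2) (L2mean_gaussian_sqr p1_gt0)).
Qed.

Let X2 : L2mean PVS (fun w => w.1.2) 0 /\ L2mean PVS (fun w => w.1.2 ^+ 2) p2.
Proof.
split; apply: (L2mean_fst (gaussian Q) (f := fun v : RR * RR => v.2) _) ||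
  apply: (L2mean_fst (gaussian Q) (f := fun v : RR * RR => v.2 ^+ 2) _).
- exact: (L2mean_snd (gaussian p1) (L2mean_gaussian_id p2_gt0)).
- exact: (L2mean_snd (gaussian p1) (L2mean_gaussian_sqr p2_gt0)).
Qed.

Let S1 : L2mean PVS (fun w => w.2) 0.
Proof. exact: (L2mean_snd PV (L2mean_gaussian_id Q_gt0)). Qed.

Let S2 : L2mean PVS (fun w => w.2 ^+ 2) Q.
Proof. exact: (L2mean_snd PV (L2mean_gaussian_sqr Q_gt0)). Qed.

Let XS1 : L2mean PVS (fun w => w.1.1 * w.2) 0.
Proof.
rewrite -[X in L2mean _ _ X](mulr0 0).
exact: (L2mean_prod (L2mean_fst (gaussian p2) (L2mean_gaussian_id p1_gt0))
  (L2mean_gaussian_id Q_gt0)).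
Qed.

Let XS2 : L2mean PVS (fun w => w.1.2 * w.2) 0.
Proof.
rewrite -[X in L2mean _ _ X](mulr0 0).
exact: (L2mean_prod (L2mean_snd (gaussian p1) (L2mean_gaussian_id p2_gt0))
  (L2mean_gaussian_id Q_gt0)).
Qed.

Lemma dpc_mean_input_score :
  L2mean PVS (fun w => dpc_input_score Q p1 p2 mu1 mu2 (dpc_codeword mu1 mu2 w, w.2))
    (2^-1 * ln (W1 / p1) + 2^-1 * ln (W2 / p2)).
Proof.
exact: (L2meanD (L2mean_input_score mu1 p1_gt0 Q_gt0 X1.2 S2 XS1)
  (L2mean_input_score mu2 p2_gt0 Q_gt0 X2.2 S2 XS2)).
Qed.

Lemma dpc_mean_power :
  L2mean PVS (fun w => ComplexField.Normc.normc
    (dpc_input mu1 mu2 (dpc_codeword mu1 mu2 w, w.2)) ^+ 2) (p1 + p2).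
Proof.
apply: eq_L2mean (L2meanD X1.2 X2.2) => // w.
by rewrite normc_sqrE /= !addrK.
Qed.

Lemma dpc_mean_output_score :
  L2mean (PVS \x noise)%E (fun w => dpc_output_score Q Delta p1 p2 mu1 mu2
      (dpc_codeword mu1 mu2 w.1, channel_letter
        (dpc_input mu1 mu2 (dpc_codeword mu1 mu2 w.1, w.1.2), (w.1.2, w.2))))
    ((2^-1 * ln (W1 / estimator_var p1 Q mu1 (cos Delta)) +
      2^-1 * ln (W1 / estimator_var p1 Q mu1 (cos (- Delta)))) / 2 +
     (2^-1 * ln (W2 / estimator_var p2 Q mu2 (sin Delta)) +
      2^-1 * ln (W2 / estimator_var p2 Q mu2 (sin (- Delta)))) / 2).
Proof.
have [R1 R2] := L2mean_circular_Re R; have [I1 I2] := L2mean_circular_Im R.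
have mcos := continuous_measurable_fun (@continuous_cos R).
have msin := continuous_measurable_fun (@continuous_sin R).
apply: eq_L2mean (L2meanD
  (L2mean_output_score Delta mu1 p1_gt0 Q_gt0 mcos X1.2 S2 XS1 X1.1 S1 R1 R2)
  (L2mean_output_score Delta mu2 p2_gt0 Q_gt0 msin X2.2 S2 XS2 X2.1 S1 I1 I2)) => //.
move=> [[[x1 x2] s] [t z]].
by rewrite /dpc_output_score /channel_letter channel_outE /= !addrK.
Qed.

(** In the difference of output and input means the codeword variances cancel, which leaves the
    ratios of [p1], [p2] to the error variances; the two phases share one in-phase error because
    cosine is even. *)
Lemma dpc_achievable (r : R) : p1 + p2 < P -> 0 < r ->
  r * ln 2 < 2^-1 * ln (p1 / estimator_var p1 Q mu1 (cos Delta)) +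
    4^-1 * (ln (p2 / estimator_var p2 Q mu2 (sin Delta)) +
            ln (p2 / estimator_var p2 Q mu2 (- sin Delta))) ->
  achievable P Q (circular_binomial Delta) r.
Proof.
move=> pP r0 rE.
have W1_gt0 : 0 < W1 by exact: codeword_var_gt0.
have W2_gt0 : 0 < W2 by exact: codeword_var_gt0.
apply: (single_letter_achievable (measurable_dpc_codeword mu1 mu2)
  (measurable_dpc_input mu1 mu2) (measurable_dpc_input_score Q p1 p2 mu1 mu2)
  (measurable_dpc_output_score Q Delta p1 p2 mu1 mu2)
  (PU := (gaussian W1 \x gaussian W2)%E) _ _
  dpc_mean_input_score dpc_mean_power dpc_mean_output_score _ pP r0).
- move=> s F mF F0.
  exact: (ge0_integral_gauss_shift2 p1_gt0 p2_gt0 W1_gt0 W2_gt0 (mu1 * s) (mu2 * s) mF F0).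
- move=> [y t].
  have := integral_gauss_llr2
    (estimator_var_gt0 mu1 (cos (snap Delta t)) p1_gt0 Q_gt0)
    (estimator_var_gt0 mu2 (sin (snap Delta t)) p2_gt0 Q_gt0) W1_gt0 W2_gt0
    (estimator_gain p1 Q mu1 (cos (snap Delta t)) * complex.Re y)
    (estimator_gain p2 Q mu2 (sin (snap Delta t)) * complex.Im y).
  by move=> E; rewrite -[leRHS]E.
- have half0 : 0 <= 2^-1 :> R by rewrite invr_ge0.
  by rewrite addr_ge0// mulr_ge0// ln_ge0// ler_pdivlMr// mul1r lerDl mulr_ge0 ?sqr_ge0// ltW.
- apply: lt_le_trans rE _; rewrite cosN sinN.
  have v1 := estimator_var_gt0 mu1 (cos Delta) p1_gt0 Q_gt0.
  have v2 := estimator_var_gt0 mu2 (sin Delta) p2_gt0 Q_gt0.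
  have v2' := estimator_var_gt0 mu2 (- sin Delta) p2_gt0 Q_gt0.
  rewrite le_eqVlt; apply/orP; left; apply/eqP.
  by rewrite !ln_div ?posrE//; field.
Qed.

End gaussian_scheme_rate.

(** * Comparison of rates *)

Section estimation_ratios.
Variable R : realType.
Variable Q : R.
Hypothesis Q_gt0 : 0 < Q.

Lemma div_estimator_var (p mu c : R) : 0 < p ->
  p / estimator_var p Q mu c =
  p * output_var p Q c / (p * Q * (c - mu) ^+ 2 + codeword_var p Q mu / 2).
Proof.
move=> p0; have v0 := estimator_var_gt0 mu c p0 Q_gt0.
have V0 := output_var_gt0 c p0 Q_gt0.
by rewrite -(estimator_varE mu c p0 Q_gt0); field; rewrite !gt_eqF.
Qed.

Lemma estimator_denominator_gt0 (p mu c : R) : 0 < p ->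
  0 < p * Q * (c - mu) ^+ 2 + codeword_var p Q mu / 2.
Proof.
move=> p0; rewrite -(estimator_varE mu c p0 Q_gt0) mulr_gt0//.
  exact: estimator_var_gt0.
exact: output_var_gt0.
Qed.

(* Costa's coefficient cancels the in-phase interference completely. *)
Lemma costa_ratio (p c : R) : 0 < p ->
  p / estimator_var p Q (2 * p * c / (2 * p + 1)) c = 1 + 2 * p.
Proof.
move=> p0; set mu := 2 * p * c / (2 * p + 1).
have d0 : 2 * p + 1 != 0 by rewrite gt_eqF// addr_gt0 ?mulr_gt0.
rewrite div_estimator_var//.
apply: (mulIf (lt0r_neq0 (estimator_denominator_gt0 mu c p0))).
rewrite divfK ?(gt_eqF (estimator_denominator_gt0 mu c p0))//.
by rewrite /output_var /codeword_var /mu; field.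
Qed.

(** With [mu = 0] the interference is treated as noise: the ratio is 1 + p / (c^2 Q + 1/2). *)
Lemma no_binning_ratio (p c : R) : 0 < p ->
  p / estimator_var p Q 0 c = (1 + 2 * p + 2 * (c ^+ 2 * Q)) / (1 + 2 * (c ^+ 2 * Q)).
Proof.
move=> p0; rewrite div_estimator_var// /codeword_var /output_var.
have c0 : 0 <= c ^+ 2 * Q by rewrite mulr_ge0 ?sqr_ge0// ltW.
have d0 : 1 + 2 * (c ^+ 2 * Q) != 0 by rewrite gt_eqF// ltr_wpDr// mulr_ge0.
have e0 : p * Q * (c - 0) ^+ 2 + (p + 0 ^+ 2 * Q) / 2 != 0.
  by have := estimator_denominator_gt0 0 c p0; rewrite /codeword_var => /lt0r_neq0.
have -> : p * Q * (c - 0) ^+ 2 + (p + 0 ^+ 2 * Q) / 2 =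
    p * (1 + 2 * (c ^+ 2 * Q)) / 2 by field.
by field; rewrite d0 gt_eqF.
Qed.

(* [t = mu^2 Q] minimizes the product of the two denominators, a quadratic in [t]. *)
Lemma two_phase_ratio (p c : R) : 0 < p ->
  2 * (c ^+ 2 * Q) + 2 * p + 1 <= 4 * p * (c ^+ 2 * Q) ->
  exists mu : R,
    (p / estimator_var p Q mu c) * (p / estimator_var p Q mu (- c)) =
    (2 * p + 2 * (c ^+ 2 * Q) + 1) * (2 * p + 1) ^+ 2 / (16 * p * (c ^+ 2 * Q)).
Proof.
move=> p0; set s := c ^+ 2 * Q => sp.
pose t := p * (4 * p * s - (2 * s + 2 * p + 1)) / (2 * p + 1) ^+ 2.
(* [sp] says exactly that the minimizer is nonnegative, hence of the form [mu ^+ 2 * Q]. *)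
have t0 : 0 <= t by rewrite divr_ge0 ?sqr_ge0// mulr_ge0 ?subr_ge0// ltW.
have s0 : 0 <= s by rewrite mulr_ge0 ?sqr_ge0// ltW.
have d0 : 0 < 2 * p + 1 by rewrite addr_gt0 ?mulr_gt0.
have s0' : 0 < s.
  have ps : 0 < 4 * p * s.
    by apply: lt_le_trans sp; rewrite -addrA ltr_wpDl// mulr_ge0.
  by move: ps; rewrite pmulr_rgt0// mulr_gt0.
exists (Num.sqrt (t / Q)); set mu := Num.sqrt _.
have muE : mu ^+ 2 * Q = t.
  have tQ : 0 <= t / Q by rewrite divr_ge0 ?(ltW Q_gt0).
  by rewrite /mu (sqr_sqrtr tQ) divfK ?gt_eqF.
have D1 := lt0r_neq0 (estimator_denominator_gt0 mu c p0).
have D2 := lt0r_neq0 (estimator_denominator_gt0 mu (- c) p0).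
rewrite !div_estimator_var// mulf_div.
have e16 : 16 * p * s != 0 by rewrite (lt0r_neq0 (mulr_gt0 (mulr_gt0 _ p0) s0')).
apply/eqP; rewrite (eqr_div _ _ (mulf_neq0 D1 D2) e16); apply/eqP.
have -> : output_var p Q (- c) = output_var p Q c by rewrite /output_var sqrrN.
have -> : output_var p Q c = p + s + 2^-1 by [].
have E e : e ^+ 2 = c ^+ 2 -> p * Q * (e - mu) ^+ 2 + codeword_var p Q mu / 2 =
    (p * (s + t) + (p + t) / 2) - 2 * p * (e * mu * Q).
  by rewrite /codeword_var muE -muE /s => <-; ring.
rewrite (E c)// (E (- c)) ?sqrrN//.
have -> : ((p * (s + t) + (p + t) / 2) - 2 * p * (c * mu * Q)) *
    ((p * (s + t) + (p + t) / 2) - 2 * p * (- c * mu * Q)) =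
    (p * (s + t) + (p + t) / 2) ^+ 2 - 4 * p ^+ 2 * (s * t).
  by rewrite -muE /s; ring.
by rewrite /t; field; rewrite gt_eqF.
Qed.

End estimation_ratios.

Section dpc_rates.
Variable R : realType.
Variables (P Q Delta : R).
Hypothesis Q_gt0 : 0 < Q.
Local Notation s := (sin Delta ^+ 2 * Q).

Let s_ge0 : 0 <= s. Proof. by rewrite mulr_ge0 ?sqr_ge0// ltW. Qed.

(** The scheme needs total power strictly below [P], and the strict rate inequality leaves room to
    lower the in-phase power. The value [z] is the power at which the inequality would become an
    equality. *)
Lemma ln_double_shrink (B x : R) : 0 < x -> B < 2^-1 * ln (1 + 2 * x) ->
  exists x', [/\ 0 < x', x' < x & B < 2^-1 * ln (1 + 2 * x')].
Proof.
move=> x0 Bx; pose z := (expR (2 * B) - 1) / 2.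
have zx : z < x.
  have h : 2 * B < ln (1 + 2 * x) by lra.
  have : expR (2 * B) < 1 + 2 * x.
    by rewrite -[ltRHS]lnK ?posrE ?ltr_expR// addr_gt0 ?mulr_gt0.
  by rewrite /z; lra.
have [x' [x'0 zx' x'x]] : exists x', [/\ 0 < x', z < x' & x' < x].
  have [z0|z0] := ltP z 0; first by exists (x / 2); split; lra.
  by exists ((z + x) / 2); split; lra.
exists x'; split=> //.
have h : expR (2 * B) < 1 + 2 * x' by move: zx'; rewrite /z; lra.
have : 2 * B < ln (1 + 2 * x').
  by rewrite -[ltLHS]expRK ltr_ln ?posrE ?expR_gt0//; apply: lt_trans h; exact: expR_gt0.
by lra.
Qed.

Lemma achievable_no_binning (x y r : R) : 0 < x -> 0 < y -> x + y <= P -> 0 < r ->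
  r * ln 2 < 2^-1 * ln (1 + 2 * x) + 2^-1 * ln ((1 + 2 * y + 2 * s) / (1 + 2 * s)) ->
  achievable P Q (circular_binomial Delta) r.
Proof.
move=> x0 y0 xy r0; rewrite -ltrBlDr => /(ln_double_shrink x0)[x' [x'0 x'x]].
rewrite ltrBlDr => rE.
apply: (@dpc_achievable _ P Q Delta x' y (2 * x' * cos Delta / (2 * x' + 1)) 0) => //.
  by apply: lt_le_trans xy; rewrite ltrD2r.
rewrite costa_ratio// !no_binning_ratio// sqrrN.
by apply: lt_le_trans rE _; rewrite lerD2l; lra.
Qed.

Lemma achievable_two_phase (x y r : R) : 0 < x -> 0 < y -> x + y <= P -> 0 < r ->
  2 * s + 2 * y + 1 <= 4 * y * s ->
  r * ln 2 < 2^-1 * ln (1 + 2 * x) +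
    4^-1 * ln ((2 * y + 2 * s + 1) * (2 * y + 1) ^+ 2 / (16 * y * s)) ->
  achievable P Q (circular_binomial Delta) r.
Proof.
move=> x0 y0 xy r0 sy; rewrite -ltrBlDr => /(ln_double_shrink x0)[x' [x'0 x'x]].
have [mu muE] := two_phase_ratio Q_gt0 y0 sy; rewrite ltrBlDr -muE => rE.
apply: (@dpc_achievable _ P Q Delta x' y (2 * x' * cos Delta / (2 * x' + 1)) mu) => //.
  by apply: lt_le_trans xy; rewrite ltrD2r.
by rewrite costa_ratio// -lnM// posrE divr_gt0// estimator_var_gt0.
Qed.

(** The scheme requires positive power in quadrature; half of what the shrinking releases goes
    there, where it can only add to the rate. *)
Lemma achievable_in_phase (r : R) : 0 < P -> 0 < r ->
  r * ln 2 < 2^-1 * ln (1 + 2 * P) -> achievable P Q (circular_binomial Delta) r.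
Proof.
move=> P0 r0 /(ln_double_shrink P0)[x [x0 xP rE]].
apply: (@achievable_no_binning x ((P - x) / 2)) => //; [lra|lra|].
apply: lt_le_trans rE _; rewrite lerDl mulr_ge0// ln_ge0//.
by move: (s) s_ge0 => v v0; rewrite ler_pdivlMr; lra.
Qed.

End dpc_rates.

(** * Algebraic bounds on the target rate *)

Section inner_gain.
Variable R : realType.
Implicit Types a b s k : R.

(* With [a = 1 + (1 - alpha) beta P] and [b = 1 + beta P], a quarter of the
   logarithm of this gain is what [rate_IN_B] adds to the in-phase rate. *)
Definition inner_gain a b s : R :=
  ((b + s) / (a + s)) ^+ 2 * (a * Num.max 1 (a * (a + s) / (a - s + 2 * s * a))).

Lemma inner_gain_denominator_gt0 a s : 1 <= a -> 0 <= s -> 0 < a - s + 2 * s * a.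
Proof. by move=> a1 s0; nra. Qed.

Lemma inner_gain_gt0 a b s : 1 <= a -> 1 <= b -> 0 <= s -> 0 < inner_gain a b s.
Proof.
move=> a1 b1 s0; have a0 : 0 < a by lra.
rewrite mulr_gt0//; first by rewrite exprn_gt0// divr_gt0//; lra.
by rewrite mulr_gt0// lt_max ltr01.
Qed.

(** One hypothesis for each branch of the maximum, cleared of denominators. *)
Lemma inner_gain_le a b s k : 1 <= a -> 0 <= s ->
  (b + s) ^+ 2 * a <= k * (a + s) ^+ 2 ->
  (b + s) ^+ 2 * a ^+ 2 <= k * ((a + s) * (a - s + 2 * s * a)) ->
  inner_gain a b s <= k.
Proof.
move=> a1 s0 h1 h2; have D0 := inner_gain_denominator_gt0 a1 s0.
have as0 : 0 < a + s by lra.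
have as2 : 0 < (a + s) ^+ 2 by rewrite exprn_gt0.
rewrite /inner_gain expr_div_n; case: (leP 1 (a * (a + s) / (a - s + 2 * s * a))) => _.
  rewrite [leLHS](_ : _ = (b + s) ^+ 2 * a ^+ 2 / ((a + s) * (a - s + 2 * s * a))).
    by rewrite ler_pdivrMr// mulr_gt0.
  by field; rewrite !gt_eqF.
by rewrite mulr1 mulrAC ler_pdivrMr.
Qed.

(** The bound is the gain of a quadrature channel free of interference. *)
Lemma inner_gain_le_sqr a b s : 1 <= a -> a <= b -> 0 <= s ->
  inner_gain a b s <= b ^+ 2.
Proof.
move=> a1 ab s0; have key : (b + s) * a <= b * (a + s) by nra.
have bsa0 : 0 <= (b + s) * a by nra.
have sq : (b + s) ^+ 2 * a ^+ 2 <= b ^+ 2 * (a + s) ^+ 2.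
  by rewrite -!exprMn ler_sqr// nnegrE//; nra.
apply: inner_gain_le => //.
  apply: le_trans sq; rewrite ler_wpM2l ?sqr_ge0// expr2; nra.
apply: le_trans sq _; rewrite ler_wpM2l ?sqr_ge0// expr2 ler_wpM2l//; nra.
Qed.

(** For [a <= s] the maximum in [inner_gain] is 1. What remains increases with [a] up to [a = b],
    where it equals [b]. *)
Lemma inner_gain_le_strong a b s : 1 <= a -> a <= b -> b <= s ->
  inner_gain a b s <= b.
Proof.
move=> a1 ab bs.
have h1 : (b + s) ^+ 2 * a <= b * (a + s) ^+ 2.
  have : 0 <= (b - a) * (s ^+ 2 - a * b) by rewrite mulr_ge0//; nra.
  by nra.
apply: inner_gain_le => //; first lra.
have h2 : (b + s) ^+ 2 * a ^+ 2 <= b * (a + s) * (a * (a + s)).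
  have -> : b * (a + s) * (a * (a + s)) = a * (b * (a + s) ^+ 2) by ring.
  by rewrite expr2 mulrCA ler_wpM2l//; lra.
apply: le_trans h2 _; rewrite -mulrA ler_wpM2l//; first lra.
by rewrite ler_wpM2l//; nra.
Qed.

(** A bound free of [a]: the two branches reduce to a^2 - a + s^2 >= 0 and s^2 (2a - 1) >= 0. *)
Lemma inner_gain_le_weak a b s : 1 <= a -> 0 <= s ->
  inner_gain a b s <= (b + s) ^+ 2 / (1 + 2 * s).
Proof.
move=> a1 s0; have d0 : 0 < 1 + 2 * s by lra.
apply: inner_gain_le => //; rewrite [leRHS]mulrAC ler_pdivlMr// -[leLHS]mulrA ler_wpM2l ?sqr_ge0//.
  by nra.
have : 0 <= s ^+ 2 * (2 * a - 1) by rewrite mulr_ge0 ?sqr_ge0//; lra.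
by nra.
Qed.

End inner_gain.

Lemma half_quarter_ln (R : realType) (x u p m : R) :
  0 < x -> 0 < u -> 0 < p -> 0 < m ->
  2^-1 * ln x + 2^-1 * ln u + 4^-1 * ln p + 4^-1 * ln m =
  4^-1 * ln (x ^+ 2 * (u ^+ 2 * (p * m))).
Proof.
move=> x0 u0 p0 m0; have x2 := exprn_gt0 2 x0; have u2 := exprn_gt0 2 u0.
have pm := mulr_gt0 p0 m0.
rewrite [ln (x ^+ 2 * _)]lnM ?posrE ?mulr_gt0// [ln (u ^+ 2 * _)]lnM ?posrE//.
by rewrite [ln (p * m)]lnM ?posrE// !lnXn// !mulr2n; field.
Qed.

Section rate_bounds.
Variable R : realType.
Variables (P Q Delta : R).
Hypotheses (P_gt0 : 0 < P) (Q_gt0 : 0 < Q).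
Local Notation s := (sin Delta ^+ 2 * Q).

Let s_ge0 : 0 <= s. Proof. by rewrite mulr_ge0 ?sqr_ge0// ltW. Qed.

(** With the four logarithms merged into one, rates are compared through rational gains. *)
Lemma rate_IN_B_nats (al be : R) : 0 <= al <= 1 -> 0 <= be <= 1 ->
  rate_IN_B P Q Delta al be * ln 2 =
  4^-1 * ln ((1 + (1 - be) * P) ^+ 2 *
             inner_gain (1 + (1 - al) * be * P) (1 + be * P) s).
Proof.
move=> /andP[a0 a1] /andP[b0 b1].
have l2 : ln 2 != 0 :> R by rewrite gt_eqF// ln_gt0// ltr1n.
have ln2E (u1 u2 u3 u4 : R) : (2^-1 * log2 u1 + 2^-1 * log2 u2 + 4^-1 * log2 u3 +
    4^-1 * log2 u4) * ln 2 = 2^-1 * ln u1 + 2^-1 * ln u2 + 4^-1 * ln u3 + 4^-1 * ln u4.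
  by rewrite /log2; field.
rewrite /rate_IN_B /= ln2E.
move: (s) s_ge0 => v v0.
set x := (1 - be) * P; set p := (1 - al) * be * P; set y := be * P.
have x0 : 0 <= x by apply: mulr_ge0 (ltW P_gt0); lra.
have y0 : 0 <= y by apply: mulr_ge0 (ltW P_gt0); lra.
have p0 : 0 <= p by rewrite /p -mulrA; apply: mulr_ge0 y0; lra.
have py : al * be * P = y - p by rewrite /p /y; ring.
have D0 : 0 < p + 2 * v * p + v + 1 by have := mulr_ge0 v0 p0; lra.
have e1 : 1 + al * be * P / (1 + p + v) = (1 + y + v) / (1 + p + v).
  by rewrite py; field; rewrite gt_eqF//; lra.
have e2 : (p + 1) * (p + v + 1) / (p + 2 * v * p + v + 1) =
    (1 + p) * (1 + p + v) / (1 + p - v + 2 * v * (1 + p)).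
  have E : p + 2 * v * p + v + 1 = 1 + p - v + 2 * v * (1 + p) by ring.
  by rewrite -E; congr (_ / _); ring.
have p1 : 0 < 1 + p by lra.
have x1 : 0 < 1 + x by lra.
have u0 : 0 < (1 + y + v) / (1 + p + v) by rewrite divr_gt0//; lra.
by rewrite e1 e2 half_quarter_ln// lt_max ltr01.
Qed.

(** (1 + x)(1 + y) <= 1 + 2 (x + y) amounts to x y <= x + y, which holds as soon as one of the two
    is at most 1. *)
Lemma outer_gain_small (x y M : R) : 0 <= x -> 0 <= y -> (x <= 1) || (y <= 1) ->
  0 <= M -> M <= (1 + y) ^+ 2 -> (1 + x) ^+ 2 * M <= (1 + 2 * (x + y)) ^+ 2.
Proof.
move=> x0 y0 xy1 M0 My; apply: (@le_trans _ _ (((1 + x) * (1 + y)) ^+ 2)).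
  by rewrite exprMn ler_wpM2l ?sqr_ge0.
have xy : x * y <= x + y by case/orP: xy1 => ?; nra.
by rewrite ler_sqr ?nnegrE; nra.
Qed.

Lemma outer_gain_large (x M K : R) : 1 <= x -> 0 <= M -> 4 * M <= 9 * K ->
  (1 + x) ^+ 2 * M <= (1 + 2 * x) ^+ 2 * K.
Proof.
move=> x1 M0 MK; have K0 : 0 <= K by lra.
have h : 9 * (1 + x) ^+ 2 <= 4 * (1 + 2 * x) ^+ 2 by nra.
have h1 : (1 + x) ^+ 2 * (4 * M) <= (1 + x) ^+ 2 * (9 * K) by rewrite ler_wpM2l ?sqr_ge0.
have h2 : K * (9 * (1 + x) ^+ 2) <= K * (4 * (1 + 2 * x) ^+ 2) by rewrite ler_wpM2l.
have e1 : (1 + x) ^+ 2 * (4 * M) = 4 * ((1 + x) ^+ 2 * M) by ring.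
have e2 : (1 + x) ^+ 2 * (9 * K) = K * (9 * (1 + x) ^+ 2) by ring.
have e3 : K * (4 * (1 + 2 * x) ^+ 2) = 4 * ((1 + 2 * x) ^+ 2 * K) by ring.
by lra.
Qed.

Lemma strong_interference_gain (y v M : R) : 1 <= y -> 0 < v -> 0 <= M -> M <= 1 + y ->
  4 * M <= 9 * ((2 * y + 2 * v + 1) * (2 * y + 1) ^+ 2 / (16 * y * v)).
Proof.
move=> y1 v0 M0 My; have d0 : 0 < 16 * y * v by rewrite !mulr_gt0//; lra.
rewrite mulrA ler_pdivlMr//; apply: (@le_trans _ _ (4 * (1 + y) * (16 * y * v))).
  by rewrite ler_pM2r// ler_pM2l.
(* Dropping 2y + 1 from the first factor and 1 from the square leaves 64 against 72 as coefficients
   of v y (y + 1). *)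
have h : (2 * v) * (4 * y * (y + 1)) <= (2 * y + 2 * v + 1) * (2 * y + 1) ^+ 2.
  by apply: ler_pM; nra.
have : 0 <= v * (y * (y + 1)) by rewrite !mulr_ge0//; lra.
by move: h; nra.
Qed.

(** The threshold 2 on [v] comes from here: 4 (1 + 2v) <= 20, while (1 + 2w)^2 >= 9/4 (1 + w)^2 for
    w = y + v >= 1 makes the right side at least 81/4 times (1 + w)^2. *)
Lemma weak_interference_gain (y v M : R) : 1 <= y -> 0 <= v -> v <= 2 -> 0 <= M ->
  M <= (1 + y + v) ^+ 2 / (1 + 2 * v) ->
  4 * M <= 9 * ((1 + 2 * y + 2 * v) / (1 + 2 * v)) ^+ 2.
Proof.
move=> y1 v0 v2 M0 My; have d0 : 0 < 1 + 2 * v by lra.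
have d2 := exprn_gt0 2 d0.
apply: (@le_trans _ _ (4 * ((1 + y + v) ^+ 2 / (1 + 2 * v)))); first by rewrite ler_pM2l.
have -> : 4 * ((1 + y + v) ^+ 2 / (1 + 2 * v)) =
    4 * (1 + y + v) ^+ 2 * (1 + 2 * v) / (1 + 2 * v) ^+ 2 by field; rewrite gt_eqF.
rewrite expr_div_n [leRHS]mulrA ler_pM2r ?invr_gt0//.
have h1 : (1 + y + v) ^+ 2 * (1 + 2 * v) <= (1 + y + v) ^+ 2 * 5.
  by rewrite ler_wpM2l ?sqr_ge0//; lra.
have h2 : 9 * (1 + y + v) ^+ 2 <= 4 * (1 + 2 * y + 2 * v) ^+ 2 by nra.
have W0 := sqr_ge0 (1 + y + v).
rewrite -[leLHS]mulrA; apply: (@le_trans _ _ (4 * ((1 + y + v) ^+ 2 * 5))).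
  by rewrite ler_pM2l.
by lra.
Qed.

(** The polynomial inequality is split by the auxiliary factor 2 + y + v: [h3] compares it with the
    factors special to this regime, using [v <= 1 + y], and [h4] with the square of 1 + y + v. *)
Lemma moderate_interference_gain (y v M : R) : 1 <= y -> 0 < v -> v <= 1 + y -> 0 <= M ->
  M <= (1 + y + v) ^+ 2 / (1 + 2 * v) ->
  4 * M <= 9 * ((2 * y + 2 * v + 1) * (2 * y + 1) ^+ 2 / (16 * y * v)).
Proof.
move=> y1 v0 vy M0 My; have d0 : 0 < 1 + 2 * v by lra.
have e0 : 0 < 16 * y * v by rewrite !mulr_gt0//; lra.
apply: (@le_trans _ _ (4 * ((1 + y + v) ^+ 2 / (1 + 2 * v)))); first by rewrite ler_pM2l.
rewrite [leLHS]mulrA [leRHS]mulrA ler_pdivrMr// [leRHS]mulrAC ler_pdivlMr//.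
have h1 : 4 * y * (y + 1) <= (2 * y + 1) ^+ 2 by nra.
have h2 : v * (2 + y + v) <= (y + 1) * (1 + 2 * v) by nra.
have h3 : (4 * y) * (v * (2 + y + v)) <= (2 * y + 1) ^+ 2 * (1 + 2 * v).
  apply: (@le_trans _ _ (4 * y * ((y + 1) * (1 + 2 * v)))).
    by rewrite ler_wpM2l//; lra.
  by rewrite mulrA ler_wpM2r//; lra.
have h4 : 16 * (1 + y + v) ^+ 2 <= 9 * (2 * y + 2 * v + 1) * (2 + y + v) by nra.
have h5 : 9 * (2 * y + 2 * v + 1) * ((4 * y) * (v * (2 + y + v))) <=
    9 * (2 * y + 2 * v + 1) * ((2 * y + 1) ^+ 2 * (1 + 2 * v)).
  by rewrite ler_wpM2l//; lra.
have h6 : (4 * y * v) * (16 * (1 + y + v) ^+ 2) <=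
    (4 * y * v) * (9 * (2 * y + 2 * v + 1) * (2 + y + v)).
  by rewrite ler_wpM2l// !mulr_ge0//; lra.
have e1 : 4 * (1 + y + v) ^+ 2 * (16 * y * v) = (4 * y * v) * (16 * (1 + y + v) ^+ 2) by ring.
have e2 : (4 * y * v) * (9 * (2 * y + 2 * v + 1) * (2 + y + v)) =
   9 * (2 * y + 2 * v + 1) * ((4 * y) * (v * (2 + y + v))) by ring.
have e3 : 9 * (2 * y + 2 * v + 1) * ((2 * y + 1) ^+ 2 * (1 + 2 * v)) =
  9 * ((2 * y + 2 * v + 1) * (2 * y + 1) ^+ 2) * (1 + 2 * v) by ring.
by rewrite e1 -e3; apply: le_trans h6 _; rewrite e2.
Qed.

Lemma achievable_lt_rate_IN_B (al be r : R) : 0 <= al <= 1 -> 0 <= be <= 1 ->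
  0 < r -> r < rate_IN_B P Q Delta al be ->
  achievable P Q (circular_binomial Delta) r.
Proof.
move=> al01 be01 r0 rlt.
have l2 : 0 < ln 2 :> R by rewrite ln_gt0// ltr1n.
have rE : r * ln 2 < rate_IN_B P Q Delta al be * ln 2 by rewrite ltr_pM2r.
move: rE; rewrite (rate_IN_B_nats al01 be01) => rE.
move: al01 be01 => /andP[a0 a1] /andP[b0 b1].
set x := (1 - be) * P in rE; set y := be * P in rE.
set a := 1 + (1 - al) * be * P in rE; set M := inner_gain _ _ _ in rE.
have x0 : 0 <= x by apply: mulr_ge0 (ltW P_gt0); lra.
have y0 : 0 <= y by apply: mulr_ge0 (ltW P_gt0); lra.
have xyP : x + y = P by rewrite /x /y; ring.
have age1 : 1 <= a by rewrite lerDl -mulrA; apply: mulr_ge0 y0; lra.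
have ab : a <= 1 + y.
  rewrite lerD2l -mulrA -/y -[leRHS]mul1r; apply: ler_wpM2r y0 _ _ _; lra.
have M0 : 0 < M by apply: inner_gain_gt0 s_ge0; lra.
have x2M : 0 < (1 + x) ^+ 2 * M by rewrite mulr_gt0// exprn_gt0//; lra.
have upto B : (1 + x) ^+ 2 * M <= B -> r * ln 2 < 4^-1 * ln B.
  move=> MB; apply: lt_le_trans rE _; rewrite ler_pM2l ?invr_gt0//.
  by rewrite ler_ln ?posrE// (lt_le_trans x2M).
have quarter2 (z : R) : 0 < z -> 4^-1 * ln (z ^+ 2) = 2^-1 * ln z.
  by move=> z0; rewrite lnXn// mulr2n; field.
have [small|/norP[]] := boolP ((x <= 1) || (y <= 1)).
  apply: achievable_in_phase => //; rewrite -quarter2; last by have := P_gt0; lra.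
  apply: upto; rewrite -xyP.
  by apply: outer_gain_small (ltW M0) _ => //; apply: inner_gain_le_sqr.
rewrite -!ltNge => x1 y1.
have x2 : 0 < 1 + 2 * x by lra.
have xp : 0 < x by lra.
have yp : 0 < y by lra.
have xy : x + y <= P by rewrite xyP.
(* Since [y > 1], the bound [2 < s] ensures the condition under which a real minimizing coefficient
   exists; the regime left over, [s <= 2], is the one where ignoring the interference suffices. *)
have binning (v0 : 2 < s) : 4 * M <= 9 * ((2 * y + 2 * s + 1) * (2 * y + 1) ^+ 2 / (16 * y * s)) ->
    achievable P Q (circular_binomial Delta) r.
  move=> MG; apply: (achievable_two_phase Q_gt0 xp yp xy r0); first by nra.
  set G := _ / _ in MG *.
  have G0 : 0 < G by lra.
  by rewrite -quarter2// -mulrDr -lnM ?posrE ?exprn_gt0//; apply/upto/outer_gain_large; lra.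
have [ys|sy] := leP (1 + y) s.
  apply: binning; first lra.
  by apply: strong_interference_gain; [lra|lra|lra|exact: inner_gain_le_strong].
have Mw : M <= (1 + y + s) ^+ 2 / (1 + 2 * s) by apply: inner_gain_le_weak.
have [s2|s2] := leP s 2.
  apply: (achievable_no_binning Q_gt0 xp yp xy r0).
  set u := (1 + 2 * y + 2 * s) / (1 + 2 * s).
  have u0 : 0 < u.
    by rewrite /u; move: (s) s_ge0 => v v0; apply: divr_gt0; lra.
  rewrite -(quarter2 _ x2) -(quarter2 _ u0) -mulrDr -lnM ?posrE ?exprn_gt0//.
  apply/upto/outer_gain_large; [lra|lra|].
  by apply: weak_interference_gain => //; lra.
by apply: binning => //; apply: moderate_interference_gain => //; lra.
Qed.

End rate_bounds.

Section main_bounds.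
Variable R : realType.
Variables (P Q Delta : R).
Hypotheses (P_gt0 : 0 < P) (Q_gt0 : 0 < Q).
Local Notation s := (sin Delta ^+ 2 * Q).
Local Notation C := (capacity P Q (circular_binomial Delta)).

Let s_ge0 : 0 <= s. Proof. by rewrite mulr_ge0 ?sqr_ge0// ltW. Qed.

Lemma rate_IN_B_le_capacity (al be : R) : 0 <= al <= 1 -> 0 <= be <= 1 ->
  ((rate_IN_B P Q Delta al be)%:E <= C)%E.
Proof.
move=> al01 be01.
have leC r : achievable P Q (circular_binomial Delta) r -> (r%:E <= C)%E.
  by move=> Ar; apply: ereal_sup_ubound; exists r.
have l2 : 0 < ln 2 :> R by rewrite ln_gt0// ltr1n.
have l2P : 0 < ln (1 + 2 * P) by rewrite ln_gt0// ltrDl mulr_gt0.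
(* Half the in-phase rate: one positive achievable rate, which makes the capacity positive and, in
   the argument by contradiction, finite. *)
have r0 : 0 < ln (1 + 2 * P) / (4 * ln 2) by rewrite divr_gt0// mulr_gt0.
have := leC _ (achievable_in_phase Delta Q_gt0 P_gt0 r0 _).
have -> : ln (1 + 2 * P) / (4 * ln 2) * ln 2 = 4^-1 * ln (1 + 2 * P).
  by field; rewrite gt_eqF.
move=> /(_ ltac:(lra)) r0C; rewrite leNgt; apply/negP => CR.
have Cfin : C \is a fin_num.
  rewrite fin_real//; apply/andP; split.
    by apply: lt_le_trans r0C; exact: ltNyr.
  by apply: lt_trans CR _; exact: ltry.
move: CR r0C leC; rewrite -(fineK Cfin); set c := fine C.
rewrite lte_fin lee_fin => cR r0c leC.
(* The midpoint is positive and below the rate, hence achievable, yet it exceeds the capacity. *)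
have := leC ((c + rate_IN_B P Q Delta al be) / 2).
rewrite lee_fin leNgt => /(_ _)/negP; apply; last by lra.
by apply: (achievable_lt_rate_IN_B P_gt0 Q_gt0 al01 be01); lra.
Qed.

Lemma inner_gain_ge (a b v : R) : 1 <= a ->
  ((b + v) / (a + v)) ^+ 2 * a <= inner_gain a b v.
Proof.
move=> a1; rewrite ler_wpM2l ?sqr_ge0// ler_peMr ?le_max ?lexx//; lra.
Qed.

(** Power is split evenly, [p] stands for the part (1 - alpha) P / 2 of the quadrature power, and
    the maximum is bounded below by 1. The value of alpha is read off from [p]. *)
Lemma rate_IN_B_half_ge (p K : R) : 0 <= p <= P / 2 -> 0 < K ->
  K <= ((1 + P / 2 + s) / (1 + p + s)) ^+ 2 * (1 + p) ->
  exists2 al, 0 <= al <= 1 &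
    4^-1 * ln ((1 + P / 2) ^+ 2 * K) <= rate_IN_B P Q Delta al 2^-1 * ln 2.
Proof.
move=> /andP[p0 pP] K0 Kle.
have al01 : 0 <= 1 - p / (P / 2) <= 1.
  have P20 : 0 < P / 2 by rewrite divr_gt0.
  by rewrite subr_ge0 ler_pdivrMr// mul1r pP gerDl oppr_le0 divr_ge0// ltW.
exists (1 - p / (P / 2)) => //; rewrite rate_IN_B_nats//; last first.
  by rewrite invr_ge0 ler0n invf_le1// ler1n.
have -> : (1 - (1 - p / (P / 2))) * 2^-1 * P = p by field; rewrite gt_eqF.
have -> : (1 - 2^-1) * P = P / 2 by field.
rewrite [2^-1 * P]mulrC ler_pM2l ?invr_gt0//.
have h0 : 0 < (1 + P / 2) ^+ 2.
  by rewrite exprn_gt0// addr_gt0// divr_gt0.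
have p1 : 1 <= 1 + p by lra.
have M0 : 0 < inner_gain (1 + p) (1 + P / 2) s.
  by apply: inner_gain_gt0 => //; have := P_gt0; lra.
rewrite ler_ln ?posrE; [|exact: mulr_gt0 h0 K0|exact: mulr_gt0 h0 M0].
by rewrite ler_pM2l//; apply: le_trans Kle (inner_gain_ge _ _ p1).
Qed.

Lemma rate_IN_APP_B_le (r : R) : rate_IN_APP_B P Q Delta = Some r ->
  exists2 al, 0 <= al <= 1 & r <= rate_IN_B P Q Delta al 2^-1.
Proof.
have l2 : 0 < ln 2 :> R by rewrite ln_gt0// ltr1n.
set h := 1 + P / 2; have h0 : 1 < h by rewrite /h; have := P_gt0; lra.
have hp : 0 < h by lra.
have sge0 : 0 <= s := s_ge0.
(* Each branch of the closed form is written as the quarter logarithm of a gain; its subtracted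
   constants 1 and 5/4 become the factors 2^-4 and 2^-5 in [K]. *)
suff key p K : 0 <= p <= P / 2 -> 0 < K -> K <= ((h + s) / (1 + p + s)) ^+ 2 * (1 + p) ->
    r * ln 2 = 4^-1 * ln (h ^+ 2 * K) ->
    exists2 al, 0 <= al <= 1 & r <= rate_IN_B P Q Delta al 2^-1.
  have ln2E n : ln (2 ^+ n) = n%:R * ln 2 :> R by rewrite lnXn// mulr_natl.
  rewrite /rate_IN_APP_B -/h /=; move: (s) sge0 key => v v0 key; case: ifP => [s1 [rE]|s1].
    (* alpha = 1, where the closed form equals the gain with the maximum replaced by 1. *)
    apply: (key 0 (((h + v) / (1 + v)) ^+ 2)); rewrite ?addr0 ?mulr1//.
    - by rewrite lexx/= divr_ge0// ltW.
    - by rewrite exprn_gt0// divr_gt0//; lra.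
    - rewrite -rE; have -> : 1 + P / (2 + 2 * v) = (h + v) / (1 + v).
        by rewrite /h; field; rewrite !gt_eqF//; lra.
      have u0 : 0 < (h + v) / (1 + v) by rewrite divr_gt0//; lra.
      rewrite /log2 [ln (h ^+ 2 * _)]lnM ?posrE ?exprn_gt0// !lnXn// !mulr2n.
      by field; rewrite gt_eqF.
  case: ifP => [s2 [rE]|s2].
    (* alpha = 0: the gain is [h] itself. *)
    apply: (key (P / 2) (h / 2 ^+ 4)).
    - by rewrite lexx divr_ge0// ltW.
    - by rewrite divr_gt0// exprn_gt0.
    - rewrite -/h divff ?gt_eqF//; last by lra.
      by rewrite expr1n mul1r ler_pdivrMr ?exprn_gt0// ler_peMr ?ltW//; lra.
    - rewrite -rE /log2 [ln (h ^+ 2 * _)]lnM ?posrE ?exprn_gt0 ?divr_gt0 ?exprn_gt0//.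
      rewrite [ln (h ^+ 2)]lnXn// ln_div ?posrE ?exprn_gt0// ln2E mulr2n.
      by field; rewrite gt_eqF.
  case: ifP => // /andP[s1' sP] [rE].
  have s0 : 0 < v by lra.
  have w0 : 0 < (v + 2 * h) / (2 * v) by apply: divr_gt0; lra.
  have W2 : 0 < ((v + 2 * h) / (2 * v)) ^+ 2 * v by rewrite mulr_gt0 ?(exprn_gt0 2 w0).
  have W5 : 0 < ((v + 2 * h) / (2 * v)) ^+ 2 * v / 2 ^+ 5.
    by rewrite divr_gt0 ?exprn_gt0.
  have E : (2^-1 * log2 h + 2^-1 * log2 (2^-1 + (P + 2) / (2 * v)) +
      4^-1 * log2 v - 5 / 4) * ln 2 =
      4^-1 * ln (h ^+ 2 * (((v + 2 * h) / (2 * v)) ^+ 2 * v / 2 ^+ 5)).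
    have -> : 2^-1 + (P + 2) / (2 * v) = (v + 2 * h) / (2 * v).
      by rewrite /h; field; rewrite gt_eqF.
    rewrite [ln (h ^+ 2 * _)]lnM ?posrE ?exprn_gt0//.
    rewrite [ln (_ / 2 ^+ 5)]ln_div ?posrE ?exprn_gt0//.
    rewrite [ln (_ ^+ 2 * v)]lnM ?posrE ?exprn_gt0// ln2E !lnXn// !mulr2n /log2.
    by field; rewrite gt_eqF.
  (* The choice [p = v - 1] is allowed only while [v <= 1 + P / 2]. Beyond that [p] is capped at
     [P / 2], and the factor 2^-5 absorbs the loss since [v < P + 1]. *)
  have [sh|hs] := leP v h.
    rewrite rE in E; apply: (key (v - 1) _ _ _ _ E).
    - by move: sh; rewrite /h; lra.
    - exact: W5.
    - have -> : 1 + (v - 1) = v by ring.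
      have -> : ((v + 2 * h) / (2 * v)) ^+ 2 * v / 2 ^+ 5 = (v + 2 * h) ^+ 2 / 32 * (4 * v)^-1.
        by field; rewrite gt_eqF.
      have -> : ((h + v) / (v + v)) ^+ 2 * v = (h + v) ^+ 2 * (4 * v)^-1.
        by field; rewrite -mulr2n mulrn_eq0 gt_eqF.
      have i0 : 0 < (4 * v)^-1 by rewrite invr_gt0; lra.
      by rewrite ler_pM2r//; nra.
  rewrite rE in E; apply: (key (P / 2) _ _ _ _ E).
  - by rewrite lexx divr_ge0// ltW.
  - exact: W5.
  - rewrite -/h divff ?gt_eqF//; last by lra.
    rewrite expr1n mul1r.
    have -> : ((v + 2 * h) / (2 * v)) ^+ 2 * v / 2 ^+ 5 = (v + 2 * h) ^+ 2 / (128 * v).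
      by field; rewrite gt_eqF.
    have s4h : v + 2 * h <= 4 * h by rewrite /h; move: sP; lra.
    have : (v + 2 * h) ^+ 2 <= (4 * h) ^+ 2 by rewrite ler_sqr ?nnegrE//; lra.
    have d0 : 0 < 128 * v by lra.
    rewrite ler_pdivrMr//.
    by have : h * h <= h * v by [rewrite ler_pM2l// ltW]; nra.
move=> p0P K0 Kle rE; have [al al01 le] := rate_IN_B_half_ge p0P K0 Kle.
by exists al => //; rewrite -(ler_pM2r l2) rE.
Qed.

End main_bounds.

(** * Attainment of the maximum over the unit square *)

Section rate_maximum.
Variable R : realType.
Variables (P Q Delta : R).
Hypotheses (P_gt0 : 0 < P) (Q_gt0 : 0 < Q).
Local Notation s := (sin Delta ^+ 2 * Q).

Lemma continuous_log2 (T : topologicalType) (f : T -> R) (w : T) :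
  0 < f w -> {for w, continuous f} -> {for w, continuous (fun x => log2 (f x))}.
Proof.
move=> fw cf; apply: (@continuousM R T (fun x => ln (f x)) (cst (ln 2)^-1)).
  exact: (@continuous_comp _ _ _ f (@ln R) w cf (continuous_ln fw)).
exact: cst_continuous.
Qed.

(** On the unit square every logarithm has a positive argument and every denominator is positive. *)
Lemma continuous_rate_IN_B (w : R * R) : 0 <= w.1 <= 1 -> 0 <= w.2 <= 1 ->
  {for w, continuous (fun w => rate_IN_B P Q Delta w.1 w.2)}.
Proof.
move=> /andP[a0 a1] /andP[b0 b1].
have s_ge0 : 0 <= s by rewrite mulr_ge0 ?sqr_ge0// ltW.
rewrite /rate_IN_B /=; move: (s) s_ge0 => v v0.
have c1 : {for w, continuous (@fst R R)} by exact: cvg_fst.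
have c2 : {for w, continuous (@snd R R)} by exact: cvg_snd.
have cc (k : R) : {for w, continuous (fun _ : R * R => k)} by exact: cst_continuous.
have c1' : {for w, continuous (fun u : R * R => 1 - u.1)} by exact: continuousB.
have c2' : {for w, continuous (fun u : R * R => 1 - u.2)} by exact: continuousB.
have cx : {for w, continuous (fun u : R * R => (1 - u.2) * P)} by exact: continuousM.
have cq : {for w, continuous (fun u : R * R => u.1 * u.2 * P)}.
  by apply: continuousM => //; exact: continuousM.
have cp : {for w, continuous (fun u : R * R => (1 - u.1) * u.2 * P)}.
  by apply: continuousM => //; exact: continuousM.
have x0 : 0 <= (1 - w.2) * P by apply: mulr_ge0 (ltW P_gt0); lra.
have q0 : 0 <= w.1 * w.2 * P by rewrite !mulr_ge0// ltW.
have p0 : 0 <= (1 - w.1) * w.2 * P by apply: mulr_ge0 (ltW P_gt0); apply: mulr_ge0 b0; lra.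
have vp := mulr_ge0 v0 p0.
have cL (c : R) (f : R * R -> R) : 0 < f w -> {for w, continuous f} ->
    {for w, continuous (fun u => c * log2 (f u))}.
  by move=> fw cf; apply: continuousM => //; exact: continuous_log2.
apply: continuousD; first apply: continuousD; first apply: continuousD.
- by apply: cL; [lra|exact: continuousD].
- apply: cL.
    by have : 0 <= w.1 * w.2 * P / (1 + (1 - w.1) * w.2 * P + v) by [apply: divr_ge0; lra]; lra.
  apply: continuousD => //; apply: continuousM => //; apply: continuousV; first lra.
  by apply: continuousD => //; exact: continuousD.
- by apply: cL; [lra|exact: continuousD].
- apply: cL; first by rewrite lt_max ltr01.
  apply: continuous_max => //; apply: continuousM.
    by apply: continuousM; [exact: continuousD|apply: continuousD => //; exact: continuousD].
  apply: continuousV; first by rewrite gt_eqF//; lra.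
  apply: continuousD => //; apply: continuousD => //; apply: continuousD => //.
  exact: continuousM.
Qed.

Lemma rate_IN_B_has_max : exists al be, [/\ 0 <= al <= 1, 0 <= be <= 1 &
  forall a b, 0 <= a <= 1 -> 0 <= b <= 1 ->
    rate_IN_B P Q Delta a b <= rate_IN_B P Q Delta al be].
Proof.
pose I : set R := [set` `[0, 1]].
have cI : compact I by exact: segment_compact.
have Ic : {within I `*` I, continuous (fun w => rate_IN_B P Q Delta w.1 w.2)}.
  apply: continuous_in_subspaceT => w; rewrite inE => -[].
  by rewrite /I /= !in_itv /= => h1 h2; exact: continuous_rate_IN_B.
have I0 : (I `*` I) !=set0 by exists (0, 0); rewrite /I /= !in_itv /= !lexx ler01.
have [[al be]] := compact_EVT_max I0 (compact_setX cI cI) Ic.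
rewrite inE => -[]; rewrite /I /= !in_itv /= => h1 h2 M.
exists al, be; split=> // a b h3 h4; apply: (M (a, b)).
by rewrite inE; split; rewrite /= in_itv.
Qed.

End rate_maximum.

Theorem mainTheorem3 (R : realType) (P Q Delta : R)
    (P_gt0 : 0 < P) (Q_gt0 : 0 < Q) (Delta_bnd : 0 <= Delta <= pi / 2) :
  exists alpha beta : R,
    [/\ 0 <= alpha <= 1,
        0 <= beta <= 1,
        (forall a b : R, 0 <= a <= 1 -> 0 <= b <= 1 ->
           rate_IN_B P Q Delta a b <= rate_IN_B P Q Delta alpha beta),
        ((rate_IN_B P Q Delta alpha beta)%:E
           <= capacity P Q (circular_binomial Delta))%E &
        (forall r : R, rate_IN_APP_B P Q Delta = Some r ->
           r <= rate_IN_B P Q Delta alpha beta)].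
Proof.
have [al [be [al01 be01 M]]] := rate_IN_B_has_max Delta P_gt0 Q_gt0.
exists al, be; split=> //; first exact: rate_IN_B_le_capacity.
move=> r /(rate_IN_APP_B_le P_gt0 Q_gt0)[a a01 ra]; apply: le_trans ra _.
by apply: M => //; rewrite invr_ge0 ler0n invf_le1// ler1n.
Qed.
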